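(* Let $p_1,p_2>2$ and $1<r<2$ with $1/p_1+1/p_2=1/r$, and let $1/r+1/r'=1$. Let $f_1\in L^{p_1}(\mathbb R)$, $f_2\in L^{p_2}(\mathbb R)$ and $f_3\in L^{r'}(\mathbb R)$. Then $$\big|\Lambda_{\mathbf S^{(1)},m}(f_1,f_2,f_3)\big|\le C\|f_1\|_{p_1}\|f_2\|_{p_2}\|f_3\|_{r'},$$ where $C$ is independent of $m,f_1,f_2,f_3$.
   Context: $\widehat f(\xi)=\int f(x)e^{-2\pi i x\xi}dx$. Let $L_1,L_2$ be positive integers, $M_1,M_2$ integers, $m$ a nonnegative integer. Put $A_{\ell,j}=2^{L_\ell j+M_\ell}$ for $\ell\in\{1,2\}$, $j\in\mathbb Z$. Frequency pieces. $\Phi_1$ is a fixed Schwartz function with $\widehat\Phi_1$ a standard bump function supported on $[1/2,2]$. For $\ell\in\{1,2\}$: $\omega'_{\ell,j}=\{\xi:A_{\ell,j}/2\le|\xi|\le 2A_{\ell,j}\}$ and $f^0_{\ell,j}=f_\ell*\Phi^0_{\ell,j}$ with $\widehat{\Phi^0_{\ell,j}}(\xi)=\widehat\Phi_1(\xi/A_{\ell,j})$. For $\ell=3$: $f^0_{3,j}=f_3*\Phi_{3,j}$, where $\Phi_{3,j}$ is Schwartz with $\widehat\Phi_{3,j}$ a bump function adapted to $\omega'_{3,j}$, and: if $A_{2,j}<A_{1,j}/8$, $\omega'_{3,j}=\{A_{1,j}/8\le|\xi|\le 19A_{1,j}/8\}$ and $\widehat\Phi_{3,j}=1$ for $A_{1,j}/4\le|\xi|\le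 9A_{1,j}/4$; if $A_{1,j}<A_{2,j}/8$, the same with $A_{2,j}$ in place of $A_{1,j}$; if $A_{1,j}/8\le A_{2,j}\le 8A_{1,j}$, $\omega'_{3,j}=\{|\xi|\le 18\max(A_{1,j},A_{2,j})\}$ and $\widehat\Phi_{3,j}=1$ for $|\xi|\le 17\max(A_{1,j},A_{2,j})$. Translations: $\mathrm{Tr}_{\ell,j,m}(x)=x+m_{j\ell}$ with $m_{j\ell}=2^{m-jL_\ell-M_\ell}$ for $\ell\in\{1,2\}$, $m_{j3}=0$. Time localization: $\psi\ge0$ is a fixed Schwartz function with $\widehat\psi$ supported in $[-1/100,1/100]$, $\widehat\psi(0)=1$; $\psi_k(x)=2^k\psi(2^kx)$. $k_{j\ell}$ is an integer with $|\omega'_{\ell,j}|\sim2^{k_{j\ell}}$ (comparable up to absolute constants), $k_j=\min_{\ell}k_{j\ell}$, $I_{k_j,n}=[2^{-k_j}n,2^{-k_j}(n+1)]$, $\mathbf 1^*_{j,n}=\mathbf 1_{I_{k_j,n}}*\psi_{k_j}$. Forms: for $0\le\gamma<2^{100}$ an integer, $\mathbb Z(\gamma)$ is the set of integers congruent to $\gamma$ mod $2^{100}$. For a set $\mathbf S\subset\mathbb Z(\gamma)\times\mathbb Z$, $\mathbf S_j=\{n:(j,n)\in\mathbf S\}$ and $$\Lambda_{\mathbf S,m}(f_1,f_2,f_3)=\int_{\mathbb R}\sum_{j\in\mathbb Z}\prod_{\ell=1}^3\sum_{n\in\mathbf S_j}\big(\mathbf 1^*_{j,n}f^0_{\ell,j}\big)\big(\mathrm{Tr}_{\ell,j,m}(x)\big)\,dx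 .$$ Given such $\mathbf S$, $\mathbf S^{(1)}=\{(j,n)\in\mathbf S:\ |\omega'_{2,j}|\le|\omega'_{1,j}|/10\ \text{or}\ |\omega'_{1,j}|\le|\omega'_{2,j}|/10\}$, where $|\cdot|$ is Lebesgue measure. *)

(* Defs.v *)
From mathcomp Require Import all_boot all_order all_algebra.
From mathcomp Require Import all_classical all_reals all_analysis.
From mathcomp Require Import complex.

Set Implicit Arguments.
Unset Strict Implicit.
Unset Printing Implicit Defensive.
Import Order.TTheory GRing.Theory Num.Theory.
Import numFieldNormedType.Exports.

Local Open Scope classical_set_scope.
Local Open Scope complex_scope.
Local Open Scope ring_scope.

Section Defs.
Variable R : realType.
Implicit Types (f g : R -> R[i]) (x y xi A p c : R) (j k n M : int).
Local Notation mu := (@lebesgue_measure R).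

(* The modulus as a real number; `|z| would be an element of R[i]. *)
Definition cabs (z : R[i]) : R := ComplexField.Normc.normc z.

Definition cint f : R[i] :=
  (\int[mu]_x complex.Re (f x)) +i* (\int[mu]_x complex.Im (f x)).

(* Unordered sum of an absolutely convergent family over a set, as the
   difference of the sums of its positive and negative parts. *)
Definition rsum (I : choiceType) (D : set I) (a : I -> R) : R :=
  fine (\esum_(i in D) (Num.max (a i) 0)%:E)
  - fine (\esum_(i in D) (Num.max (- a i) 0)%:E).

Definition csum (I : choiceType) (D : set I) (a : I -> R[i]) : R[i] :=
  rsum D (fun i => complex.Re (a i)) +i* rsum D (fun i => complex.Im (a i)).

Definition convolution f g : R -> R[i] := fun x => cint (fun y => f y * g (x - y)).

Definition fourier f : R -> R[i] := fun xi =>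
  cint (fun x => f x * (cos (2 * pi * x * xi) -i* sin (2 * pi * x * xi))).

Definition Lpnorm p f : \bar R := Lnorm mu p%:E (fun x => (cabs (f x))%:E).

Definition in_Lp p f : Prop :=
  [/\ measurable_fun setT (fun x => complex.Re (f x)),
      measurable_fun setT (fun x => complex.Im (f x)) &
      (Lpnorm p f < +oo)%E].

Definition cderiv (d : nat) f : R -> R[i] := fun x =>
  derive1n d (fun t => complex.Re (f t)) x
  +i* derive1n d (fun t => complex.Im (f t)) x.

Definition smooth f : Prop := forall (d : nat) x,
  derivable (derive1n d (fun t => complex.Re (f t))) x 1 /\
  derivable (derive1n d (fun t => complex.Im (f t))) x 1.

Definition schwartz f : Prop :=
  smooth f /\ forall a d : nat, exists C : R, forall x,
    `|x| ^+ a * cabs (cderiv d f x) <= C.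

Definition supported_in f (E : set R) : Prop := forall x, ~ E x -> f x = 0.

(* The derivative bounds are uniform over the family. *)
Definition adapted_bumps (phi : int -> R -> R[i]) (omega : int -> set R) :=
  [/\ forall j, smooth (phi j),
      forall j, supported_in (phi j) (omega j) &
      forall d : nat, exists C : R, forall j xi,
        cabs (cderiv d (phi j) xi) <= C * (fine (mu (omega j))) ^- d].

Definition annulus (a b : R) : set R := [set xi | a <= `|xi| <= b].

Definition Adyad (L : nat) M j : R := 2 ^ (L%:Z * j + M).

Definition omega12 (L : nat) M j : set R :=
  annulus (Adyad L M j / 2) (2 * Adyad L M j).

Definition omega3 (L1 L2 : nat) (M1 M2 : int) j : set R :=
  let A1 := Adyad L1 M1 j in let A2 := Adyad L2 M2 j in
  if A2 < A1 / 8 then annulus (A1 / 8) (19 * A1 / 8)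
  else if A1 < A2 / 8 then annulus (A2 / 8) (19 * A2 / 8)
  else [set xi | `|xi| <= 18 * Num.max A1 A2].

(* The part of omega3 on which the Fourier transform of Phi3 equals 1. *)
Definition plateau3 (L1 L2 : nat) (M1 M2 : int) j : set R :=
  let A1 := Adyad L1 M1 j in let A2 := Adyad L2 M2 j in
  if A2 < A1 / 8 then annulus (A1 / 4) (9 * A1 / 4)
  else if A1 < A2 / 8 then annulus (A2 / 4) (9 * A2 / 4)
  else [set xi | `|xi| <= 17 * Num.max A1 A2].

Definition comparable_sizes c (omega : int -> set R) (k : int -> int) : Prop :=
  forall j, ((c^-1 * 2 ^ k j)%:E <= mu (omega j))%E /\
            (mu (omega j) <= (c * 2 ^ k j)%:E)%E.

Definition kmin (k1 k2 k3 : int -> int) : int -> int := fun j =>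
  Num.min (k1 j) (Num.min (k2 j) (k3 j)).

Definition dilate (psi : R -> R) k : R -> R := fun x => 2 ^ k * psi (2 ^ k * x).

(* The time interval I_{k,n}. *)
Definition dyadic k n : set R := `[2 ^ (- k) * n%:~R, 2 ^ (- k) * (n + 1)%:~R].

Definition one_star (psi : R -> R) k n : R -> R[i] :=
  convolution (fun y => (\1_(dyadic k n) y)%:C) (fun y => (dilate psi k y)%:C).

Definition slice (S : set (int * int)) j : set int := [set n | S (j, n)].

(* The factor of the form attached to one index, before translation;
   k is the common scale of the time intervals. *)
Definition localized (psi : R -> R) (k : int -> int) (S : set (int * int))
    (Phi : int -> R -> R[i]) f j : R -> R[i] := fun x =>
  csum (slice S j) (fun n => one_star psi (k j) n x * convolution f (Phi j) x).

Definition Tr (L : nat) M (m : nat) j x : R := x + 2 ^ (m%:Z - j * L%:Z - M).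

Definition Lambda (L1 L2 : nat) (M1 M2 : int) (psi : R -> R) (k : int -> int)
    (Phi1 Phi2 Phi3 : int -> R -> R[i]) (S : set (int * int)) (m : nat)
    (f1 f2 f3 : R -> R[i]) : R[i] :=
  cint (fun x => csum [set: int] (fun j =>
    localized psi k S Phi1 f1 j (Tr L1 M1 m j x) *
    localized psi k S Phi2 f2 j (Tr L2 M2 m j x) *
    localized psi k S Phi3 f3 j x)).

Definition Zclass (gamma : int) : set int :=
  [set j | (j = gamma %[mod 2%:Z ^+ 100])%Z].

(* The set S^(1): the first two frequency supports have very different sizes. *)
Definition lacunary_part (L1 L2 : nat) (M1 M2 : int) (S : set (int * int)) :
    set (int * int) :=
  [set jn | S jn /\
    ((mu (omega12 L2 M2 jn.1) <= (10^-1)%:E * mu (omega12 L1 M1 jn.1))%E \/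
     (mu (omega12 L1 M1 jn.1) <= (10^-1)%:E * mu (omega12 L2 M2 jn.1))%E)].

End Defs.

(* Main.v *)
(* On [S^(1)] the frequency supports of each family are pairwise disjoint annuli (for the third
   one, after separating the indices with [A_2 < A_1 / 8] from those with [A_1 < A_2 / 8]), so that
   no cancellation between the scales is needed.
   For [p > 2] the operator [f |-> (f * Phi_j)_j] maps [L^p] into [L^p(l^p)]: by Plancherel
   and disjointness for [p = 2], by the uniform bound on [||Phi_j||_1] for [p = oo], and by real
   interpolation in between.  The norm of [L^p(l^p)] is invariant under translations depending on [j],
   hence the translations, and with them [m], play no role: since [1/p1 + 1/p2 + 1/r' = 1] and
   all three exponents exceed 2, Hoelder's inequality in [(x, j)] gives the estimate.  The time
   localizations are harmless because the functions [1*_{j,n}] add up to at most 2.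

   Plancherel is obtained for real functions by pairing [|g^|^2] with [exp (- e xi)] on the half-line,
   whose cosine transform is the Poisson kernel, and letting [e] tend to 0. *)
Require Import Defs.
From HB Require Import structures.
From mathcomp Require Import all_boot all_order all_algebra.
From mathcomp Require Import all_classical all_reals all_analysis.
From mathcomp Require Import complex.
From mathcomp Require Import measurable_realfun ring lra.

Set Implicit Arguments.
Unset Strict Implicit.
Unset Printing Implicit Defensive.
Import Order.TTheory GRing.Theory Num.Theory.
Import numFieldNormedType.Exports.

Local Open Scope classical_set_scope.
Local Open Scope complex_scope.
Local Open Scope ring_scope.

(** * Integrals over the line *)

Section basics.
Context {R : realType}.
Local Notation mu := (@lebesgue_measure R).
Implicit Types (f g u K : R -> R) (a b t x y : R).

(** Everything quantitative is proved for real functions. A complex convolution splits into four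
    real ones, and the cosine and sine transforms of the real and imaginary parts of a kernel
    combine its Fourier transform at [xi] and [- xi]; so the frequency sets are taken symmetric, and
    the half-line carries half of the energy, whence the factors 1/2. The uniform bound of the
    kernels in L^1 has to come from transforms known only to be bounded by [B], supported in a set
    of measure at most [w], and Lipschitz with constant [B / w]. Plancherel then bounds [K] and
    [x * K x] in L^2, and the powers of [w] cancel. A function in L^p with [p > 2] lies in general
    neither in L^1 nor in L^2, so Plancherel is applied only to its part above a level; cutting at
    varying levels is also what performs the interpolation. All estimates are for finite lists of
    distinct scales, with constants independent of the list; the sum over all scales enters at the
    end by monotone convergence. *)

Lemma measurable_affine a b : measurable_fun setT (fun x => a * x + b).
Proof.
by apply: measurable_funD => //; exact: measurable_funM.
Qed.

(** The scaled pushforward of [mu] gives half-open intervals their length, which characterizes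
    Lebesgue measure. For [a < 0] the preimage is closed at the other end, hence the two cases. *)
Lemma lebesgue_measure_affine a b (A : set R) : a != 0 -> measurable A ->
  mu ((fun x => a * x + b) @^-1` A) = (`|a|^-1%:E * mu A)%E.
Proof.
move=> a0 mA.
pose phi := (fun x => a * x + b) : R -> measurableTypeR R.
have mphi : measurable_fun [set: measurableTypeR R] phi by exact: measurable_affine.
suff -> : mu A = (`|a|%:E * mu (phi @^-1` A))%E.
  by rewrite muleA -EFinM mulVf ?normr_eq0// mul1e.
unshelve refine (@lebesgue_measure_unique _ (mscale (NngNum (normr_ge0 a)) (pushforward mu phi)) _ _ mA).
  exact: mphi.
move=> // _ [[x y]] _ <-.
change (mu `]x, y] = (`|a|%:E * mu (phi @^-1` `]x, y]))%E).
have [a_gt0|a_le0] := ltP 0 a.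
  rewrite [X in (_ * mu X)%E](_ : _ = `](x - b) / a, (y - b) / a]%classic).
    rewrite !lebesgue_measure_itv/= !lte_fin ltr_pM2r ?invr_gt0// ltrD2r gtr0_norm//.
    by case: ifP => _; rewrite ?mule0// -!EFinD -EFinM; congr EFin; field.
  apply/seteqP; split => z/=; rewrite !in_itv/= /phi ltr_pdivrMr// ler_pdivlMr//;
    by move=> /andP[? ?]; apply/andP; split; lra.
have a_lt0 : a < 0 by rewrite lt_neqAle a0.
rewrite [X in (_ * mu X)%E](_ : _ = `[(y - b) / a, (x - b) / a[%classic).
  rewrite !lebesgue_measure_itv/= !lte_fin ltr_nM2r ?invr_lt0// ltrD2r ltr0_norm//.
  by case: ifP => _; rewrite ?mule0// -!EFinD -EFinM; congr EFin; field.
apply/seteqP; split => z/=; rewrite !in_itv/= /phi ltr_ndivlMr// ler_ndivrMr//;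
  by move=> /andP[? ?]; apply/andP; split; lra.
Qed.

Lemma ge0_integral_affine a b (f : R -> \bar R) : a != 0 ->
  measurable_fun setT f -> (forall x, 0 <= f x)%E ->
  (\int[mu]_x f (a * x + b)%R = `|a|^-1%:E * \int[mu]_x f x)%E.
Proof.
move=> a0 mf f0.
pose phi := (fun x => a * x + b) : measurableTypeR R -> measurableTypeR R.
have mphi : measurable_fun setT phi by exact: measurable_affine.
have := @ge0_integral_pushforward _ _ _ _ _ _ mphi mu setT f measurableT mf (fun y _ => f0 y).
rewrite preimage_setT => <-.
have ia : 0 <= `|a|^-1 by rewrite invr_ge0.
rewrite -(ge0_integral_mscale _ measurableT (NngNum ia))//.
apply: eq_measure_integral => A mA _; exact: lebesgue_measure_affine.
Qed.

Definition L1 f := mu.-integrable setT (EFin \o f).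

Lemma L1P f : L1 f <-> mu.-integrable setT (EFin \o f).
Proof. by []. Qed.

Lemma L1_measurable f : L1 f -> measurable_fun setT f.
Proof. by move=> /measurable_int/measurable_EFinP. Qed.

Lemma L1_le f g : measurable_fun setT f -> (forall x, `|f x| <= g x) -> L1 g -> L1 f.
Proof.
move=> mf fg; apply: le_integrable => //; first exact/measurable_EFinP.
by move=> x _ /=; rewrite lee_fin (le_trans (fg x))// ler_norm.
Qed.

Lemma L1D f g : L1 f -> L1 g -> L1 (fun x => f x + g x).
Proof. by move=> lf lg; exact: (integrableD measurableT lf lg). Qed.

Lemma L1Z k f : L1 f -> L1 (fun x => k * f x).
Proof. by move=> lf; exact: (integrableZl measurableT k lf). Qed.

Lemma L1B f g : L1 f -> L1 g -> L1 (fun x => f x - g x).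
Proof. by move=> lf lg; exact: (integrableB measurableT lf lg). Qed.

Lemma L1_norm f : L1 f -> L1 (fun x => `|f x|).
Proof. by move=> /integrable_norm. Qed.

Lemma L1_bounded_mul f (h : R -> R) M : L1 f -> measurable_fun setT h ->
  (forall x, `|h x| <= M) -> L1 (fun x => f x * h x).
Proof.
move=> lf mh hM; apply: (@L1_le _ (fun x => M * `|f x|)).
- by apply: measurable_funM => //; exact: L1_measurable.
- by move=> x; rewrite normrM mulrC ler_wpM2r.
- exact/L1Z/L1_norm.
Qed.

Lemma L1_affine a b f : a != 0 -> L1 f -> L1 (fun x => f (a * x + b)).
Proof.
move=> a0 lf; have mf := L1_measurable lf; move/integrableP : (lf) => [_ lfoo].
apply/integrableP; split.
  by apply/measurable_EFinP; apply: measurableT_comp => //; exact: measurable_affine.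
rewrite (ge0_integral_affine b a0 (f := fun x => `|(f x)%:E|%E))//; last first.
  by apply/measurable_EFinP; exact: measurableT_comp.
by rewrite lte_mul_pinfty// lee_fin invr_ge0.
Qed.

Lemma Rintegral_fine f : \int[mu]_x f x = fine (\int[mu]_x (f x)%:E)%E.
Proof. by []. Qed.

Lemma EFin_Rintegral f : L1 f -> (\int[mu]_x f x)%:E = (\int[mu]_x (f x)%:E)%E.
Proof. by move=> lf; rewrite fineK//; exact: integrable_fin_num. Qed.

Lemma Rintegral_affine a b f : a != 0 -> L1 f ->
  \int[mu]_x f (a * x + b) = `|a|^-1 * \int[mu]_x f x.
Proof.
move=> a0 lf; have mf := L1_measurable lf.
apply: EFin_inj; rewrite EFinM !EFin_Rintegral//; last exact: L1_affine.
rewrite [in LHS]integralE [in RHS]integralE muleBr//; last first.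
  by apply: fin_num_adde_defr; exact: integrable_pos_fin_num.
congr (_ - _)%E.
  rewrite -(ge0_integral_affine b a0 (f := (fun x => (f x)%:E)^\+%E))//; last exact/measurable_funepos/measurable_EFinP.
  by apply: eq_integral => x _; rewrite !funeposE.
rewrite -(ge0_integral_affine b a0 (f := (fun x => (f x)%:E)^\-%E))//; last exact/measurable_funeneg/measurable_EFinP.
by apply: eq_integral => x _; rewrite !funenegE.
Qed.

Lemma L1_reflect x f : L1 f -> L1 (fun y => f (x - y)).
Proof.
have n0 : -1 != 0 :> R by rewrite oppr_eq0 oner_eq0.
by move=> /(L1_affine x n0); under eq_fun do rewrite mulN1r addrC.
Qed.

Lemma Rintegral_reflect x f : L1 f -> \int[mu]_y f (x - y) = \int[mu]_y f y.
Proof.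
have n0 : -1 != 0 :> R by rewrite oppr_eq0 oner_eq0.
move=> /(Rintegral_affine x n0); rewrite normrN1 invr1 mul1r => <-.
by apply: eq_Rintegral => y _; rewrite mulN1r addrC.
Qed.

Lemma L1_shift t f : L1 f -> L1 (fun y => f (y + t)).
Proof.
by move=> /(L1_affine t (oner_neq0 R)); under eq_fun do rewrite mul1r.
Qed.

Lemma Rintegral_shift t f : L1 f -> \int[mu]_y f (y + t) = \int[mu]_y f y.
Proof.
move=> /(Rintegral_affine t (oner_neq0 R)); rewrite normr1 invr1 mul1r => <-.
by apply: eq_Rintegral => y _; rewrite mul1r.
Qed.

Lemma ge0_integral_shift t (f : R -> \bar R) :
  measurable_fun setT f -> (forall x, 0 <= f x)%E ->
  (\int[mu]_x f (x + t)%R = \int[mu]_x f x)%E.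
Proof.
move=> mf f0; have := ge0_integral_affine t (oner_neq0 R) mf f0.
rewrite normr1 invr1 mul1e => <-.
by apply: eq_integral => y _; rewrite mul1r.
Qed.

Lemma Rintegral_le f g : L1 f -> L1 g -> (forall x, f x <= g x) ->
  \int[mu]_x f x <= \int[mu]_x g x.
Proof. by move=> lf lg fg; exact: le_Rintegral. Qed.

Lemma Rintegral_normr_le f g : L1 f -> L1 g -> (forall x, `|f x| <= g x) ->
  `|\int[mu]_x f x| <= \int[mu]_x g x.
Proof.
move=> lf lg fg; apply: le_trans (le_normr_Rintegral measurableT lf) _.
by apply: Rintegral_le => //; exact: L1_norm.
Qed.

Lemma RintegralDE f g : L1 f -> L1 g ->
  \int[mu]_x (f x + g x) = \int[mu]_x f x + \int[mu]_x g x.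
Proof. by move=> lf lg; rewrite RintegralD. Qed.

Lemma RintegralBE f g : L1 f -> L1 g ->
  \int[mu]_x (f x - g x) = \int[mu]_x f x - \int[mu]_x g x.
Proof. by move=> lf lg; rewrite RintegralB. Qed.

Lemma RintegralZE k f : L1 f -> \int[mu]_x (k * f x) = k * \int[mu]_x f x.
Proof. by move=> lf; rewrite RintegralZl. Qed.

(** Tonelli turns the integrable bound [b] on the inner integrals of [|F|] into joint integrability.
    Integrability of every section makes the real-valued inner integrals agree with the extended
    ones at every point. *)
Lemma Rintegral_fubini (F : R -> R -> R) (b : R -> R) :
  measurable_fun setT (fun z : R * R => F z.1 z.2) ->
  (forall x, L1 (F x)) -> (forall y, L1 (F ^~ y)) -> L1 b ->
  (forall y, \int[mu]_x `|F x y| <= b y) ->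
  [/\ L1 (fun x => \int[mu]_y F x y), L1 (fun y => \int[mu]_x F x y) &
      \int[mu]_x \int[mu]_y F x y = \int[mu]_y \int[mu]_x F x y].
Proof.
move=> mF Fx Fy lb Fb.
have imF : (mu \x mu)%E.-integrable setT (fun z : R * R => (F z.1 z.2)%:E).
  apply/integrable21ltyP; first exact/measurable_EFinP.
  move/integrableP : (lb) => [_]; apply: le_lt_trans.
  apply: ge0_le_integral => //.
  - by move=> y _; exact: integral_ge0.
  - apply: (@measurable_fun_fubini_tonelli_G _ _ _ _ _ mu (fun z : R * R => `|(F z.1 z.2)%:E|%E)) => //.
    by apply/measurable_EFinP; exact: measurableT_comp.
  - by apply/measurable_EFinP; apply: measurableT_comp => //; exact: L1_measurable.
  - move=> y _ /=; rewrite -EFin_Rintegral ?lee_fin; last exact/L1_norm/Fy.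
    exact: le_trans (Fb y) (ler_norm _).
have E1 : (fun x => (\int[mu]_y F x y)%:E) = fubini_F mu (fun z : R * R => (F z.1 z.2)%:E).
  by apply/funext => x; rewrite EFin_Rintegral.
have E2 : (fun y => (\int[mu]_x F x y)%:E) = fubini_G mu (fun z : R * R => (F z.1 z.2)%:E).
  by apply/funext => y; rewrite EFin_Rintegral//; exact: Fy.
split.
- rewrite /L1 /comp E1; exact: integrable_fubini_F imF.
- apply: L1_le lb.
    by apply/measurable_EFinP; rewrite /comp E2; exact: measurable_fubini_G imF.
  move=> y; apply: le_trans (Fb y).
  by apply: le_normr_Rintegral => //; exact: Fy.
- have := Fubini imF; rewrite /= => FE; rewrite {1 3}/Rintegral; congr fine.
  under eq_integral do rewrite EFin_Rintegral//.
  rewrite FE; apply: eq_integral => y _.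
  by rewrite EFin_Rintegral//; exact: Fy.
Qed.

End basics.

(** * Limits under the integral sign *)

Section limits.
Context {R : realType}.
Local Notation mu := (@lebesgue_measure R).
Implicit Types (f g u K w : R -> R) (a b t x y xi : R).

Lemma Rintegral_dominated_cvg (f_ : nat -> R -> R) f g :
  (forall n, measurable_fun setT (f_ n)) ->
  (forall x, f_ n x @[n --> \oo] --> f x) -> L1 g ->
  (forall n x, `|f_ n x| <= g x) ->
  \int[mu]_x f_ n x @[n --> \oo] --> \int[mu]_x f x.
Proof.
move=> mf ff lg fg.
have mf' : measurable_fun setT f by apply: (@measurable_fun_cvg _ _ _ _ f_) => // x _; exact: ff.
have ff' x : [set: R] x -> (f_ n x)%:E @[n --> \oo] --> (f x)%:E.
  by move=> _; apply: cvg_EFin; [exact: nearW|exact: ff].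
have lf : L1 f.
  apply: L1_le lg => // x.
  have nff : `|f_ n x| @[n --> \oo] --> `|f x| by exact: (cvg_norm (ff x)).
  rewrite -(cvg_lim _ nff)//; apply: limr_le; first by apply/cvg_ex; exists `|f x|.
  by apply: nearW => n; exact: fg.
have lfn n : L1 (f_ n) by apply: L1_le lg.
apply: fine_cvg; rewrite EFin_Rintegral//.
apply: (@dominated_cvg _ _ _ mu setT measurableT (fun n x => (f_ n x)%:E) _ (EFin \o g)) => //.
  by move=> n; apply/measurable_EFinP; exact: mf.
by move=> n x _; rewrite lee_fin; exact: fg.
Qed.

(** Fatou's lemma. The integrals are extended reals because the integrability of the limit is part
    of what is to be shown. *)
Lemma integral_le_limit (f_ : nat -> R -> R) f (M : \bar R) :
  (forall n, measurable_fun setT (f_ n)) -> (forall n x, 0 <= f_ n x) ->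
  (forall x, f_ n x @[n --> \oo] --> f x) ->
  (forall n, \int[mu]_x (f_ n x)%:E <= M)%E ->
  (\int[mu]_x (f x)%:E <= M)%E.
Proof.
move=> mf f0 ff fM.
have E x : limn_einf (fun n => (f_ n x)%:E) = (f x)%:E.
  have : (f_ n x)%:E @[n --> \oo] --> (f x)%:E.
    by apply: cvg_EFin; [exact: nearW|exact: ff].
  by move/cvg_limn_einf_sup => [].
under eq_integral do rewrite -E.
apply: le_trans (fatou mu measurableT (f := fun n x => (f_ n x)%:E) _ _) _.
- by move=> n; apply/measurable_EFinP; exact: mf.
- by move=> n x _; rewrite lee_fin.
- rewrite limn_einf_lim; apply: lime_le; first exact: is_cvg_einfs.
  apply: nearW => n; apply: le_trans (fM n).
  by apply: ereal_inf_lbound; exists n => //=.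
Qed.

Lemma Rintegral_continuous (F : R -> R -> R) g :
  (forall t, measurable_fun setT (F t)) -> (forall x, continuous (F ^~ x)) ->
  L1 g -> (forall t x, `|F t x| <= g x) ->
  continuous (fun t => \int[mu]_x F t x).
Proof.
move=> mF cF lg Fg t; apply/(@cvg_nbhsP _ R^o) => s st.
apply: (@Rintegral_dominated_cvg (fun n => F (s n)) (F t) g) => // x.
by have /(@cvg_nbhsP _ R^o) := cF x t; exact.
Qed.
End limits.

(** * Fourier transform of real functions and Plancherel inequalities *)

Opaque L1 Rintegral.

Section transforms.
Context {R : realType}.
Local Notation mu := (@lebesgue_measure R).
Implicit Types (f g u K w : R -> R) (a b t x y xi : R).

Lemma Rintegral_fubini_prod (F : R -> R -> R) (a b : R -> R) :
  measurable_fun setT (fun z : R * R => F z.1 z.2) ->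
  L1 a -> L1 b -> (forall x, 0 <= a x) ->
  (forall x y, `|F x y| <= a x * b y) ->
  [/\ L1 (fun x => \int[mu]_y F x y), L1 (fun y => \int[mu]_x F x y) &
      \int[mu]_x \int[mu]_y F x y = \int[mu]_y \int[mu]_x F x y].
Proof.
move=> mF la lb a0 Fab.
have Fx x : L1 (F x).
  by apply: L1_le (Fab x) (L1Z (a x) lb); exact: measurableT_comp mF (pair1_measurable x).
have Fy y : L1 (F ^~ y).
  apply: L1_le (L1Z (b y) la).
    exact: measurableT_comp mF (pair2_measurable y).
  by move=> x; rewrite mulrC; exact: Fab.
apply: (@Rintegral_fubini _ F (fun y => (\int[mu]_x a x) * b y)) => //.
  exact: L1Z.
move=> y; rewrite mulrC -RintegralZE//; apply: Rintegral_le.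
- exact/L1_norm/Fy.
- exact: L1Z.
- by move=> x; rewrite mulrC; exact: Fab.
Qed.

Definition cosT g xi := \int[mu]_x (g x * cos (2 * pi * x * xi)).
Definition sinT g xi := \int[mu]_x (g x * sin (2 * pi * x * xi)).
(* [|g^(xi)|^2] for a real function [g]. *)
Definition pw g xi := cosT g xi ^+ 2 + sinT g xi ^+ 2.

Lemma pw_ge0 g xi : 0 <= pw g xi.
Proof. by rewrite addr_ge0 ?sqr_ge0. Qed.

Lemma normr_cos_le1 x : `|cos x| <= 1 :> R.
Proof. by rewrite ler_norml cos_geN1 cos_le1. Qed.

Lemma normr_sin_le1 x : `|sin x| <= 1 :> R.
Proof. by rewrite ler_norml sin_geN1 sin_le1. Qed.

Lemma continuous_cos_comp (c : R) : continuous (fun x => cos (c * x)).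
Proof. by move=> x; apply: continuous_comp; [exact: mulrl_continuous|exact: continuous_cos]. Qed.

Lemma continuous_sin_comp (c : R) : continuous (fun x => sin (c * x)).
Proof. by move=> x; apply: continuous_comp; [exact: mulrl_continuous|exact: continuous_sin]. Qed.

Lemma measurable_cosr xi : measurable_fun setT (fun x => cos (2 * pi * x * xi)).
Proof.
apply: continuous_measurable_fun; under eq_fun do rewrite mulrAC; exact: continuous_cos_comp.
Qed.

Lemma measurable_sinr xi : measurable_fun setT (fun x => sin (2 * pi * x * xi)).
Proof.
apply: continuous_measurable_fun; under eq_fun do rewrite mulrAC; exact: continuous_sin_comp.
Qed.

Lemma L1_cos g xi : L1 g -> L1 (fun x => g x * cos (2 * pi * x * xi)).
Proof.
move=> lg; apply: L1_bounded_mul lg (measurable_cosr xi) _ => x; exact: normr_cos_le1.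
Qed.

Lemma L1_sin g xi : L1 g -> L1 (fun x => g x * sin (2 * pi * x * xi)).
Proof.
move=> lg; apply: L1_bounded_mul lg (measurable_sinr xi) _ => x; exact: normr_sin_le1.
Qed.

Lemma cosT_le g xi : L1 g -> `|cosT g xi| <= \int[mu]_x `|g x|.
Proof.
move=> lg; apply: Rintegral_normr_le; [exact: L1_cos|exact: L1_norm|].
by move=> x; rewrite normrM ler_piMr// normr_cos_le1.
Qed.

Lemma sinT_le g xi : L1 g -> `|sinT g xi| <= \int[mu]_x `|g x|.
Proof.
move=> lg; apply: Rintegral_normr_le; [exact: L1_sin|exact: L1_norm|].
by move=> x; rewrite normrM ler_piMr// normr_sin_le1.
Qed.

Lemma continuous_cosT g : L1 g -> continuous (cosT g).
Proof.
move=> lg; apply: (Rintegral_continuous (F := fun xi x => g x * cos (2 * pi * x * xi))).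
- by move=> xi; apply: L1_measurable; exact: L1_cos.
- by move=> x xi; apply: cvgMr; exact: continuous_cos_comp.
- exact: L1_norm lg.
- by move=> xi x; rewrite normrM ler_piMr// normr_cos_le1.
Qed.

Lemma continuous_sinT g : L1 g -> continuous (sinT g).
Proof.
move=> lg; apply: (Rintegral_continuous (F := fun xi x => g x * sin (2 * pi * x * xi))).
- by move=> xi; apply: L1_measurable; exact: L1_sin.
- by move=> x xi; apply: cvgMr; exact: continuous_sin_comp.
- exact: L1_norm lg.
- by move=> xi x; rewrite normrM ler_piMr// normr_sin_le1.
Qed.

Lemma measurable_pw g : L1 g -> measurable_fun setT (pw g).
Proof.
move=> lg; apply: measurable_funD; apply: measurable_funX.
  by apply: continuous_measurable_fun; exact: continuous_cosT.
by apply: continuous_measurable_fun; exact: continuous_sinT.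
Qed.

(** [pw g xi] is the double integral of [g x * g y * cos (2 * pi * (x - y) * xi)]; integrating in
    [xi] first turns the integrable weight [w] into its cosine transform at [x - y]. *)
Lemma pw_weighted w g : L1 w -> (forall xi, 0 <= w xi) -> L1 g ->
  \int[mu]_xi (w xi * pw g xi) =
  \int[mu]_x (g x * \int[mu]_y (g y * cosT w (x - y))).
Proof.
move=> lw w0 lg; set N := \int[mu]_x `|g x|.
have mg := L1_measurable lg; have mw := L1_measurable lw.
(* The inner integral over [y], written through [cosT] and [sinT] so that its boundedness and joint
   measurability can be read off. *)
pose H x xi := cos (2 * pi * x * xi) * cosT g xi + sin (2 * pi * x * xi) * sinT g xi.
have HE x xi : H x xi = \int[mu]_y (g y * cos (2 * pi * (x - y) * xi)).
  rewrite /H /cosT /sinT -!RintegralZE; [|exact: L1_sin|exact: L1_cos].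
  rewrite -RintegralDE; [|exact/L1Z/L1_cos|exact/L1Z/L1_sin].
  apply: eq_Rintegral => y _; rewrite mulrBr mulrBl cosB; ring.
have mcos x xi : measurable_fun setT (fun y => cos (2 * pi * (x - y) * xi)).
  apply: (measurableT_comp (measurable_cosr xi)); exact: measurable_funB.
have Hle x xi : `|H x xi| <= 2 * N.
  rewrite (_ : 2 * N = N + N); last by ring.
  rewrite (le_trans (ler_normD _ _))// !normrM.
  apply: lerD; rewrite -[leRHS]mul1r ler_pM// ?normr_cos_le1 ?normr_sin_le1//.
    exact: cosT_le.
  exact: sinT_le.
have mHx xi : measurable_fun setT (H ^~ xi).
  apply: measurable_funD; apply: measurable_funM => //.
    exact: measurable_cosr.
  exact: measurable_sinr.
have mH : measurable_fun setT (fun z : R * R => H z.2 z.1).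
  have mz : measurable_fun setT (fun z : R * R => 2 * pi * z.2 * z.1).
    by apply: measurable_funM => //; exact: measurable_funM.
  apply: measurable_funD; apply: measurable_funM.
  - exact: (measurableT_comp (continuous_measurable_fun (@continuous_cos R)) mz).
  - exact: measurableT_comp (continuous_measurable_fun (continuous_cosT lg)) measurable_fst.
  - exact: (measurableT_comp (continuous_measurable_fun (@continuous_sin R)) mz).
  - exact: measurableT_comp (continuous_measurable_fun (continuous_sinT lg)) measurable_fst.
transitivity (\int[mu]_xi \int[mu]_x (w xi * g x * H x xi)).
  apply: eq_Rintegral => xi _.
  have -> : pw g xi = \int[mu]_x (g x * H x xi).
    transitivity (\int[mu]_x (cosT g xi * (g x * cos (2 * pi * x * xi)) + sinT g xi * (g x * sin (2 * pi * x * xi)))).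
      rewrite RintegralDE; [|exact/L1Z/L1_cos|exact/L1Z/L1_sin].
      by rewrite !RintegralZE; [|exact: L1_sin|exact: L1_cos].
    by apply: eq_Rintegral => x _; rewrite /H; ring.
  rewrite -RintegralZE; last first.
    exact: L1_bounded_mul lg (mHx xi) (Hle ^~ xi).
  by apply: eq_Rintegral => x _; rewrite mulrA.
have mF : measurable_fun setT (fun z : R * R => w z.1 * g z.2 * H z.2 z.1).
  apply: measurable_funM; last exact: mH.
  by apply: measurable_funM; exact: measurableT_comp.
have Fle xi x : `|w xi * g x * H x xi| <= w xi * (2 * N * `|g x|).
  by rewrite !normrM ger0_norm// -mulrA ler_wpM2l// mulrC ler_wpM2r//.
have [_ _ ->] := Rintegral_fubini_prod (F := fun xi x => w xi * g x * H x xi)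
   mF lw (L1Z (2 * N) (L1_norm lg)) w0 Fle.
apply: eq_Rintegral => x _.
transitivity (\int[mu]_xi \int[mu]_y (g x * (w xi * g y * cos (2 * pi * (x - y) * xi)))).
  apply: eq_Rintegral => xi _; rewrite HE -RintegralZE; last first.
    by apply: L1_bounded_mul lg (mcos x xi) _ => y; exact: normr_cos_le1.
  by apply: eq_Rintegral => y _; ring.
have mF' : measurable_fun setT (fun z : R * R =>
    g x * (w z.1 * g z.2 * cos (2 * pi * (x - z.2) * z.1))).
  apply: measurable_funM => //; apply: measurable_funM.
    by apply: measurable_funM; exact: measurableT_comp.
  apply: (measurableT_comp (continuous_measurable_fun (@continuous_cos R))).
  apply: measurable_funM => //; apply: measurable_funM => //.
  exact: measurable_funB.
have Fle' xi y : `|g x * (w xi * g y * cos (2 * pi * (x - y) * xi))| <=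
    w xi * (`|g x| * `|g y|).
  rewrite !normrM (ger0_norm (w0 xi)) -!mulrA mulrCA ler_wpM2l//.
  by rewrite ler_wpM2l// ler_piMr// normr_cos_le1.
have [_ _ ->] := Rintegral_fubini_prod
    (F := fun xi y => g x * (w xi * g y * cos (2 * pi * (x - y) * xi)))
    mF' lw (L1Z _ (L1_norm lg)) w0 Fle'.
rewrite -RintegralZE; last first.
  apply: (L1_bounded_mul (M := \int[mu]_x `|w x|)) lg _ _.
    apply: measurableT_comp; last exact: measurable_funB.
    by apply: continuous_measurable_fun; exact: continuous_cosT.
  by move=> y; exact: cosT_le.
apply: eq_Rintegral => y _; rewrite /cosT -RintegralZE; last exact: L1_cos.
rewrite -RintegralZE; last exact/L1Z/L1_cos.
apply: eq_Rintegral => xi _; rewrite (_ : 2 * pi * (x - y) * xi = 2 * pi * xi * (x - y)); ring.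
Qed.
End transforms.

(** * The Poisson kernel as a cosine transform *)

Section poisson.
Context {R : realType}.
Local Notation mu := (@lebesgue_measure R).
Implicit Types (f g u K w : R -> R) (a b t x y xi : R).

Definition decay (e : R) : R -> R := (fun xi => expR (- e * xi)) \_ `[0, +oo[.
(** The Poisson kernel with total mass 1/2 instead of 1, since [decay] weights only the frequencies
    [xi >= 0]. *)
Definition poisson (e t : R) : R := e / (e ^+ 2 + (2 * pi * t) ^+ 2).

(** An antiderivative of [expR (- e * x) * (1 + cos (b * x))]. The summand 1 makes the integrand
    nonnegative, as the fundamental theorem on a half-line requires; the case [b = 0] yields the
    integral of the exponential alone, which is subtracted afterwards. *)
Let prim (e b x : R) := expR (- e * x) *
  ((b * sin (b * x) - e * cos (b * x)) / (e ^+ 2 + b ^+ 2) - e^-1).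

Let is_derive_prim (e b x : R) : 0 < e ->
  is_derive x 1 (prim e b) (expR (- e * x) * (1 + cos (b * x))).
Proof.
move=> e0; rewrite /prim; apply: is_derive_eq.
have eb0 : e ^+ 2 + b ^+ 2 != 0 by rewrite gt_eqF// ltr_pwDl ?exprn_gt0 ?sqr_ge0.
rewrite !scaler0 subr0 add0r.
rewrite /GRing.scale/=; field.
by rewrite gt_eqF.
Qed.

Lemma expR_decay_cvg0 (e : R) : 0 < e -> expR (- e * x) @[x --> +oo] --> (0 : R).
Proof.
move=> e0; under eq_fun do rewrite mulNr.
apply: (@cvg_comp _ _ _ (fun x => e * x) (fun x => expR (- x)) _ +oo); last exact: cvgr_expR.
apply/cvgryPge => A; near=> x.
by rewrite mulrC -ler_pdivrMr//; near: x; apply: nbhs_pinfty_ge; rewrite num_real.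
Unshelve. all: by end_near. Qed.

Let cvg_prim (e b : R) : 0 < e -> prim e b x @[x --> +oo] --> (0 : R).
Proof.
move=> e0; pose C := (`|b| + e) / (e ^+ 2 + b ^+ 2) + e^-1.
have C0 : 0 <= C by rewrite addr_ge0// ?invr_ge0 ?divr_ge0 ?addr_ge0 ?sqr_ge0// ltW.
have H : C * expR (- e * x) @[x --> +oo] --> (0 : R).
  by rewrite -[X in _ --> X](mulr0 C); apply: cvgMr; exact: expR_decay_cvg0.
apply/norm_cvg0P; apply: (squeeze_cvgr _ (cvg_cst 0) H).
apply: nearW => x; rewrite normr_ge0/= /prim normrM mulrC (ger0_norm (expR_ge0 _)) ler_wpM2r ?expR_ge0//.
have ie : 0 <= e^-1 by rewrite invr_ge0 ltW.
have id : 0 <= (e ^+ 2 + b ^+ 2)^-1 by rewrite invr_ge0 addr_ge0 ?sqr_ge0.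
apply: le_trans (ler_normB _ _) _; rewrite /C (ger0_norm ie) lerD2r.
rewrite normrM (ger0_norm id) ler_wpM2r//.
apply: le_trans (ler_normB _ _) _; rewrite !normrM (ger0_norm (ltW e0)) lerD//.
  by rewrite ler_piMr// normr_sin_le1.
by rewrite ler_piMr ?normr_cos_le1// ltW.
Qed.

Let continuous_prim' (e b : R) : continuous (fun x => expR (- e * x) * (1 + cos (b * x))).
Proof.
move=> x; apply: cvgM.
  apply: continuous_comp; [exact: mulrl_continuous|exact: continuous_expR].
by apply: cvgD; [exact: cvg_cst|exact: continuous_cos_comp].
Qed.

Let integral_decay_cos1 (e b : R) : 0 < e ->
  (\int[mu]_(x in `[0%R, +oo[) (expR (- e * x) * (1 + cos (b * x)))%:E =
  (e^-1 + e / (e ^+ 2 + b ^+ 2))%:E)%E.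
Proof.
move=> e0.
have dp x : derivable (prim e b) x 1 by have [] := is_derive_prim b x e0.
rewrite (ge0_continuous_FTC2y (F := prim e b) (l := 0)).
- rewrite /prim !mulr0 expR0 sin0 cos0 mulr0 mulr1 sub0r mul1r -EFinB; congr EFin.
  ring.
- by move=> x _; rewrite mulr_ge0 ?expR_ge0// -lerBlDl sub0r cos_geN1.
- exact/continuous_subspaceT/continuous_prim'.
- exact: cvg_prim.
- by move=> x _; exact: dp.
- apply: cvg_at_right_filter; apply: differentiable_continuous; exact/derivable1_diffP.
- by move=> x _; rewrite derive1E; have [_ ->] := is_derive_prim b x e0.
Qed.

Lemma decay_ge0 e xi : 0 <= decay e xi.
Proof. by rewrite /decay /patch; case: ifP => // _; exact: expR_ge0. Qed.

Lemma measurable_decay e : measurable_fun setT (decay e).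
Proof.
apply/(measurable_restrictT _ _).1 => //; apply: measurable_funTS.
apply: measurableT_comp; [exact: measurable_expR|exact: measurable_funM].
Qed.

Lemma integral_decay e : 0 < e -> (\int[mu]_x (decay e x)%:E = (e^-1)%:E)%E.
Proof.
move=> e0; have := integral_decay_cos1 0 e0.
rewrite expr0n addr0 (_ : e^-1 + e / e ^+ 2 = 2 * e^-1); last by field; rewrite gt_eqF.
rewrite EFinM => H.
have -> : (\int[mu]_x (decay e x)%:E = \int[mu]_(x in `[0%R, +oo[) (expR (- e * x))%:E)%E.
  by rewrite [RHS]integral_mkcond; apply: eq_integral => x _; rewrite restrict_EFin.
suff : (2%:E * \int[mu]_(x in `[0%R, +oo[) (expR (- e * x))%:E = 2%:E * (e^-1)%:E)%E.
  move=> /(congr1 (fun z => (2^-1)%:E * z)%E).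
  by rewrite !muleA -EFinM mulVf// !mul1e.
rewrite -H -ge0_integralZl_EFin//.
- by apply: eq_integral => x _; rewrite mul0r cos0 -EFinM mulrC.
- apply/measurable_EFinP; apply: measurable_funTS.
  by apply: measurableT_comp; [exact: measurable_expR|exact: measurable_funM].
Qed.

Lemma L1_decay e : 0 < e -> L1 (decay e).
Proof.
move=> e0; apply/L1P/integrableP; split; first by apply/measurable_EFinP; exact: measurable_decay.
under eq_integral do rewrite gee0_abs ?lee_fin ?decay_ge0//.
by rewrite integral_decay// ltry.
Qed.

Lemma cosT_decay e t : 0 < e -> cosT (decay e) t = poisson e t.
Proof.
move=> e0; have ld := L1_decay e0.
have h1 : \int[mu]_x decay e x = e^-1.
  by apply: EFin_inj; rewrite EFin_Rintegral// integral_decay.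
have h2 : \int[mu]_x (decay e x + decay e x * cos (2 * pi * x * t)) =
    e^-1 + poisson e t.
  apply: EFin_inj; rewrite EFin_Rintegral; last by apply: L1D => //; exact: L1_cos.
  rewrite /poisson -integral_decay_cos1// [RHS]integral_mkcond.
  apply: eq_integral => x _; rewrite restrict_EFin /decay /patch.
  (* Off the half-line both restrictions take the default value [point], which is 0 in [R]. *)
  rewrite /=; case: ifP => _; last by rewrite (_ : point = 0) ?mul0r ?addr0.
  by rewrite (_ : 2 * pi * t * x = 2 * pi * x * t); [congr EFin|]; ring.
move: h2; rewrite RintegralDE//; last exact: L1_cos.
by rewrite h1 => /addrI.
Qed.
End poisson.

(** * Quadratic forms of the Poisson kernel *)

Section plancherel.
Context {R : realType}.
Local Notation mu := (@lebesgue_measure R).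
Implicit Types (f g u K w : R -> R) (a b e t x y xi : R).

(** The profile of the Poisson kernel; it also serves as the integrable majorant of Schwartz
    functions and as the weight in the L^1 bound of a kernel. *)
Definition bump x : R := (oneDsqr x)^-1.

Lemma bumpE x : bump x = (1 + x ^+ 2)^-1.
Proof. by []. Qed.

Lemma bump_ge0 x : 0 <= bump x.
Proof. by rewrite invr_ge0 addr_ge0// sqr_ge0. Qed.

Lemma bump_le1 x : bump x <= 1.
Proof. exact: oneDsqrV_le1. Qed.

Lemma continuous_bump : continuous bump.
Proof. exact: continuous_oneDsqrV. Qed.

Lemma integral_bump : (\int[mu]_x (bump x)%:E = pi%:E)%E.
Proof.
rewrite ge0_symfun_integralT.
- rewrite (_ : [set x | _] = `[0, +oo[%classic); last first.
    by apply/seteqP; split => x/=; rewrite in_itv/= andbT.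
  by rewrite integral0y_oneDsqr -EFinM mulrCA divff// mulr1.
- exact: bump_ge0.
- exact: continuous_bump.
- by move=> x /=; rewrite /bump /oneDsqr sqrrN.
Qed.

Lemma L1_bump : L1 bump.
Proof.
apply/L1P/integrableP; split.
  by apply/measurable_EFinP; apply: continuous_measurable_fun; exact: continuous_bump.
under eq_integral do rewrite gee0_abs ?lee_fin ?bump_ge0//.
by rewrite integral_bump ltry.
Qed.

Lemma Rintegral_bump : \int[mu]_x bump x = pi.
Proof. by apply: EFin_inj; rewrite EFin_Rintegral ?integral_bump//; exact: L1_bump. Qed.

Lemma poissonE e t : 0 < e -> poisson e t = e^-1 * bump (2 * pi / e * t + 0).
Proof.
move=> e0; rewrite /poisson /bump /oneDsqr addr0; field.
by repeat (apply/andP; split); rewrite gt_eqF// ltr_pwDl ?sqr_ge0 ?exprn_gt0//.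
Qed.

Let twopie_neq0 (e : R) : 0 < e -> 2 * pi / e != 0.
Proof. by move=> e0; rewrite gt_eqF// divr_gt0// mulr_gt0// pi_gt0. Qed.

Lemma poisson_ge0 e t : 0 < e -> 0 <= poisson e t.
Proof. by move=> e0; rewrite poissonE// mulr_ge0 ?bump_ge0// invr_ge0 ltW. Qed.

Lemma poisson_le e t : 0 < e -> poisson e t <= e^-1.
Proof. by move=> e0; rewrite poissonE// ler_piMr ?bump_le1// invr_ge0 ltW. Qed.

Lemma continuous_poisson e : 0 < e -> continuous (poisson e).
Proof.
move=> e0; rewrite (_ : poisson e = fun t => e^-1 * bump (2 * pi / e * t + 0)); last first.
  by apply/funext => t; exact: poissonE.
move=> t; apply: cvgMr.
apply: (@continuous_comp _ _ _ (fun t => 2 * pi / e * t + 0)); last exact: continuous_bump.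
by apply: cvgD; [exact: mulrl_continuous|exact: cvg_cst].
Qed.

Lemma L1_poisson e : 0 < e -> L1 (poisson e).
Proof.
move=> e0; rewrite (_ : poisson e = fun t => e^-1 * bump (2 * pi / e * t + 0)); last first.
  by apply/funext => t; exact: poissonE.
apply/L1Z/L1_affine; [exact: twopie_neq0|exact: L1_bump].
Qed.

Lemma Rintegral_poisson e : 0 < e -> \int[mu]_t poisson e t = 2^-1.
Proof.
move=> e0; under eq_Rintegral do rewrite poissonE//.
have la := L1_affine 0 (twopie_neq0 e0) L1_bump.
rewrite RintegralZE// (Rintegral_affine 0 (twopie_neq0 e0) L1_bump) Rintegral_bump.
rewrite ger0_norm ?divr_ge0 ?mulr_ge0 ?pi_ge0 ?ltW//.
have : pi != 0 :> R by rewrite gt_eqF// pi_gt0.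
move: (pi : R) => p p0; field.
by rewrite p0 gt_eqF.
Qed.

Lemma L1_mul_poisson g e x : 0 < e -> L1 g -> L1 (fun y => g y * poisson e (x - y)).
Proof.
move=> e0 lg; apply: L1_bounded_mul lg _ _.
  apply: measurableT_comp; last exact: measurable_funB.
  by apply: continuous_measurable_fun; exact: continuous_poisson.
by move=> y; rewrite ger0_norm ?poisson_ge0//; exact: poisson_le.
Qed.

Let measurable_poisson e : 0 < e -> measurable_fun setT (poisson e).
Proof.
by move=> e0; apply: continuous_measurable_fun; exact: continuous_poisson.
Qed.

Opaque poisson bump.

Lemma Rintegral_poisson_conv e h : 0 < e -> L1 h -> (forall x, 0 <= h x) ->
  L1 (fun x => \int[mu]_y (h y * poisson e (x - y))) /\
  \int[mu]_x \int[mu]_y (h y * poisson e (x - y)) = 2^-1 * \int[mu]_y h y.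
Proof.
move=> e0 lh h0.
have lp' y : L1 (fun x => poisson e (x - y)) by apply: L1_shift; exact: L1_poisson.
have ip y : \int[mu]_x (h y * poisson e (x - y)) = 2^-1 * h y.
  rewrite RintegralZE; last exact: lp'.
  rewrite Rintegral_shift; last exact: L1_poisson.
  by rewrite Rintegral_poisson; [rewrite mulrC|exact: e0].
have mF : measurable_fun setT (fun z : R * R => h z.2 * poisson e (z.1 - z.2)).
  apply: measurable_funM.
    exact: (measurableT_comp (L1_measurable lh) measurable_snd).
  by apply: (measurableT_comp (measurable_poisson e0)); exact: measurable_funB.
have Fb y : \int[mu]_x `|h y * poisson e (x - y)| <= 2^-1 * h y.
  rewrite -ip le_eqVlt; apply/orP; left; apply/eqP; apply: eq_Rintegral => x _.
  by apply: ger0_norm; apply: mulr_ge0; [exact: h0|exact: poisson_ge0].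
have [l1 _ ->] := @Rintegral_fubini _ (fun x y => h y * poisson e (x - y))
  (fun y => 2^-1 * h y) mF (fun x => L1_mul_poisson x e0 lh)
  (fun y => L1Z (h y) (lp' y)) (L1Z 2^-1 lh) Fb.
split; first exact: l1.
rewrite -RintegralZE; last exact: lh.
by apply: eq_Rintegral => y _; exact: ip.
Qed.

(** [2 a b <= a^2 + b^2] integrated against a kernel of mass 1/2. This replaces an L^2 bound for the
    convolution with the Poisson kernel. *)
Let poisson_quadratic_le e g x : 0 < e -> L1 g -> L1 (fun x => g x ^+ 2) ->
  g x * \int[mu]_y (g y * poisson e (x - y)) <=
  2^-1 * (2^-1 * g x ^+ 2) + 2^-1 * \int[mu]_y (g y ^+ 2 * poisson e (x - y)).
Proof.
move=> e0 lg lg2.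
have lp : L1 (fun y => poisson e (x - y)) by apply: L1_reflect; exact: L1_poisson.
have lgp := L1_mul_poisson x e0 lg.
have lq := L1_mul_poisson x e0 lg2.
have <- : \int[mu]_y (g x ^+ 2 * poisson e (x - y)) = 2^-1 * g x ^+ 2.
  rewrite RintegralZE; last exact: lp.
  rewrite (Rintegral_reflect x (L1_poisson e0)) Rintegral_poisson; last exact: e0.
  by rewrite mulrC.
rewrite -(RintegralZE (g x) lgp) -(RintegralZE 2^-1 lq) -(RintegralZE 2^-1 (L1Z (g x ^+ 2) lp)).
rewrite -(RintegralDE (L1Z 2^-1 (L1Z (g x ^+ 2) lp)) (L1Z 2^-1 lq)).
apply: Rintegral_le.
- exact: L1Z.
- by apply: L1D; [apply: L1Z; exact: L1Z|exact: L1Z].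
- move=> y; have pe := poisson_ge0 (x - y) e0.
  move: (poisson e (x - y)) (g x) (g y) pe => p a b pe.
  have := sqr_ge0 (a - b); nra.
Qed.

Lemma L1_poisson_quadratic e g : 0 < e -> L1 g ->
  L1 (fun x => g x * \int[mu]_y (g y * poisson e (x - y))).
Proof.
move=> e0 lg; set N := \int[mu]_y `|g y|.
have mg := L1_measurable lg.
have cP : continuous (fun x => \int[mu]_y (g y * poisson e (x - y))).
  apply: (Rintegral_continuous (F := fun x y => g y * poisson e (x - y)) (g := fun y => e^-1 * `|g y|)).
  - move=> x; exact: L1_measurable (L1_mul_poisson x e0 lg).
  - move=> y x; apply: cvgMr.
    apply: (@continuous_comp _ _ _ (fun x => x - y)); last exact: continuous_poisson.
    by apply: cvgB; [exact: cvg_id|exact: cvg_cst].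
  - exact/L1Z/L1_norm.
  - move=> x y; rewrite normrM mulrC ler_wpM2r//.
    by rewrite ger0_norm; [exact: poisson_le|exact: poisson_ge0].
apply: (L1_bounded_mul (M := e^-1 * N) lg).
  exact: continuous_measurable_fun.
move=> x; rewrite /N -(RintegralZE e^-1 (L1_norm lg)).
apply: Rintegral_normr_le.
- exact: L1_mul_poisson.
- exact/L1Z/L1_norm.
- move=> y; rewrite normrM mulrC ler_wpM2r//.
  by rewrite ger0_norm; [exact: poisson_le|exact: poisson_ge0].
Qed.

Lemma pw_decayE e g : 0 < e -> L1 g ->
  \int[mu]_xi (decay e xi * pw g xi) =
  \int[mu]_x (g x * \int[mu]_y (g y * poisson e (x - y))).
Proof.
move=> e0 lg; rewrite pw_weighted; [|exact: L1_decay|exact: decay_ge0|exact: lg].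
apply: eq_Rintegral => x _; congr (_ * _).
by apply: eq_Rintegral => y _; rewrite cosT_decay.
Qed.

Lemma pw_decay_le e g : 0 < e -> L1 g -> L1 (fun x => g x ^+ 2) ->
  \int[mu]_xi (decay e xi * pw g xi) <= 2^-1 * \int[mu]_x (g x ^+ 2).
Proof.
move=> e0 lg lg2; rewrite (pw_decayE e0 lg).
have [l1 Fub] := Rintegral_poisson_conv e0 lg2 (fun x => sqr_ge0 (g x)).
have l2 := L1Z 2^-1 (L1Z 2^-1 lg2).
have l3 := L1Z 2^-1 l1.
apply: le_trans (Rintegral_le (L1_poisson_quadratic e0 lg) (L1D l2 l3)
   (fun x => poisson_quadratic_le x e0 lg lg2)) _.
rewrite (RintegralDE l2 l3) (RintegralZE 2^-1 (L1Z 2^-1 lg2)) (RintegralZE 2^-1 lg2).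
rewrite (RintegralZE 2^-1 l1) Fub.
(* Each of the two squares contributes a quarter of the integral of [g ^ 2]. *)
by move: (Rintegral _ _ _) => I; lra.
Qed.

End plancherel.

(** * The two Plancherel inequalities on the half-line *)

Section plancherel_limits.
Context {R : realType}.
Local Notation mu := (@lebesgue_measure R).
Implicit Types (f g u K w : R -> R) (a b e t x y xi : R).

Let eps (n : nat) : R := n.+1%:R^-1.

Let eps_gt0 n : 0 < eps n. Proof. by rewrite invr_gt0. Qed.

Let eps_cvg : eps n @[n --> \oo] --> (0 : R).
Proof. exact: cvg_harmonic. Qed.

Lemma pw_le g xi : L1 g -> pw g xi <= 2 * (\int[mu]_x `|g x|) ^+ 2.
Proof.
move=> lg; have h1 := cosT_le xi lg; have h2 := sinT_le xi lg.
have h (a b : R) : `|a| <= b -> a ^+ 2 <= b ^+ 2.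
  by move=> ab; rewrite -real_normK ?num_real// ler_sqr ?nnegrE// (le_trans _ ab).
by have := h _ _ h1; have := h _ _ h2; rewrite /pw; lra.
Qed.

Lemma L1_decay_pw e g : 0 < e -> L1 g -> L1 (fun xi => decay e xi * pw g xi).
Proof.
move=> e0 lg; apply: (L1_bounded_mul (L1_decay e0) (measurable_pw lg)) => xi.
by rewrite ger0_norm ?pw_ge0//; exact: pw_le.
Qed.

Let decay_le1 e xi : 0 < e -> decay e xi <= 1.
Proof.
move=> e0; rewrite /decay /patch; case: ifPn => [|_]; last exact: ler01.
by rewrite inE/= in_itv/= andbT => xi0; rewrite -expR0 ler_expR mulNr oppr_le0 mulr_ge0// ltW.
Qed.

(** The weights [decay (eps n)] tend to 1 on the half-line, and the bounds for the weighted
    integrals pass to the limit by Fatou. This direction is used for the input of a convolution. *)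
Lemma integral_pw_le g : L1 g -> L1 (fun x => g x ^+ 2) ->
  (\int[mu]_(xi in `[0%R, +oo[) (pw g xi)%:E <= (2^-1 * \int[mu]_x (g x ^+ 2))%:E)%E.
Proof.
move=> lg lg2; rewrite integral_mkcond.
have -> : ((fun xi => (pw g xi)%:E) \_ `[0%R, +oo[)%E = EFin \o (pw g \_ `[0%R, +oo[).
  by apply/funext => x; rewrite restrict_EFin.
apply: (@integral_le_limit _ (fun n xi => decay (eps n) xi * pw g xi)).
- by move=> n; apply: L1_measurable; exact: L1_decay_pw.
- by move=> n xi; rewrite mulr_ge0 ?decay_ge0 ?pw_ge0.
- move=> xi; rewrite /decay /patch; case: ifPn => _; last by under eq_fun do rewrite mul0r; exact: cvg_cst.
  rewrite -[X in _ --> X]mul1r; apply: cvgMl; rewrite -expR0.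
  apply: continuous_cvg; first exact: continuous_expR.
  rewrite -(mul0r xi) -oppr0; apply: cvgMl; exact: cvgN.
- move=> n; rewrite -EFin_Rintegral; last exact: L1_decay_pw.
  by rewrite lee_fin; exact: pw_decay_le.
Qed.

(** The substitution [x - y = e / (2 * pi) * z] puts the small parameter into the argument of [g]
    and leaves a fixed kernel, so that the limit [e -> 0] is dominated by a multiple of [bump]. *)
Let poisson_dilate g x e : 0 < e -> L1 g ->
  \int[mu]_y (g y * poisson e (x - y)) =
  (2 * pi)^-1 * \int[mu]_z (g (x - e / (2 * pi) * z) * bump z).
Proof.
move=> e0 lg; have p0 : 0 < (pi : R) by exact: pi_gt0.
have a0 : e / (2 * pi) != 0 by rewrite gt_eqF// divr_gt0// mulr_gt0.
pose h s := g (x - s) * poisson e s.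
have lh : L1 h.
  have := L1_reflect x (L1_mul_poisson x e0 lg).
  rewrite (_ : (fun y => _) = h)//; apply/funext => y; rewrite /h; congr (_ * poisson e _); ring.
transitivity (\int[mu]_s h s).
  rewrite -(Rintegral_reflect x lh); apply: eq_Rintegral => y _.
  by rewrite /h; congr (g _ * _); ring.
have lh' := L1_affine 0 a0 lh.
have -> : \int[mu]_s h s = (e / (2 * pi)) * \int[mu]_z h (e / (2 * pi) * z + 0).
  rewrite (Rintegral_affine 0 a0 lh) ger0_norm; last by rewrite divr_ge0 ?mulr_ge0// ltW.
  by rewrite mulrA divff// mul1r.
rewrite (_ : e / (2 * pi) = (2 * pi)^-1 * e); last by rewrite mulrC.
rewrite -mulrA; congr (_ * _); rewrite -RintegralZE; last first.
  by move: lh'; rewrite (_ : e / (2 * pi) = (2 * pi)^-1 * e)// mulrC.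
apply: eq_Rintegral => z _; rewrite /h addr0 poissonE// addr0.
rewrite (_ : 2 * pi / e * _ = z); first by rewrite mulrCA mulVKf// gt_eqF.
have : pi != 0 :> R by rewrite gt_eqF.
by move: (pi : R) => p p00; field; rewrite p00 gt_eqF.
Qed.

Lemma poisson_approx g M x : L1 g -> continuous g -> (forall y, `|g y| <= M) ->
  \int[mu]_y (g y * poisson (eps n) (x - y)) @[n --> \oo] --> 2^-1 * g x.
Proof.
move=> lg cg gM.
have -> : (fun n => \int[mu]_y (g y * poisson (eps n) (x - y))) =
    (fun n => (2 * pi)^-1 * \int[mu]_z (g (x - eps n / (2 * pi) * z) * bump z)).
  by apply/funext => n; apply: poisson_dilate.
have p0 : 0 < (pi : R) by exact: pi_gt0.
have -> : 2^-1 * g x = (2 * pi)^-1 * \int[mu]_z (g x * bump z).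
  rewrite (RintegralZE (g x) L1_bump) Rintegral_bump invfM -mulrA; congr (_ * _).
  by rewrite mulrCA mulVf ?gt_eqF// mulr1.
apply: cvgMr.
have mb : measurable_fun setT (@bump R) by exact: L1_measurable L1_bump.
apply: (@Rintegral_dominated_cvg _ _ _ (fun z => M * bump z)).
- move=> n; apply: measurable_funM => //.
  apply: measurableT_comp; first exact: continuous_measurable_fun.
  by apply: measurable_funB => //; exact: measurable_funM.
- move=> z; apply: cvgMl; apply: continuous_cvg; first exact: cg.
  rewrite -[X in _ --> X]subr0; apply: cvgB; first exact: cvg_cst.
  rewrite -[X in _ --> X](mul0r z); apply: cvgMl.
  by rewrite -[X in _ --> X](mul0r (2 * pi)^-1); apply: cvgMl.
- exact/L1Z/L1_bump.
- by move=> n z; rewrite normrM (ger0_norm (bump_ge0 z)) ler_wpM2r ?bump_ge0.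
Qed.

(** Here the quadratic forms must really converge: Poisson averages of a continuous bounded function
    tend to [g x / 2] at every point, and the weight [decay] is at most 1. This direction is used
    for kernels and for outputs of convolutions, which have this regularity. *)
Lemma integral_pw_ge g M : L1 g -> continuous g -> (forall y, `|g y| <= M) ->
  ((2^-1 * \int[mu]_x (g x ^+ 2))%:E <= \int[mu]_(xi in `[0%R, +oo[) (pw g xi)%:E)%E.
Proof.
move=> lg cg gM.
set I := (X in (_ <= X)%E).
have M0 : 0 <= M by exact: le_trans (gM 0).
have mg := L1_measurable lg.
have lim : \int[mu]_x (g x * \int[mu]_y (g y * poisson (eps n) (x - y))) @[n --> \oo]
    --> 2^-1 * \int[mu]_x (g x ^+ 2).
  have -> : 2^-1 * \int[mu]_x (g x ^+ 2) = \int[mu]_x (g x * (2^-1 * g x)).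
    rewrite -RintegralZE; last first.
      rewrite (_ : (fun x => g x ^+ 2) = fun x => g x * g x); last by apply/funext.
      exact: L1_bounded_mul gM.
    by apply: eq_Rintegral => x _; ring.
  apply: (@Rintegral_dominated_cvg _ _ _ (fun x => (M * 2^-1) * `|g x|)).
  - move=> n; exact: L1_measurable (L1_poisson_quadratic (eps_gt0 n) lg).
  - by move=> x; apply: cvgMr; exact: poisson_approx lg cg gM.
  - exact/L1Z/L1_norm.
  (* An average of a function bounded by [M] against a kernel of mass 1/2 is at most [M / 2]. *)
  - move=> n x; rewrite normrM mulrC ler_wpM2r//.
    rewrite -(Rintegral_poisson (eps_gt0 n)) -(Rintegral_reflect x (L1_poisson (eps_gt0 n))).
    have lp := L1_reflect x (L1_poisson (eps_gt0 n)).
    rewrite -(RintegralZE M lp); apply: Rintegral_normr_le.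
    + exact: L1_mul_poisson.
    + exact: L1Z.
    + move=> y; rewrite normrM (ger0_norm (poisson_ge0 _ (eps_gt0 n))) ler_wpM2r//.
      exact: poisson_ge0.
have leI n : ((\int[mu]_x (g x * \int[mu]_y (g y * poisson (eps n) (x - y))))%:E <= I)%E.
  rewrite -(pw_decayE (eps_gt0 n) lg) EFin_Rintegral; last exact: L1_decay_pw.
  rewrite /I [X in (_ <= X)%E]integral_mkcond; apply: ge0_le_integral => //.
  - by move=> xi _; rewrite lee_fin mulr_ge0 ?decay_ge0 ?pw_ge0.
  - by apply/measurable_EFinP; apply: L1_measurable; exact: L1_decay_pw.
  - apply/(measurable_restrictT _ _).1 => //; apply: measurable_funTS.
    by apply/measurable_EFinP; exact: measurable_pw.
  - move=> xi _; rewrite restrict_EFin/= lee_fin /decay /patch.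
    have := decay_le1 xi (eps_gt0 n); rewrite /decay /patch; case: ifPn => _ h.
      by rewrite ler_piMl// pw_ge0.
    by rewrite mul0r.
case: I leI => [r| |] leI; last 2 first.
- exact: leey.
- by have := leI 0%N.
rewrite lee_fin -(cvg_lim _ lim)//; apply: limr_le; first by apply/cvg_ex; eexists; exact: lim.
by apply: nearW => n; rewrite -lee_fin; exact: leI.
Qed.

End plancherel_limits.

(** * Convolution *)

Section convolution.
Context {R : realType}.
Local Notation mu := (@lebesgue_measure R).
Implicit Types (f g u K w : R -> R) (a b e t x y xi M : R).

Definition conv u K x := \int[mu]_y (u y * K (x - y)).

Lemma L1_mul_reflect u K M x : L1 u -> measurable_fun setT K ->
  (forall x, `|K x| <= M) -> L1 (fun y => u y * K (x - y)).
Proof.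
move=> lu mK KM; apply: (L1_bounded_mul lu) => [|y]; last exact: KM.
by apply: (measurableT_comp mK); exact: measurable_funB.
Qed.

Lemma conv_le u K M x : L1 u -> measurable_fun setT K ->
  (forall x, `|K x| <= M) -> `|conv u K x| <= M * \int[mu]_y `|u y|.
Proof.
move=> lu mK KM; rewrite -(RintegralZE M (L1_norm lu)); apply: Rintegral_normr_le.
- exact: L1_mul_reflect KM.
- exact/L1Z/L1_norm.
- by move=> y; rewrite normrM mulrC ler_wpM2r.
Qed.

Lemma continuous_conv u K M : L1 u -> continuous K ->
  (forall x, `|K x| <= M) -> continuous (conv u K).
Proof.
move=> lu cK KM; have mK := continuous_measurable_fun cK.
apply: (Rintegral_continuous (F := fun x y => u y * K (x - y)) (g := fun y => M * `|u y|)).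
- move=> x; exact: L1_measurable (L1_mul_reflect x lu mK KM).
- move=> y x; apply: cvgMr; apply: (@continuous_comp _ _ _ (fun x => x - y)); last exact: cK.
  by apply: cvgB; [exact: cvg_id|exact: cvg_cst].
- exact/L1Z/L1_norm.
- by move=> x y; rewrite normrM mulrC ler_wpM2r.
Qed.

(** The adjoint form of convolution. The choice [h = 1] gives the integrability of [conv u K], a
    cosine or sine gives its transforms. *)
Lemma Rintegral_conv u K (h : R -> R) M H : L1 u -> L1 K -> (forall x, `|K x| <= M) ->
  measurable_fun setT h -> (forall x, `|h x| <= H) ->
  L1 (fun x => conv u K x * h x) /\
  \int[mu]_x (conv u K x * h x) = \int[mu]_y (u y * \int[mu]_z (K z * h (z + y))).
Proof.
move=> lu lK KM mh hH.
have mK := L1_measurable lK; have mu_ := L1_measurable lu.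
have H0 : 0 <= H by exact: le_trans (hH 0).
have lKh y : L1 (fun z => K z * h (z + y)).
  apply: (L1_bounded_mul lK) => [|z]; last exact: hH.
  by apply: (measurableT_comp mh); exact: measurable_funD.
have lKh' y : L1 (fun x => K (x - y) * h x).
  have := L1_shift (- y) (lKh y).
  by rewrite (_ : (fun _ => _) = (fun x => K (x - y) * h x))//; apply/funext => x; rewrite subrK.
have Ey y : \int[mu]_x (u y * (K (x - y) * h x)) = u y * \int[mu]_z (K z * h (z + y)).
  rewrite (RintegralZE (u y) (lKh' y)); congr (_ * _).
  by rewrite -(Rintegral_shift (- y) (lKh y)); apply: eq_Rintegral => x _; rewrite subrK.
have Ex x : \int[mu]_y (u y * (K (x - y) * h x)) = conv u K x * h x.
  rewrite mulrC -(RintegralZE (h x) (L1_mul_reflect x lu mK KM)).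
  by apply: eq_Rintegral => y _; ring.
have lx x : L1 (fun y => u y * (K (x - y) * h x)).
  have := L1Z (h x) (L1_mul_reflect x lu mK KM).
  by rewrite (_ : (fun _ => _) = (fun y => u y * (K (x - y) * h x)))//; apply/funext => y; ring.
have mF : measurable_fun setT (fun z : R * R => u z.2 * (K (z.1 - z.2) * h z.1)).
  apply: measurable_funM; first exact: (measurableT_comp mu_ measurable_snd).
  apply: measurable_funM; last exact: (measurableT_comp mh measurable_fst).
  by apply: (measurableT_comp mK); exact: measurable_funB.
have Fb y : \int[mu]_x `|u y * (K (x - y) * h x)| <= H * (\int[mu]_z `|K z|) * `|u y|.
  rewrite -(Rintegral_shift (- y) (L1_norm lK)) -(RintegralZE H (L1_shift (- y) (L1_norm lK))).
  rewrite mulrC -(RintegralZE `|u y| (L1Z H (L1_shift (- y) (L1_norm lK)))).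
  apply: Rintegral_le.
  - exact/L1_norm/L1Z/lKh'.
  - exact/L1Z/L1Z/(L1_shift (- y) (L1_norm lK)).
  - by move=> x; rewrite !normrM ler_wpM2l// mulrC ler_wpM2r.
have [l1 _ fub] := @Rintegral_fubini _ (fun x y => u y * (K (x - y) * h x)) _ mF lx
  (fun y => L1Z (u y) (lKh' y)) (L1Z (H * \int[mu]_z `|K z|) (L1_norm lu)) Fb.
split; first by move: l1; rewrite (funext Ex).
transitivity (\int[mu]_x \int[mu]_y (u y * (K (x - y) * h x))).
  by apply: eq_Rintegral => x _; rewrite Ex.
by rewrite fub; apply: eq_Rintegral => y _; exact: Ey.
Qed.

Lemma L1_conv u K M : L1 u -> L1 K -> (forall x, `|K x| <= M) -> L1 (conv u K).
Proof.
move=> lu lK KM; have h1 x : `|(1 : R)| <= 1 by rewrite normr1.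
have [] := @Rintegral_conv u K (fun=> 1) M 1 lu lK KM (measurable_cst _) h1.
by rewrite (_ : (fun _ => _) = conv u K)//; apply/funext => x; rewrite mulr1.
Qed.

Lemma Rintegral_trig f a b xi : L1 f ->
  \int[mu]_x (f x * (a * cos (2 * pi * x * xi) + b * sin (2 * pi * x * xi))) =
  a * cosT f xi + b * sinT f xi.
Proof.
move=> lf; have lc := L1_cos xi lf; have ls := L1_sin xi lf.
rewrite -(RintegralZE a lc) -(RintegralZE b ls) -(RintegralDE (L1Z a lc) (L1Z b ls)).
by apply: eq_Rintegral => x _; ring.
Qed.

(** The addition formulas for cosine and sine say that the transform of a convolution is the product
    of the transforms; [pw] is the squared modulus, hence multiplicative. *)
Lemma pw_conv u K M xi : L1 u -> L1 K -> (forall x, `|K x| <= M) ->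
  pw (conv u K) xi = pw u xi * pw K xi.
Proof.
move=> lu lK KM.
have [_ C] := Rintegral_conv lu lK KM (measurable_cosr xi) (fun x => normr_cos_le1 _).
have [_ S] := Rintegral_conv lu lK KM (measurable_sinr xi) (fun x => normr_sin_le1 _).
have EC : cosT (conv u K) xi = cosT K xi * cosT u xi + (- sinT K xi) * sinT u xi.
  rewrite -(Rintegral_trig _ _ _ lu) {1}/cosT C; apply: eq_Rintegral => y _; congr (_ * _).
  rewrite [RHS](_ : _ = cos (2 * pi * y * xi) * cosT K xi +
    (- sin (2 * pi * y * xi)) * sinT K xi); last by ring.
  rewrite -(Rintegral_trig _ _ _ lK).
  by apply: eq_Rintegral => z _; rewrite mulrDr mulrDl cosD; ring.
have ES : sinT (conv u K) xi = sinT K xi * cosT u xi + cosT K xi * sinT u xi.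
  rewrite -(Rintegral_trig _ _ _ lu) {1}/sinT S; apply: eq_Rintegral => y _; congr (_ * _).
  rewrite [RHS](_ : _ = sin (2 * pi * y * xi) * cosT K xi +
    cos (2 * pi * y * xi) * sinT K xi); last by ring.
  rewrite -(Rintegral_trig _ _ _ lK).
  by apply: eq_Rintegral => z _; rewrite mulrDr mulrDl sinD; ring.
rewrite /pw EC ES.
by move: (cosT K xi) (sinT K xi) (cosT u xi) (sinT u xi) => a b c d; ring.
Qed.

Lemma L1_sqr f M : L1 f -> (forall x, `|f x| <= M) -> L1 (fun x => f x ^+ 2).
Proof. by move=> lf fM; exact: (L1_bounded_mul lf (L1_measurable lf) fM). Qed.

(** Plancherel for each output, the pointwise bound on the sum of the squared multipliers, then
    Plancherel for [u]. The two factors 1/2 cancel, so [B] itself is the constant. *)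
Lemma sum_conv_sqr_le (I : Type) (s : seq I) (K : I -> R -> R) (M : I -> R) (B : R) u :
  (forall j, L1 (K j)) -> (forall j, continuous (K j)) ->
  (forall j x, `|K j x| <= M j) ->
  (forall xi, \sum_(j <- s) pw (K j) xi <= B) ->
  L1 u -> L1 (fun x => u x ^+ 2) ->
  (\sum_(j <- s) \int[mu]_x (conv u (K j) x ^+ 2)%:E <= B%:E * \int[mu]_x (u x ^+ 2)%:E)%E.
Proof.
move=> lK cK KM KB lu lu2.
have B0 : 0 <= B by apply: le_trans (KB 0); apply: sumr_ge0 => j _; exact: pw_ge0.
have m2 : measurable (`[0%R, +oo[ : set R) by [].
have step j : ((2^-1)%:E * \int[mu]_x (conv u (K j) x ^+ 2)%:E <=
    \int[mu]_(xi in `[0%R, +oo[) (pw u xi * pw (K j) xi)%:E)%E.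
  have lc := L1_conv lu (lK j) (KM j).
  have cM := fun x => conv_le x lu (L1_measurable (lK j)) (KM j).
  have := integral_pw_ge lc (continuous_conv lu (cK j) (KM j)) cM.
  rewrite EFinM (EFin_Rintegral (L1_sqr lc cM)) => /le_trans; apply.
  by under eq_integral do rewrite (pw_conv _ lu (lK j) (KM j)).
have -> : (\sum_(j <- s) \int[mu]_x (conv u (K j) x ^+ 2)%:E =
   2%:E * \sum_(j <- s) (2^-1)%:E * \int[mu]_x (conv u (K j) x ^+ 2)%:E)%E.
  rewrite -ge0_sume_distrr; last first.
    by move=> j _; apply: integral_ge0 => x _; rewrite lee_fin sqr_ge0.
  by rewrite muleA -EFinM divff// mul1e.
have -> : (B%:E * \int[mu]_x (u x ^+ 2)%:E = 2%:E * (B%:E * (2^-1 * \int[mu]_x (u x ^+ 2))%:E))%E.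
  by rewrite -EFin_Rintegral// -!EFinM; congr EFin; field.
apply: lee_wpmul2l => //.
apply: (@le_trans _ _ (\sum_(j <- s) \int[mu]_(xi in `[0%R, +oo[) (pw u xi * pw (K j) xi)%:E)%E).
  exact: lee_sum.
have mpw j : measurable_fun (`[0%R, +oo[ : set R) (fun xi => (pw u xi * pw (K j) xi)%:E).
  apply: measurable_funTS; apply/measurable_EFinP; apply: measurable_funM; exact: measurable_pw.
rewrite -ge0_integral_sum//; last by move=> j xi _; rewrite lee_fin mulr_ge0 ?pw_ge0.
apply: (@le_trans _ _ (B%:E * \int[mu]_(xi in `[0%R, +oo[) (pw u xi)%:E)%E); last first.
  by apply: lee_wpmul2l; [rewrite lee_fin|exact: integral_pw_le].
rewrite -ge0_integralZl_EFin//; last 2 first.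
- by move=> xi _; rewrite lee_fin pw_ge0.
- by apply: measurable_funTS; apply/measurable_EFinP; exact: measurable_pw.
apply: ge0_le_integral => //.
- by move=> xi _; apply: sume_ge0 => j _; rewrite lee_fin mulr_ge0 ?pw_ge0.
- exact: emeasurable_sum.
- apply: measurable_funTS; apply/measurable_EFinP; apply: measurable_funM => //; exact: measurable_pw.
- move=> xi _; rewrite sumEFin lee_fin -mulr_sumr mulrC ler_wpM2r ?pw_ge0//.
Qed.

End convolution.

(** * Interpolation between square integrable and bounded functions *)

Section levels.
Context {R : realType}.
Implicit Types (a b q : R).

(** Interleaves nonnegative and negative integers, so that families indexed by [int] become series
    over [nat]. *)
Definition int_of_nat (n : nat) : int := if odd n then Negz n./2 else Posz n./2.

Lemma int_of_nat_bij : set_bij [set: nat] [set: int] int_of_nat.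
Proof.
split=> //.
- move=> m n _ _; rewrite /int_of_nat => h; rewrite -(odd_double_half m) -(odd_double_half n).
  by move: h; case: (odd m); case: (odd n) => // -[->].
- move=> [m|m] _.
    by exists m.*2 => //; rewrite /int_of_nat odd_double doubleK.
  by exists m.*2.+1 => //; rewrite /int_of_nat /= odd_double/= uphalf_double.
Qed.

Lemma nneseries_geometric_le (z : R) : 0 <= z < 1 ->
  (\sum_(n <oo) (z ^+ n)%:E <= ((1 - z)^-1)%:E)%E.
Proof.
move=> /andP[z0 z1]; apply: lime_le.
  by apply: is_cvg_nneseries => n _ _; rewrite lee_fin exprn_ge0.
apply: nearW => n; rewrite sumEFin lee_fin.
rewrite -(ler_pM2r (x := 1 - z)) ?subr_gt0// mulVf ?gt_eqF ?subr_gt0//.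
rewrite mulrC big_mkord.
have -> : (1 - z) * (\sum_(i < n) z ^+ i) = 1 - z ^+ n.
  by rewrite -[1 - z]opprB mulNr -subrX1 opprB.
by rewrite lerBlDr lerDl exprn_ge0.
Qed.

(* A discrete layer-cake formula: the levels are the powers [e ^ k], [k] an integer, with
   weights [e ^ (k q)]. *)
Lemma exists_levels q : 0 < q -> exists (lam w : nat -> R) (C : R),
  [/\ forall n, 0 < lam n, forall n, 0 <= w n, 0 <= C,
      forall a, 0 <= a ->
        ((a ^+ 2 * a `^ q)%:E <=
         C%:E * \sum_(n <oo) (w n * (Num.max (a - lam n) 0) ^+ 2)%:E)%E &
      forall b, 0 <= b ->
        (\sum_(n <oo) (w n * (lam n < b)%R%:R)%:E <= (C * b `^ q)%:E)%E].
Proof.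
move=> q0; pose e := int_of_nat; have [_ _ esurj] := int_of_nat_bij.
pose lam n := expR ((e n)%:~R : R); pose w n := expR ((e n)%:~R * q : R).
pose z : R := expR (- q).
have z01 : 0 <= z < 1 by rewrite expR_ge0/= expR_lt1 oppr_lt0.
pose C1 : R := 4 * expR (2 * q); pose C2 : R := (1 - z)^-1.
have C20 : 0 <= C2 by rewrite invr_ge0 subr_ge0 ltW//; case/andP: z01.
exists lam, w, (C1 + C2); split.
- by move=> n; exact: expR_gt0.
- by move=> n; exact: expR_ge0.
- by rewrite addr_ge0// mulr_ge0// expR_ge0.
- move=> a; rewrite le_eqVlt => /orP[/eqP <-|a0].
    rewrite expr0n mul0r mule_ge0//; first by rewrite lee_fin addr_ge0// mulr_ge0// expR_ge0.
    by apply: nneseries_ge0 => n _ _; rewrite lee_fin mulr_ge0 ?expR_ge0 ?sqr_ge0.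
  (* A single level suffices: [lam = e ^ k] lies between [a / e ^ 2] and [a / e]. As [e >= 2], the
     excess [a - lam] is at least [a / 2], which costs the 4 in [C1], and the weight loses at most
     [expR (2 * q)]. *)
  pose k := Num.floor (ln a) - 1.
  have [n _ en] : [set e x | x in setT] k by exact: esurj.
  have lE : lam n = expR (k%:~R) by rewrite /lam en.
  have wE : w n = expR (k%:~R * q) by rewrite /w en.
  have kle : (k%:~R : R) + 1 <= ln a by rewrite /k intrB subrK floor_le.
  have klt : ln a < (k%:~R : R) + 2.
    by have /andP[_] := floor_itv (ln a); rewrite /k intrB intrD /=; lra.
  have aE : expR (ln a) = a by rewrite lnK// posrE.
  have la : 2 * lam n <= a.
    apply: (@le_trans _ _ (expR (k%:~R + 1))); last by rewrite -[leRHS]aE ler_expR.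
    rewrite expRD mulrC lE ler_wpM2l ?expR_ge0//.
    by have := expR_ge1Dx (1 : R); lra.
  have l0 : 0 < lam n by exact: expR_gt0.
  have hq : a `^ q <= expR (2 * q) * w n.
    rewrite /powR gt_eqF// wE -expRD ler_expR -mulrDl mulrC ler_wpM2r ?ltW//; lra.
  have ha : a ^+ 2 <= 4 * (Num.max (a - lam n) 0) ^+ 2.
    rewrite (_ : Num.max _ _ = a - lam n); last by apply/max_idPl; lra.
    by nra.
  apply: (@le_trans _ _ (C1%:E * (w n * (Num.max (a - lam n) 0) ^+ 2)%:E)%E).
    rewrite -EFinM lee_fin /C1.
    rewrite [leRHS](_ : _ = 4 * (Num.max (a - lam n) 0) ^+ 2 * (expR (2 * q) * w n)); last by ring.
    by apply: ler_pM; rewrite ?sqr_ge0 ?powR_ge0.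
  apply: lee_pmul.
  - by rewrite lee_fin mulr_ge0// expR_ge0.
  - by rewrite lee_fin mulr_ge0 ?sqr_ge0// expR_ge0.
  - by rewrite lee_fin lerDl.
  - rewrite (nneseriesD1 (n := n))// ?leeDl//.
    + by apply: nneseries_ge0 => i _ _; rewrite lee_fin mulr_ge0 ?sqr_ge0// expR_ge0.
    + by move=> i _; rewrite lee_fin mulr_ge0 ?sqr_ge0// expR_ge0.
- move=> b; rewrite le_eqVlt => /orP[/eqP <-|b0].
    rewrite eseries0; first by rewrite powR0 ?gt_eqF// mulr0.
    by move=> n _ _; rewrite ltNge expR_ge0/= mulr0.
  (* Only the levels [k <= k0] lie below [b]; counted downwards from [k0], their weights form a
     geometric series of ratio [expR (- q) < 1]. *)
  pose k0 := Num.floor (ln b).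
  rewrite nneseries_esumT; last by move=> n; rewrite lee_fin mulr_ge0 ?expR_ge0.
  pose F (k : int) : \bar R := (expR (k%:~R * q) * (expR k%:~R < b)%R%:R)%:E.
  rewrite -(reindex_esum _ setT e F int_of_nat_bij).
  have h : (\esum_(k in [set: int]) F k <= \esum_(k in [set k | (k <= k0)%O]) (expR (k%:~R * q))%:E)%E.
    rewrite [leRHS]esum_mkcond; apply: le_esum => k _; rewrite /F.
    have [kb|kb] := boolP (expR k%:~R < b); last first.
      by rewrite mulr0; case: ifP => // _; rewrite lee_fin expR_ge0.
    rewrite mulr1 mem_set//=.
    by rewrite /k0 floor_ge_int -ler_expR lnK ?posrE// ltW.
  apply: (le_trans h).
  rewrite (reindex_esum setT _ (fun n : nat => k0 - n%:Z)); last first.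
    split.
    - by move=> n _ /=; rewrite lerBlDr lerDl.
    - by move=> m n _ _ /addrI/oppr_inj[].
    - move=> k /= kk0; exists `|k0 - k|%N => //.
      by rewrite gez0_abs ?subr_ge0// opprB addrC subrK.
  rewrite -nneseries_esumT; last by move=> n; rewrite lee_fin expR_ge0.
  apply: (@le_trans _ _ ((expR (k0%:~R * q))%:E * \sum_(n <oo) (z ^+ n)%:E)%E).
    rewrite -nneseriesZl; last by move=> n _; rewrite lee_fin exprn_ge0// expR_ge0.
    apply: lee_nneseries => n _; rewrite ?lee_fin ?expR_ge0//.
    rewrite /z -expRM_natl -expRD ler_expR intrB.
    by rewrite mulrBl mulrN.
  apply: (@le_trans _ _ ((b `^ q)%:E * C2%:E)%E).
    apply: lee_pmul.
    - by rewrite lee_fin expR_ge0.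
    - by apply: nneseries_ge0 => n _ _; rewrite lee_fin exprn_ge0// expR_ge0.
    - rewrite lee_fin /powR gt_eqF// ler_expR mulrC.
      by apply: ler_wpM2l; [exact: ltW|exact: floor_le].
    - exact: nneseries_geometric_le.
  rewrite -EFinM lee_fin mulrC ler_wpM2r ?powR_ge0// lerDr.
  by rewrite mulr_ge0// expR_ge0.
Qed.
End levels.

(** * From the level decomposition to the bound from L^p to L^p(l^p) *)

Section interpolation.
Context {R : realType}.
Local Notation mu := (@lebesgue_measure R).
Implicit Types (f g u K w : R -> R) (a b e t x y xi M p l : R).

Lemma le_1D_powR a p : 1 <= p -> 0 <= a -> a <= 1 + a `^ p.
Proof.
move=> p1 a0; have [a1|a1] := leP a 1.
  by rewrite (le_trans a1)// lerDl powR_ge0.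
by rewrite (le_trans (le1r_powR (ltW a1) p1))// lerDr.
Qed.

(** By [|u| <= 1 + |u| ^ p] the product is dominated by two terms: the first is integrable because
    [K] is, the second because [K] is bounded. *)
Lemma L1_mul_reflect_powR u K M p x : 1 <= p -> measurable_fun setT u ->
  L1 (fun x => `|u x| `^ p) -> L1 K -> (forall x, `|K x| <= M) ->
  L1 (fun y => u y * K (x - y)).
Proof.
move=> p1 mu_ lup lK KM.
have lKx := L1_reflect x (L1_norm lK).
apply: L1_le (L1D lKx (L1Z M lup)).
  by apply: measurable_funM => //; apply: (measurableT_comp (L1_measurable lK)); exact: measurable_funB.
move=> y; rewrite normrM.
apply: (@le_trans _ _ ((1 + `|u y| `^ p) * `|K (x - y)|)).
  by rewrite ler_wpM2r// le_1D_powR.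
by rewrite mulrDl mul1r lerD2l mulrC ler_wpM2r ?powR_ge0.
Qed.

(** The truncations of [u] to [[- n, n]] are integrable, so their convolutions are continuous; they
    converge pointwise to [conv u K]. *)
Lemma measurable_conv u K M p : 1 <= p -> measurable_fun setT u ->
  L1 (fun x => `|u x| `^ p) -> L1 K -> continuous K -> (forall x, `|K x| <= M) ->
  measurable_fun setT (conv u K).
Proof.
move=> p1 mu_ lup lK cK KM.
pose cut (n : nat) : R -> R := fun y => u y * \1_(`[- n%:R, n%:R] : set R) y.
have mcut n : measurable_fun setT (cut n) by exact: measurable_funM.
have ule n y : `|cut n y| <= `|u y|.
  by rewrite /cut normrM ler_piMr// indicE; case: (_ \in _); rewrite ?normr1 ?normr0.
have lcut n : L1 (cut n).
  have l1 : L1 (\1_(`[- n%:R, n%:R] : set R)) by apply/L1P; exact: integrable_indic_itv.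
  apply: L1_le (L1D l1 lup) => // y.
  have [yn|yn] := boolP (y \in (`[- n%:R, n%:R]%classic : set R)).
    by rewrite /cut indicE yn mulr1 le_1D_powR.
  by rewrite /cut indicE (negbTE yn) mulr0 normr0 add0r powR_ge0.
apply: (@measurable_fun_cvg _ _ _ _ (fun n => conv (cut n) K)).
  by move=> n; apply: continuous_measurable_fun; exact: continuous_conv KM.
move=> x _; have luK := L1_mul_reflect_powR x p1 mu_ lup lK KM.
apply: (@Rintegral_dominated_cvg _ _ _ (fun y => `|u y * K (x - y)|)).
- by move=> n; exact: L1_measurable (L1_mul_reflect x (lcut n) (L1_measurable lK) KM).
- move=> y; apply: cvgMl; rewrite -[X in _ --> X]mulr1; apply: cvgMr.
  apply: cvg_near_cst; near=> n; rewrite indicE mem_set//= in_itv/= -ler_norml.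
  near: n; exact: nbhs_infty_ger.
- exact: L1_norm.
- by move=> n y; rewrite normrM [leRHS]normrM; apply: ler_wpM2r => //; exact: ule.
Unshelve. all: by end_near. Qed.

Definition high l u : R -> R := fun y => if l < `|u y| then u y else 0.

Lemma measurable_high l u : measurable_fun setT u -> measurable_fun setT (high l u).
Proof.
move=> mu_; apply: measurable_fun_ifT => //.
by apply: measurable_fun_ltr => //; exact: measurableT_comp.
Qed.

(** Where [|u| > l] the ratio [|u| / l] exceeds 1, and raising its exponent from [k] to [p] only
    enlarges it. The cases [k = 1] and [k = 2] place [high l u] in L^1 and L^2, where Plancherel is
    available. *)
Lemma high_powR l u p y k : 0 < l -> (0 < k)%N -> k%:R <= p ->
  `|high l u y| ^+ k <= l ^+ k * l^-1 `^ p * `|u y| `^ p.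
Proof.
move=> l0 k0 kp; rewrite /high; case: ifPn => [lu|_]; last first.
  by rewrite normr0 expr0n gtn_eqF// !mulr_ge0 ?powR_ge0 ?exprn_ge0// ltW.
have h1 : 1 <= `|u y| / l by rewrite ler_pdivlMr// mul1r ltW.
have -> : `|u y| ^+ k = l ^+ k * (`|u y| / l) `^ k%:R.
  by rewrite powR_mulrn ?(le_trans ler01)// -exprMn mulrC divfK// gt_eqF.
rewrite -mulrA; apply: ler_wpM2l; first by rewrite exprn_ge0// ltW.
have -> : l^-1 `^ p * `|u y| `^ p = (`|u y| / l) `^ p.
  by rewrite mulrC powRM// invr_ge0 ltW.
exact: ler_powR.
Qed.

Lemma L1_high l u p k : 0 < l -> (0 < k)%N -> k%:R <= p -> measurable_fun setT u ->
  L1 (fun x => `|u x| `^ p) -> L1 (fun x => high l u x ^+ k).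
Proof.
move=> l0 k0 kp mu_ lup; apply: L1_le (L1Z (l ^+ k * l^-1 `^ p) lup).
  by apply: measurable_funX; exact: measurable_high.
by move=> y; rewrite normrX; exact: high_powR.
Qed.

(* The part of [u] below [l] contributes at most [l * B] to the convolution. *)
Lemma conv_high_le l u K M B p x : 0 < l -> 1 <= p -> measurable_fun setT u ->
  L1 (fun x => `|u x| `^ p) -> L1 K -> (forall x, `|K x| <= M) ->
  \int[mu]_x `|K x| <= B ->
  Num.max (`|conv u K x| - l * B) 0 ^+ 2 <= conv (high l u) K x ^+ 2.
Proof.
move=> l0 p1 mu_ lup lK KM KB.
have lh : L1 (high l u).
  have := @L1_high l u p 1 l0 isT p1 mu_ lup.
  by rewrite (_ : (fun _ => _) = high l u).
have luK := L1_mul_reflect_powR x p1 mu_ lup lK KM.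
have lhK := L1_mul_reflect x lh (L1_measurable lK) KM.
have lKx := L1_reflect x (L1_norm lK).
have -> : conv u K x = conv (high l u) K x + \int[mu]_y (u y * K (x - y) - high l u y * K (x - y)).
  by rewrite (RintegralBE luK lhK) addrC subrK.
have low : `|\int[mu]_y (u y * K (x - y) - high l u y * K (x - y))| <= l * B.
  apply: (@le_trans _ _ (l * \int[mu]_y `|K y|)); last by rewrite ler_wpM2l// ltW.
  rewrite -(Rintegral_reflect x (L1_norm lK)) -(RintegralZE l lKx).
  apply: Rintegral_normr_le.
  - exact: L1B.
  - exact: L1Z.
  - move=> y; rewrite -mulrBl normrM ler_wpM2r// /high.
    by case: ifPn; rewrite ?subrr ?normr0 ?subr0 -?leNgt// ltW.
move: (conv _ _ _) (Rintegral _ _ _) low => a b low.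
rewrite -[leRHS]real_normK ?num_real//.
have h : Num.max (`|a + b| - l * B) 0 <= `|a|.
  by rewrite ge_max normr_ge0 andbT lerBlDr (le_trans (ler_normD _ _))// lerD2l.
by rewrite ler_sqr// nnegrE le_max lexx orbT.
Qed.

Lemma sum_nneseries (I : Type) (s : seq I) (a : I -> nat -> \bar R) :
  (forall i n, 0 <= a i n)%E ->
  (\sum_(i <- s) \sum_(n <oo) a i n = \sum_(n <oo) \sum_(i <- s) a i n)%E.
Proof.
move=> a0; elim: s => [|i s IH].
  by rewrite big_nil eseries0// => n _ _; rewrite big_nil.
rewrite big_cons IH -nneseriesD//; last by move=> n _ _; apply: sume_ge0 => j _; exact: a0.
by apply: eq_eseriesr => n _; rewrite big_cons.
Qed.

(** For the output level [lam] the input is cut at [lam / B1]: the low part changes the convolution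
    by at most [lam], so the excess over [lam] is controlled by the convolution of the high part, to
    which the L^2 bound applies. Summing over the levels with [q = p - 2] rebuilds the power [p] on
    both sides. The constant sees neither the list nor the sup bounds [M]. *)
Lemma conv_Lp_lp_bound p B1 B2 : 2 < p -> 0 < B1 -> 0 <= B2 -> exists2 C, 0 <= C &
  forall (I : Type) (s : seq I) (K : I -> R -> R) (M : I -> R) u,
  (forall j, L1 (K j)) -> (forall j, continuous (K j)) ->
  (forall j x, `|K j x| <= M j) ->
  (forall j, \int[mu]_x `|K j x| <= B1) ->
  (forall xi, \sum_(j <- s) pw (K j) xi <= B2) ->
  measurable_fun setT u -> L1 (fun x => `|u x| `^ p) ->
  (\sum_(j <- s) \int[mu]_x (`|conv u (K j) x| `^ p)%:E <=
    C%:E * \int[mu]_x (`|u x| `^ p)%:E)%E.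
Proof.
move=> p2 B10 B20; pose q := p - 2.
have q0 : 0 < q by rewrite subr_gt0.
have [lam [w [C [lam0 w0 C0 lev1 lev2]]]] := exists_levels q0.
have p1 : 1 <= p by lra.
have pE a : 0 <= a -> a `^ p = a ^+ 2 * a `^ q.
  move=> a0; rewrite -powR_mulrn// -powRD /q; last by apply/implyP; rewrite addrC subrK gt_eqF//; lra.
  by rewrite addrC subrK.
(* One [C] for each of the two level inequalities, [B2] from the L^2 bound, and the power of [B1]
   because the input is cut at [lam / B1]. *)
exists (C * B2 * C * B1 `^ q); first by rewrite !mulr_ge0// powR_ge0.
move=> I s K M u lK cK KM KB KB2 mu_ lup.
pose l n := lam n / B1.
have l0 n : 0 < l n by rewrite divr_gt0.
have lB n : l n * B1 = lam n by rewrite divfK// gt_eqF.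
have lh n : L1 (high (l n) u).
  have := @L1_high (l n) u p 1 (l0 n) isT p1 mu_ lup.
  by rewrite (_ : (fun _ => _) = high (l n) u).
have lh2 n : L1 (fun x => high (l n) u x ^+ 2).
  by apply: L1_high lup => //; rewrite ltW.
have mT j : measurable_fun setT (conv u (K j)) by exact: (measurable_conv p1 mu_ lup (lK j) (cK j) (KM j)).
pose G j n x := w n * (Num.max (`|conv u (K j) x| - lam n) 0) ^+ 2.
have G0 j n x : 0 <= G j n x by rewrite mulr_ge0 ?sqr_ge0.
have mG j n : measurable_fun setT (fun x => (G j n x)%:E).
  apply/measurable_EFinP; apply: measurable_funM => //; apply: measurable_funX.
  apply: measurable_maxr => //; apply: measurable_funB => //.
  exact: measurableT_comp.
have level n : (\sum_(j <- s) \int[mu]_x (G j n x)%:E <=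
    (w n * B2)%:E * \int[mu]_x (high (l n) u x ^+ 2)%:E)%E.
  rewrite EFinM -muleA.
  apply: (@le_trans _ _ ((w n)%:E * \sum_(j <- s) \int[mu]_x (conv (high (l n) u) (K j) x ^+ 2)%:E)%E); last first.
    by apply: lee_wpmul2l; [rewrite lee_fin|exact: sum_conv_sqr_le KM KB2 _ _].
  rewrite ge0_sume_distrr; last by move=> j _; apply: integral_ge0 => x _; rewrite lee_fin sqr_ge0.
  apply: lee_sum => j _.
  have mc : measurable_fun setT (fun x => (conv (high (l n) u) (K j) x ^+ 2)%:E).
    apply/measurable_EFinP; apply: measurable_funX; apply: continuous_measurable_fun.
    exact: continuous_conv (KM j).
  rewrite -ge0_integralZl_EFin//; last by move=> x _; rewrite lee_fin sqr_ge0.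
  apply: ge0_le_integral => //.
  - by move=> x _; rewrite lee_fin.
  - exact: mG.
  - exact: measurable_funeM.
  - move=> x _; rewrite -EFinM lee_fin /G ler_wpM2l// -lB.
    exact: conv_high_le (l0 n) p1 mu_ lup (lK j) (KM j) (KB j).
have step1 j : (\int[mu]_x (`|conv u (K j) x| `^ p)%:E <=
    C%:E * \sum_(n <oo) \int[mu]_x (G j n x)%:E)%E.
  have mA : measurable_fun setT (fun x => `|conv u (K j) x|) by exact: measurableT_comp.
  rewrite -integral_nneseries; [|by []|exact: mG|by move=> n x _; rewrite lee_fin].
  have mS : measurable_fun setT (fun x => (\sum_(n <oo) (G j n x)%:E)%E).
    by apply: ge0_emeasurable_sum => // n x _ _; rewrite lee_fin.
  have S0 x : (0 <= \sum_(n <oo) (G j n x)%:E)%E.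
    by apply: nneseries_ge0 => n _ _; rewrite lee_fin.
  rewrite -ge0_integralZl_EFin//.
  apply: ge0_le_integral => //.
  - apply/measurable_EFinP; exact: (measurableT_comp (measurable_powR p) mA).
  - exact: measurable_funeM.
  - by move=> x _; rewrite pE//; exact: lev1.
apply: (@le_trans _ _ (\sum_(j <- s) C%:E * \sum_(n <oo) \int[mu]_x (G j n x)%:E)%E).
  exact: lee_sum.
have iG0 j n : (0 <= \int[mu]_x (G j n x)%:E)%E by apply: integral_ge0 => x _; rewrite lee_fin.
rewrite -ge0_sume_distrr; last by move=> j _; exact: nneseries_ge0.
rewrite sum_nneseries//.
pose H n x := w n * high (l n) u x ^+ 2.
have H0 n x : 0 <= H n x by rewrite mulr_ge0 ?sqr_ge0.
have mH n : measurable_fun setT (fun x => (H n x)%:E).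
  apply/measurable_EFinP; apply: measurable_funM => //; apply: measurable_funX.
  exact: measurable_high.
apply: (@le_trans _ _ (C%:E * (B2%:E * \sum_(n <oo) \int[mu]_x (H n x)%:E))%E).
  apply: lee_wpmul2l; first by rewrite lee_fin.
  rewrite -nneseriesZl; last by move=> n _; apply: integral_ge0 => x _; rewrite lee_fin.
  apply: lee_nneseries => n _; first by move=> _; exact: sume_ge0.
  apply: le_trans (level n) _; rewrite mulrC EFinM -muleA; apply: lee_wpmul2l; first by rewrite lee_fin.
  rewrite -ge0_integralZl_EFin//; last 2 first.
  - by move=> x _; rewrite lee_fin sqr_ge0.
  - by apply/measurable_EFinP; apply: L1_measurable; exact: lh2.
rewrite -integral_nneseries; [|by []|exact: mH|by move=> n x _; rewrite lee_fin].
rewrite -[C * B2 * C * _]mulrA EFinM -muleA EFinM -muleA.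
apply: lee_wpmul2l; first by rewrite lee_fin.
apply: lee_wpmul2l; first by rewrite lee_fin.
have mup : measurable_fun setT (fun x => (`|u x| `^ p)%:E).
  by apply/measurable_EFinP; exact: L1_measurable.
rewrite -ge0_integralZl_EFin//; last by rewrite mulr_ge0 ?powR_ge0.
apply: ge0_le_integral => //.
- by move=> x _; apply: nneseries_ge0 => n _ _; rewrite lee_fin.
- apply: ge0_emeasurable_sum; first by move=> n x _ _; rewrite lee_fin.
  by move=> n _; exact: mH.
- exact: measurable_funeM.
move=> x _.
(* Level [n] sees the point [x] exactly when [lam n < B1 * |u x|], and then contributes the full
   square of [u x]; the second level inequality sums these weights. *)
have HE n : (H n x)%:E = ((`|u x| ^+ 2)%:E * (w n * (lam n < B1 * `|u x|)%R%:R)%:E)%E.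
  rewrite /H /high -EFinM /l ltr_pdivrMr// [_ * B1]mulrC.
  by case: ifPn => _; congr EFin; rewrite ?mulr1 ?mulr0 ?expr0n ?mulr0// mulrC real_normK ?num_real.
under eq_eseriesr do rewrite HE.
rewrite nneseriesZl; last by move=> n _; rewrite lee_fin mulr_ge0.
apply: (@le_trans _ _ ((`|u x| ^+ 2)%:E * (C * (B1 * `|u x|) `^ q)%:E)%E).
  by apply: lee_wpmul2l; [rewrite lee_fin sqr_ge0|apply: lev2; rewrite mulr_ge0// ltW].
rewrite -!EFinM lee_fin pE// powRM ?(ltW B10)//.
by rewrite le_eqVlt; apply/orP; left; apply/eqP; ring.
Qed.
End interpolation.

(** * Integrability of a kernel with localized smooth transform *)

Section kernel_bound.
Context {R : realType}.
Local Notation mu := (@lebesgue_measure R).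
Implicit Types (f g u K : R -> R) (a b e h t x y xi M B w : R).

Lemma continuous_sin_mul h : continuous (fun x : R => sin (2 * pi * h * x)).
Proof. exact: continuous_sin_comp. Qed.

Lemma sin_quotient_cvg a : n.+1%:R * sin (n.+1%:R^-1 * a) @[n --> \oo] --> a.
Proof.
have d : is_derive (0 : R) 1 (fun t => sin (t * a)) a.
  by apply: is_derive_eq; rewrite mul0r cos0 /GRing.scale/= mul1r !mulr1 mulr0 add0r.
have [dv dE] := d.
have H : (h^-1 *: (sin ((h *: 1 + 0) * a) - sin (0 * a))) @[h --> (0 : R)^'] --> a.
  by rewrite -[X in _ --> X]dE; exact: dv.
have [/(_ H) + _] := cvgr_dnbhsP (fun h : R => h^-1 *: (sin ((h *: 1 + 0) * a) - sin (0 * a))) 0 a.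
move=> /(_ (fun n => n.+1%:R^-1)).
have -> : (fun n : nat => n.+1%:R * sin (n.+1%:R^-1 * a)) =
  (fun n : nat => (n.+1%:R^-1)^-1 *: (sin ((n.+1%:R^-1 *: 1 + 0) * a) - sin (0 * a))) :> (nat -> R).
  by apply/funext => n; rewrite mul0r sin0 subr0 addr0 invrK /GRing.scale/= mulr1.
apply; split; last exact: cvg_harmonic.
by move=> n; rewrite invr_eq0.
Qed.

Lemma cosT_mul_sin K h xi : L1 K ->
  cosT (fun x => K x * sin (2 * pi * h * x)) xi = 2^-1 * (sinT K (xi + h) - sinT K (xi - h)).
Proof.
move=> lK; rewrite /sinT -(RintegralBE (L1_sin _ lK) (L1_sin _ lK)).
rewrite -(RintegralZE _ (L1B (L1_sin _ lK) (L1_sin _ lK))).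
apply: eq_Rintegral => x _; have -> : 2 * pi * x * (xi + h) = 2 * pi * x * xi + 2 * pi * h * x by ring.
have -> : 2 * pi * x * (xi - h) = 2 * pi * x * xi - 2 * pi * h * x by ring.
rewrite sinB sinD.
by field.
Qed.

Lemma sinT_mul_sin K h xi : L1 K ->
  sinT (fun x => K x * sin (2 * pi * h * x)) xi = 2^-1 * (cosT K (xi - h) - cosT K (xi + h)).
Proof.
move=> lK; rewrite /cosT -(RintegralBE (L1_cos _ lK) (L1_cos _ lK)).
rewrite -(RintegralZE _ (L1B (L1_cos _ lK) (L1_cos _ lK))).
apply: eq_Rintegral => x _; have -> : 2 * pi * x * (xi + h) = 2 * pi * x * xi + 2 * pi * h * x by ring.
have -> : 2 * pi * x * (xi - h) = 2 * pi * x * xi - 2 * pi * h * x by ring.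
rewrite cosB cosD.
by field.
Qed.

Section bound.
Variables (K : R -> R) (E : set R) (M B w : R).
Hypotheses (lK : L1 K) (cK : continuous K) (KM : forall x, `|K x| <= M).
Hypotheses (mE : measurable E) (w0 : 0 < w) (Ew : (mu E <= w%:E)%E).
Hypotheses (cosE : forall xi, ~ E xi -> cosT K xi = 0)
  (sinE : forall xi, ~ E xi -> sinT K xi = 0).
Hypotheses (cosB : forall xi, `|cosT K xi| <= B) (sinB : forall xi, `|sinT K xi| <= B).
Hypotheses (cosL : forall xi eta, `|cosT K xi - cosT K eta| <= B / w * `|xi - eta|)
  (sinL : forall xi eta, `|sinT K xi - sinT K eta| <= B / w * `|xi - eta|).

Let B0 : 0 <= B. Proof. exact: le_trans (cosB 0). Qed.

Let sqr_le (a b : R) : `|a| <= b -> a ^+ 2 <= b ^+ 2.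
Proof.
by move=> ab; rewrite -real_normK ?num_real// ler_sqr ?nnegrE// (le_trans _ ab).
Qed.

Let mIE t : measurable_fun setT (fun xi => (\1_E (xi + t) : R)).
Proof.
apply: (measurableT_comp (f := (\1_E : R -> R))); first exact: measurable_indic.
exact: measurable_funD.
Qed.

Let int_IE t : (\int[mu]_xi (\1_E (xi + t)%R)%:E <= w%:E)%E.
Proof.
rewrite (ge0_integral_shift t (f := fun xi => (\1_E xi)%:E)).
- by rewrite integral_indic// setIT.
- by apply/measurable_EFinP; exact: measurable_indic.
- by move=> x; rewrite lee_fin.
Qed.

(** Each translate of [E] has measure at most [w], so only the number of translates counts: one for
    [K] itself, two for the difference quotient of its transform. *)
Let half_integral_le (f : R -> R) (c : R) (s : seq R) : 0 <= c -> measurable_fun setT f -> (forall xi, 0 <= f xi) ->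
  (forall xi, f xi <= c * \sum_(t <- s) \1_E (xi + t)) ->
  (\int[mu]_(xi in `[0%R, +oo[) (f xi)%:E <= (c * (size s)%:R * w)%:E)%E.
Proof.
move=> c0 mf f0 fle.
have mS : measurable_fun setT (fun xi => ((\sum_(t <- s) \1_E (xi + t))%:E : \bar R)).
  by apply/measurable_EFinP; apply: measurable_sum => t; exact: mIE.
apply: (@le_trans _ _ (\int[mu]_xi (f xi)%:E)%E).
  apply: ge0_subset_integral => //; first exact/measurable_EFinP.
  by move=> x _; rewrite lee_fin.
apply: (@le_trans _ _ (\int[mu]_xi (c%:E * (\sum_(t <- s) \1_E (xi + t))%:E))%E).
  apply: ge0_le_integral => //.
  - by move=> x _; rewrite lee_fin.
  - exact/measurable_EFinP.
  - exact: measurable_funeM.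
  - by move=> x _; rewrite -EFinM lee_fin.
rewrite ge0_integralZl_EFin//; last by move=> x _; rewrite lee_fin sumr_ge0.
rewrite -mulrA EFinM; apply: lee_wpmul2l; first by rewrite lee_fin.
under eq_integral do rewrite -sumEFin.
rewrite ge0_integral_sum//; last first.
- by move=> t; apply/measurable_EFinP; exact: mIE.
apply: (@le_trans _ _ (\sum_(t <- s) w%:E)%E).
  by apply: lee_sum => t _; exact: int_IE.
by rewrite sumEFin big_const_seq count_predT iter_addr_0 mulr_natl.
Qed.

Let indE (xi : R) : (\1_E xi : R) = 1 \/ cosT K xi = 0 /\ sinT K xi = 0.
Proof.
rewrite indicE; case: (boolP (xi \in E)) => [_|]; first by left.
by rewrite notin_setE => nE; right; rewrite cosE ?sinE.
Qed.

Let ind_ge0 (xi : R) : 0 <= (\1_E xi : R). Proof. by []. Qed.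

Let int_K2 : (\int[mu]_x (K x ^+ 2)%:E <= (4 * B ^+ 2 * w)%:E)%E.
Proof.
have lK2 := L1_sqr lK KM.
have h := integral_pw_ge lK cK KM.
have h' : (\int[mu]_(xi in `[0%R, +oo[) (pw K xi)%:E <= (2 * B ^+ 2 * (size [:: (0 : R)])%:R * w)%:E)%E.
  apply: half_integral_le.
  - by rewrite mulr_ge0 ?sqr_ge0.
  - exact: measurable_pw.
  - by move=> xi; exact: pw_ge0.
  - move=> xi; rewrite big_seq1 addr0 /pw.
    have := sqr_le (cosB xi); have := sqr_le (sinB xi); have [->|[-> ->]] := indE xi.
      by lra.
    by rewrite expr0n addr0 !mulr_ge0 ?sqr_ge0.
move: (le_trans h h'); rewrite -EFin_Rintegral// !lee_fin /=; lra.
Qed.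

(* [x * K x] is reached as a limit of [K x * sin (2 pi h x) / (2 pi h)], whose transform is a
   difference quotient of that of [K]; no derivative of the transform is needed. *)
Let int_K2sin h : 0 < h ->
  (\int[mu]_x ((K x * sin (2 * pi * h * x)) ^+ 2)%:E <= (8 * B ^+ 2 / w * h ^+ 2)%:E)%E.
Proof.
move=> h0; set g := fun x => K x * sin (2 * pi * h * x).
have gM x : `|g x| <= M.
  by rewrite normrM -[leRHS]mulr1 ler_pM// normr_sin_le1.
have cg : continuous g.
  by move=> x; apply: cvgM; [exact: cK|exact: continuous_sin_mul].
have lg : L1 g.
  apply: (L1_bounded_mul lK (continuous_measurable_fun (@continuous_sin_mul h)) (M := 1)) => x.
  exact: normr_sin_le1.
have h1 := integral_pw_ge lg cg gM.
have wi : 0 <= B / w by rewrite divr_ge0// ltW.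
have dc xi : `|cosT K (xi - h) - cosT K (xi + h)| <= B / w * (2 * h).
  have := cosL (xi - h) (xi + h); rewrite (_ : xi - h - (xi + h) = - (2 * h)); last by ring.
  by rewrite normrN (ger0_norm (x := 2 * h))// mulr_ge0// ltW.
have ds xi : `|sinT K (xi + h) - sinT K (xi - h)| <= B / w * (2 * h).
  have := sinL (xi + h) (xi - h); rewrite (_ : xi + h - (xi - h) = 2 * h); last by ring.
  by rewrite (ger0_norm (x := 2 * h))// mulr_ge0// ltW.
(* Both half-differences are at most [B / w * h], and both vanish when neither [xi + h] nor [xi - h]
   lies in [E]. *)
have h' : (\int[mu]_(xi in `[0%R, +oo[) (pw g xi)%:E <= (2 * (B / w * h) ^+ 2 * (size [:: h; - h])%:R * w)%:E)%E.
  apply: half_integral_le.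
  - by rewrite mulr_ge0 ?sqr_ge0.
  - exact: measurable_pw.
  - by move=> xi; exact: pw_ge0.
  - move=> xi; rewrite big_cons big_seq1 /pw (cosT_mul_sin _ _ lK) (sinT_mul_sin _ _ lK).
    have hc := sqr_le (dc xi); have hs := sqr_le (ds xi).
    have key : (2^-1 * (sinT K (xi + h) - sinT K (xi - h))) ^+ 2 +
      (2^-1 * (cosT K (xi - h) - cosT K (xi + h))) ^+ 2 <= 2 * (B / w * h) ^+ 2.
      move: hc hs; rewrite (_ : (B / w * (2 * h)) ^+ 2 = 4 * (B / w * h) ^+ 2); last by ring.
      rewrite !exprMn; move: (_ ^+ 2) (_ ^+ 2) => a b; lra.
    have q0 : 0 <= 2 * (B / w * h) ^+ 2 by rewrite mulr_ge0 ?sqr_ge0.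
    have := ind_ge0 (xi + h); have := ind_ge0 (xi - h).
    have [e1|[c1 s1]] := indE (xi + h); first by rewrite e1 => *; apply: le_trans key _; nra.
    have [e2|[c2 s2]] := indE (xi - h); first by rewrite e2 => *; apply: le_trans key _; nra.
    by move=> *; rewrite c1 s1 c2 s2 subrr mulr0 expr0n addr0 mulr_ge0// addr_ge0.
move: (le_trans h1 h'); rewrite -EFin_Rintegral; last exact: L1_sqr gM.
rewrite !lee_fin /= => H.
have -> : 8 * B ^+ 2 / w * h ^+ 2 = 2 * (2 * (B / w * h) ^+ 2 * 2 * w) by field; rewrite gt_eqF.
lra.
Qed.

Let int_x2K2 : (\int[mu]_x ((x * K x) ^+ 2)%:E <= (8 * B ^+ 2 / w)%:E)%E.
Proof.
have mK := continuous_measurable_fun cK.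
(* Since [2 * pi >= 1], the factor only enlarges the integral; [2 * pi * x] is the limit of
   [n.+1 * sin (2 * pi * x / n.+1)], and Fatou applies with [h = 1 / n.+1]. *)
apply: (@le_trans _ _ (\int[mu]_x ((2 * pi * x * K x) ^+ 2)%:E)%E).
  apply: ge0_le_integral => //.
  - by move=> x _; rewrite lee_fin sqr_ge0.
  - by apply/measurable_EFinP; apply: measurable_funX; exact: measurable_funM.
  - by apply/measurable_EFinP; apply: measurable_funX; exact: measurable_funM.
  - move=> x _; rewrite lee_fin -mulrA [leRHS]exprMn ler_peMl ?sqr_ge0//.
    rewrite exprn_ege1//; have := pi_ge2 R; lra.
apply: (@integral_le_limit _ (fun n x => (n.+1%:R * (K x * sin (2 * pi * n.+1%:R^-1 * x))) ^+ 2)).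
- move=> n; apply: measurable_funX; apply: measurable_funM => //; apply: measurable_funM => //.
  by apply: continuous_measurable_fun; exact: continuous_sin_mul.
- by move=> n x; exact: sqr_ge0.
- move=> x; rewrite (_ : 2 * pi * x * K x = K x * (2 * pi * x)); last by rewrite mulrC.
  have -> : (fun n : nat => (n.+1%:R * (K x * sin (2 * pi * n.+1%:R^-1 * x))) ^+ 2) =
     (fun n : nat => (K x * (n.+1%:R * sin (n.+1%:R^-1 * (2 * pi * x)))) ^+ 2).
    apply/funext => n; congr (_ ^+ 2); rewrite mulrCA; congr (_ * (_ * sin _)); ring.
  apply: (@cvg_comp _ _ _ _ (fun y : R => y ^+ 2)); last exact: exprn_continuous.
  by apply: cvgMr; exact: sin_quotient_cvg.
- move=> n; have n0 : 0 < n.+1%:R^-1 :> R by rewrite invr_gt0.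
  have H := int_K2sin n0.
  under eq_integral do rewrite exprMn EFinM.
  have mKs : measurable_fun setT (fun x => ((K x * sin (2 * pi / n.+1%:R * x)) ^+ 2)%:E).
    apply/measurable_EFinP; apply: measurable_funX; apply: measurable_funM => //.
    by apply: continuous_measurable_fun; exact: continuous_sin_mul.
  rewrite ge0_integralZl_EFin; [|by []|by move=> x _; rewrite lee_fin sqr_ge0|exact: mKs|exact: sqr_ge0].
  apply: (le_trans (lee_wpmul2l _ H)); first by rewrite lee_fin sqr_ge0.
  rewrite -EFinM lee_fin mulrCA -exprMn mulfV// expr1n mulr1//.
Qed.

(* AM-GM: [2 |K| <= t K^2 + 1 / t] with [t = (1 + w^2 x^2) / w]. *)
Let amgm x : `|K x| <= 2^-1 * (w^-1 * K x ^+ 2 + (w * (x * K x) ^+ 2 + w * bump (w * x + 0))).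
Proof.
have -> : bump (w * x + 0) = (1 + (w * x) ^+ 2)^-1 by rewrite bumpE addr0.
rewrite exprMn -[K x ^+ 2]real_normK ?num_real//; set k := `|K x|.
pose t := (1 + (w * x) ^+ 2) / w.
have t1 : 0 < 1 + (w * x) ^+ 2 by rewrite ltr_pwDl ?sqr_ge0.
have t0 : 0 < t by rewrite divr_gt0.
have -> : w^-1 * k ^+ 2 + (w * (x ^+ 2 * k ^+ 2) + w * (1 + (w * x) ^+ 2)^-1) = t * k ^+ 2 + t^-1.
  by rewrite /t; field; rewrite !gt_eqF.
have -> : t * k ^+ 2 + t^-1 = 2 * k + t^-1 * (t * k - 1) ^+ 2.
  by field; rewrite gt_eqF.
have : 0 <= t^-1 * (t * k - 1) ^+ 2 by rewrite mulr_ge0 ?sqr_ge0// invr_ge0 ltW.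
lra.
Qed.

(** Integrating [amgm] gives half of [4 * B ^ 2 + 8 * B ^ 2 + pi]. Each of the three weights
    compensates its power of [w], so the bound is the same at all scales. *)
Lemma kernel_L1_le : \int[mu]_x `|K x| <= 6 * B ^+ 2 + pi.
Proof.
have mK := continuous_measurable_fun cK.
rewrite -lee_fin (EFin_Rintegral (L1_norm lK)).
have w1 : w != 0 by rewrite gt_eqF.
have lb := L1_affine 0 w1 L1_bump.
have mb : measurable_fun setT (fun x => (w * bump (w * x + 0))%:E).
  by apply/measurable_EFinP; apply: measurable_funM => //; exact: L1_measurable.
have mA : measurable_fun setT (fun x => (w^-1 * K x ^+ 2)%:E).
  by apply/measurable_EFinP; apply: measurable_funM => //; exact: measurable_funX.
have mC : measurable_fun setT (fun x => (w * (x * K x) ^+ 2)%:E).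
  by apply/measurable_EFinP; apply: measurable_funM => //; apply: measurable_funX; exact: measurable_funM.
have wv : 0 <= w^-1 by rewrite invr_ge0 ltW.
have A0 x : (0 <= (w^-1 * K x ^+ 2)%:E)%E by rewrite lee_fin mulr_ge0 ?sqr_ge0.
have C0 x : (0 <= (w * (x * K x) ^+ 2)%:E)%E by rewrite lee_fin mulr_ge0 ?sqr_ge0// ltW.
have b0 x : (0 <= (w * bump (w * x + 0))%:E)%E by rewrite lee_fin mulr_ge0 ?bump_ge0// ltW.
apply: (@le_trans _ _ (\int[mu]_x ((2^-1)%:E * ((w^-1 * K x ^+ 2)%:E + ((w * (x * K x) ^+ 2)%:E + (w * bump (w * x + 0))%:E))))%E).
  apply: ge0_le_integral => //.
  - by apply/measurable_EFinP; exact: measurableT_comp.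
  - by apply: measurable_funeM; apply: emeasurable_funD => //; exact: emeasurable_funD.
  - by move=> x _; rewrite -!EFinD -EFinM lee_fin; exact: amgm.
rewrite ge0_integralZl_EFin//; last 2 first.
- by move=> x _; rewrite adde_ge0// adde_ge0.
- by apply: emeasurable_funD => //; exact: emeasurable_funD.
rewrite ge0_integralD//; last 2 first.
- by move=> x _; rewrite adde_ge0.
- exact: emeasurable_funD.
rewrite ge0_integralD//.
have i1 : (\int[mu]_x (w^-1 * K x ^+ 2)%:E <= (4 * B ^+ 2)%:E)%E.
  under eq_integral do rewrite EFinM.
  rewrite ge0_integralZl_EFin//; last 2 first.
  - by move=> x _; rewrite lee_fin sqr_ge0.
  - by apply/measurable_EFinP; exact: measurable_funX.
  apply: (le_trans (lee_wpmul2l _ int_K2)); first by rewrite lee_fin.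
  by rewrite -EFinM lee_fin mulrCA mulVf// mulr1.
have i2 : (\int[mu]_x (w * (x * K x) ^+ 2)%:E <= (8 * B ^+ 2)%:E)%E.
  under eq_integral do rewrite EFinM.
  have mxK : measurable_fun setT (fun x => ((x * K x) ^+ 2)%:E).
    by apply/measurable_EFinP; apply: measurable_funX; exact: measurable_funM.
  rewrite ge0_integralZl_EFin; [|by []|by move=> x _; rewrite lee_fin sqr_ge0|exact: mxK|exact: ltW].
  apply: (le_trans (lee_wpmul2l _ int_x2K2)); first by rewrite lee_fin ltW.
  by rewrite -EFinM lee_fin mulrC divfK.
have i3 : (\int[mu]_x (w * bump (w * x + 0))%:E <= pi%:E)%E.
  rewrite -(EFin_Rintegral (L1Z w lb)) (RintegralZE w lb) (Rintegral_affine 0 w1 L1_bump).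
  by rewrite Rintegral_bump lee_fin gtr0_norm// mulrA divff// mul1r.
have i123 := leeD i1 (leeD i2 i3).
apply: (le_trans (lee_wpmul2l _ i123)); first by rewrite lee_fin.
rewrite -!EFinD -EFinM lee_fin; have := pi_gt0 R; lra.
Qed.
End bound.
End kernel_bound.

(** * Complex-valued functions *)

Section complex_valued.
Context {R : realType}.
Local Notation mu := (@lebesgue_measure R).
Implicit Types (f g : R -> R[i]) (z : R[i]) (x y xi p : R).

Local Notation Re := complex.Re.
Local Notation Im := complex.Im.
Local Notation re f := (fun x => Re (f x)).
Local Notation im f := (fun x => Im (f x)).

Lemma cabsE z : cabs z = Num.sqrt (Re z ^+ 2 + Im z ^+ 2).
Proof. by case: z. Qed.

Lemma cabs_ge0 z : 0 <= cabs z.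
Proof. by rewrite cabsE sqrtr_ge0. Qed.

Lemma cabsM z1 z2 : cabs (z1 * z2) = cabs z1 * cabs z2.
Proof. exact: ComplexField.Normc.normcM. Qed.

Lemma normr_Re_le z : `|Re z| <= cabs z.
Proof. by rewrite cabsE -sqrtr_sqr ler_wsqrtr// lerDl sqr_ge0. Qed.

Lemma normr_Im_le z : `|Im z| <= cabs z.
Proof. by rewrite cabsE -sqrtr_sqr ler_wsqrtr// lerDr sqr_ge0. Qed.

Lemma cabs_le z : cabs z <= `|Re z| + `|Im z|.
Proof.
rewrite cabsE -[leRHS]ger0_norm ?addr_ge0// -sqrtr_sqr ler_wsqrtr// sqrrD.
by rewrite !real_normK ?num_real// addrAC lerDl mulrn_wge0// mulr_ge0.
Qed.

Lemma cabs_real x : cabs x%:C = `|x|.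
Proof. by rewrite cabsE /= expr0n addr0 sqrtr_sqr. Qed.

Lemma ReM z1 z2 : Re (z1 * z2) = Re z1 * Re z2 - Im z1 * Im z2.
Proof. by case: z1 z2 => [a b] [c d]. Qed.

Lemma ImM z1 z2 : Im (z1 * z2) = Re z1 * Im z2 + Im z1 * Re z2.
Proof. by case: z1 z2 => [a b] [c d]. Qed.

Lemma schwartz_continuous f : schwartz f -> continuous (re f) /\ continuous (im f).
Proof.
move=> [sm _]; split=> x; apply: differentiable_continuous; apply/derivable1_diffP.
  exact: (sm 0%N x).1.
exact: (sm 0%N x).2.
Qed.

(** The Schwartz bounds of orders [k] and [k + 2] add up to one for
    [(1 + x ^ 2) * |x| ^ k * |f|]. *)
Lemma schwartz_decay (k : nat) f : schwartz f ->
  exists C, forall x, `|x| ^+ k * cabs (f x) <= C * bump x.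
Proof.
move=> [_ dec]; have [C0 h0] := dec k 0%N; have [C2 h2] := dec k.+2 0%N.
have E x : cabs (cderiv 0 f x) = cabs (f x) by rewrite /cderiv /=; case: (f x).
exists (C0 + C2) => x; have := h0 x; have := h2 x; rewrite !E => k2 k0.
rewrite bumpE ler_pdivlMr; last by rewrite ltr_pwDl ?sqr_ge0.
rewrite mulrDr mulr1; apply: lerD => //; apply: le_trans k2.
by rewrite mulrAC -[x ^+ 2]real_normK ?num_real// -exprD addn2.
Qed.

Lemma schwartz_le f : schwartz f -> exists M, forall x, cabs (f x) <= M.
Proof.
move=> [_ dec]; have [M h] := dec 0%N 0%N; exists M => x; have := h x.
by rewrite expr0 mul1r /cderiv /=; case: (f x).
Qed.

(** The case [k = 0] gives integrability, the case [k = 1] the first moment that controls the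
    Lipschitz constant of the transform. *)
Lemma L1_decaying (k : nat) f (a : R -> R) : schwartz f -> continuous a ->
  (forall x, `|a x| <= cabs (f x)) -> L1 (fun x => `|x| ^+ k * `|a x|).
Proof.
move=> sf ca af; have [C h] := schwartz_decay k sf.
apply: L1_le (L1Z C L1_bump).
  apply: measurable_funM.
    apply: measurable_funX; apply: continuous_measurable_fun => y; exact: norm_continuous.
  by apply: measurableT_comp => //; exact: continuous_measurable_fun.
by move=> x; rewrite ger0_norm ?mulr_ge0 ?exprn_ge0// (le_trans _ (h x))// ler_wpM2l// exprn_ge0.
Qed.

Lemma schwartz_L1 f : schwartz f -> L1 (re f) /\ L1 (im f).
Proof.
move=> sf; have [cr ci] := schwartz_continuous sf.
split.
- have := L1_decaying 0 sf cr (fun x => normr_Re_le (f x)).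
  apply: L1_le; first exact: continuous_measurable_fun.
  by move=> x; rewrite expr0 mul1r.
- have := L1_decaying 0 sf ci (fun x => normr_Im_le (f x)).
  apply: L1_le; first exact: continuous_measurable_fun.
  by move=> x; rewrite expr0 mul1r.
Qed.

Lemma fourierE f xi : L1 (re f) -> L1 (im f) ->
  fourier f xi = (cosT (re f) xi + sinT (im f) xi) +i* (cosT (im f) xi - sinT (re f) xi).
Proof.
move=> lr li; rewrite /fourier /cint; congr (_ +i* _).
- rewrite -(RintegralDE (L1_cos xi lr) (L1_sin xi li)); apply: eq_Rintegral => x _.
  by rewrite ReM /= mulrN opprK.
- rewrite -(RintegralBE (L1_cos xi li) (L1_sin xi lr)); apply: eq_Rintegral => x _.
  by rewrite ImM /= mulrN addrC.
Qed.

Lemma cosTN (g : R -> R) xi : cosT g (- xi) = cosT g xi.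
Proof. by apply: eq_Rintegral => x _; rewrite mulrN cosN. Qed.

Lemma sinTN (g : R -> R) xi : L1 g -> sinT g (- xi) = - sinT g xi.
Proof.
move=> lg; rewrite -[- sinT g xi]mulN1r /sinT -(RintegralZE _ (L1_sin xi lg)).
by apply: eq_Rintegral => x _; rewrite mulrN sinN; ring.
Qed.

(* A real kernel is recovered from the values of the complex transform at [xi] and [- xi]. *)
Lemma transforms_of_fourier f xi : L1 (re f) -> L1 (im f) ->
  [/\ cosT (re f) xi = 2^-1 * (Re (fourier f xi) + Re (fourier f (- xi))),
      sinT (im f) xi = 2^-1 * (Re (fourier f xi) - Re (fourier f (- xi))),
      cosT (im f) xi = 2^-1 * (Im (fourier f xi) + Im (fourier f (- xi))) &
      sinT (re f) xi = 2^-1 * (Im (fourier f (- xi)) - Im (fourier f xi))].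
Proof.
move=> lr li; rewrite !fourierE// !cosTN !sinTN//=.
by split; field.
Qed.

Lemma convolutionE f g x :
  L1 (fun y => Re (f y) * Re (g (x - y))) -> L1 (fun y => Im (f y) * Im (g (x - y))) ->
  L1 (fun y => Re (f y) * Im (g (x - y))) -> L1 (fun y => Im (f y) * Re (g (x - y))) ->
  convolution f g x = (conv (re f) (re g) x - conv (im f) (im g) x) +i*
                      (conv (re f) (im g) x + conv (im f) (re g) x).
Proof.
move=> l1 l2 l3 l4; rewrite /convolution /cint; congr (_ +i* _).
- by rewrite -(RintegralBE l1 l2); apply: eq_Rintegral => y _; rewrite ReM.
- by rewrite -(RintegralDE l3 l4); apply: eq_Rintegral => y _; rewrite ImM.
Qed.

End complex_valued.

(** * Complex kernels and their real and imaginary parts *)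

Section family.
Context {R : realType}.
Local Notation mu := (@lebesgue_measure R).
Implicit Types (f g : R -> R[i]) (z : R[i]) (x y xi p B : R).

Local Notation Re := complex.Re.
Local Notation Im := complex.Im.
Local Notation re f := (fun x => Re (f x)).
Local Notation im f := (fun x => Im (f x)).

Lemma measurable_cabs f : measurable_fun setT (re f) -> measurable_fun setT (im f) ->
  measurable_fun setT (fun x => cabs (f x)).
Proof.
move=> mr mi; under eq_fun do rewrite cabsE.
apply: (measurableT_comp (continuous_measurable_fun (@sqrt_continuous R))).
by apply: measurable_funD; exact: measurable_funX.
Qed.

Lemma measurable_powR_comp (h : R -> R) p : measurable_fun setT h ->
  measurable_fun setT (fun x => h x `^ p).
Proof. by move=> mh; exact: (measurableT_comp (measurable_powR p) mh). Qed.

Lemma Lpnorm_powR p f : 0 < p ->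
  (\int[mu]_x (cabs (f x) `^ p)%:E = Lpnorm p f `^ p)%E.
Proof.
move=> p0; rewrite /Lpnorm (poweR_Lnorm _ _ (lt0r_neq0 p0)).
by apply: eq_integral => x _; rewrite /= ger0_norm ?cabs_ge0.
Qed.

Lemma in_Lp_L1 p f : 0 < p -> in_Lp p f -> L1 (fun x => cabs (f x) `^ p).
Proof.
move=> p0 [mr mi fin]; apply/L1P/integrableP; split.
  by apply/measurable_EFinP; apply: measurable_powR_comp; exact: measurable_cabs.
under eq_integral do rewrite gee0_abs ?lee_fin ?powR_ge0//.
by rewrite Lpnorm_powR// poweR_lty.
Qed.

Lemma sum_disjoint_le (s : seq int) (F : int -> R) c : uniq s -> 0 <= c ->
  (forall j, F j <= c) ->
  (forall j k, j \in s -> k \in s -> F j != 0 -> F k != 0 -> j = k) ->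
  \sum_(j <- s) F j <= c.
Proof.
move=> us c0 Fc dis.
have [/hasP[j js Fj]|/hasPn n] := boolP (has (fun j => F j != 0) s); last first.
  by rewrite big_seq big1// => j /n; rewrite negbK => /eqP.
rewrite (bigD1_seq j)//= big_seq_cond big1 ?addr0// => k /andP[ks kj].
by apply: contraNeq kj => Fk; apply/eqP; apply: dis.
Qed.

(** The sum is at most four times its largest term. Four terms, because a convolution of complex
    functions consists of four real ones. *)
Lemma powR_sum4_le (a b c d p : R) : 0 <= p -> 0 <= a -> 0 <= b -> 0 <= c -> 0 <= d ->
  (a + b + c + d) `^ p <= 4 `^ p * (a `^ p + b `^ p + c `^ p + d `^ p).
Proof.
move=> p0 a0 b0 c0 d0.
have h t : t \in [:: a; b; c; d] -> a + b + c + d <= 4 * t ->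
    (a + b + c + d) `^ p <= 4 `^ p * (a `^ p + b `^ p + c `^ p + d `^ p).
  move=> ts le; have t0 : 0 <= t by move: ts; rewrite !inE => /or4P[] /eqP ->.
  apply: (@le_trans _ _ ((4 * t) `^ p)).
    by apply: ge0_ler_powR => //; rewrite nnegrE ?mulr_ge0// !addr_ge0.
  rewrite powRM// ler_wpM2l ?powR_ge0//.
  have := powR_ge0 a p; have := powR_ge0 b p; have := powR_ge0 c p; have := powR_ge0 d p.
  by move: ts; rewrite !inE => /or4P[] /eqP -> *; lra.
have [ab|ab] := leP a b; have [cd|cd] := leP c d.
- have [bd|bd] := leP b d; [apply: (h d)|apply: (h b)]; rewrite ?inE ?eqxx ?orbT//; lra.
- have [bd|bd] := leP b c; [apply: (h c)|apply: (h b)]; rewrite ?inE ?eqxx ?orbT//; lra.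
- have [bd|bd] := leP a d; [apply: (h d)|apply: (h a)]; rewrite ?inE ?eqxx ?orbT//; lra.
- have [bd|bd] := leP a c; [apply: (h c)|apply: (h a)]; rewrite ?inE ?eqxx ?orbT//; lra.
Qed.

Section one_kernel.
Variables (Phi : R -> R[i]) (E : set R) (w B : R).
Hypotheses (sP : schwartz Phi) (mE : measurable E) (symE : forall xi, E xi -> E (- xi)).
Hypotheses (w0 : 0 < w) (Ew : (mu E <= w%:E)%E).
Hypothesis suppE : supported_in (fourier Phi) E.
Hypothesis hatB : forall xi, cabs (fourier Phi xi) <= B.
Hypothesis hatL : forall xi eta,
  cabs (fourier Phi xi - fourier Phi eta) <= B / w * `|xi - eta|.

Let lr : L1 (re Phi). Proof. exact: (schwartz_L1 sP).1. Qed.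
Let li : L1 (im Phi). Proof. exact: (schwartz_L1 sP).2. Qed.

Let nE xi : ~ E xi -> fourier Phi xi = 0 /\ fourier Phi (- xi) = 0.
Proof.
move=> nExi; split; apply: suppE => //.
by move=> /symE; rewrite opprK.
Qed.

Let half_le (a b c : R) : `|a| <= c -> `|b| <= c -> `|2^-1 * (a + b)| <= c.
Proof.
move=> ac bc; rewrite normrM ger0_norm//.
have := ler_normD a b; lra.
Qed.

Let half_leB (a b c : R) : `|a| <= c -> `|b| <= c -> `|2^-1 * (a - b)| <= c.
Proof. by move=> ac bc; apply: half_le; rewrite ?normrN. Qed.

Let ReB xi : `|Re (fourier Phi xi)| <= B. Proof. exact: le_trans (normr_Re_le _) (hatB xi). Qed.
Let ImB xi : `|Im (fourier Phi xi)| <= B. Proof. exact: le_trans (normr_Im_le _) (hatB xi). Qed.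

Let ReL xi eta : `|Re (fourier Phi xi) - Re (fourier Phi eta)| <= B / w * `|xi - eta|.
Proof.
apply: le_trans (hatL xi eta); apply: le_trans (normr_Re_le _).
by rewrite raddfB.
Qed.

Let ImL xi eta : `|Im (fourier Phi xi) - Im (fourier Phi eta)| <= B / w * `|xi - eta|.
Proof.
apply: le_trans (hatL xi eta); apply: le_trans (normr_Im_le _).
by rewrite raddfB.
Qed.

Let opp_dist xi eta : `|(- xi) - (- eta)| = `|xi - eta|.
Proof. by rewrite -opprD normrN. Qed.

Let ReLN xi eta : `|Re (fourier Phi (- xi)) - Re (fourier Phi (- eta))| <= B / w * `|xi - eta|.
Proof. by rewrite -(opp_dist xi eta); exact: ReL. Qed.

Let ImLN xi eta : `|Im (fourier Phi (- xi)) - Im (fourier Phi (- eta))| <= B / w * `|xi - eta|.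
Proof. by rewrite -(opp_dist xi eta); exact: ImL. Qed.

(** Every real transform is half a sum or difference of parts of [fourier Phi] at [xi] and [- xi],
    so bound and Lipschitz constant are inherited without loss, and the symmetry of [E] keeps the
    support in [E]. *)
Lemma schwartz_kernel_L1_le :
  \int[mu]_x `|Re (Phi x)| <= 6 * B ^+ 2 + pi /\
  \int[mu]_x `|Im (Phi x)| <= 6 * B ^+ 2 + pi.
Proof.
have [cr ci] := schwartz_continuous sP.
have [M hM] := schwartz_le sP.
have tr xi := transforms_of_fourier xi lr li.
split.
- apply: (@kernel_L1_le _ (re Phi) E M B w) => //.
  + by move=> x; exact: le_trans (normr_Re_le _) (hM x).
  + by move=> xi /nE[e1 e2]; have [-> _ _ _] := tr xi; rewrite e1 e2 /= addr0 mulr0.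
  + by move=> xi /nE[e1 e2]; have [_ _ _ ->] := tr xi; rewrite e1 e2 /= subr0 mulr0.
  + by move=> xi; have [-> _ _ _] := tr xi; exact: half_le.
  + by move=> xi; have [_ _ _ ->] := tr xi; exact: half_leB.
  + move=> xi eta; have [-> _ _ _] := tr xi; have [-> _ _ _] := tr eta.
    rewrite -mulrBr opprD addrACA; exact: half_le.
  + move=> xi eta; have [_ _ _ ->] := tr xi; have [_ _ _ ->] := tr eta.
    rewrite -mulrBr.
    rewrite (_ : _ - _ - _ = (Im (fourier Phi (- xi)) - Im (fourier Phi (- eta))) -
       (Im (fourier Phi xi) - Im (fourier Phi eta))); last by ring.
    exact: half_leB.
- apply: (@kernel_L1_le _ (im Phi) E M B w) => //.
  + by move=> x; exact: le_trans (normr_Im_le _) (hM x).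
  + by move=> xi /nE[e1 e2]; have [_ _ -> _] := tr xi; rewrite e1 e2 /= addr0 mulr0.
  + by move=> xi /nE[e1 e2]; have [_ -> _ _] := tr xi; rewrite e1 e2 /= subr0 mulr0.
  + by move=> xi; have [_ _ -> _] := tr xi; exact: half_le.
  + by move=> xi; have [_ -> _ _] := tr xi; exact: half_leB.
  + move=> xi eta; have [_ _ -> _] := tr xi; have [_ _ -> _] := tr eta.
    rewrite -mulrBr opprD addrACA; exact: half_le.
  + move=> xi eta; have [_ -> _ _] := tr xi; have [_ -> _ _] := tr eta.
    rewrite -mulrBr.
    rewrite (_ : _ - _ - _ = (Re (fourier Phi xi) - Re (fourier Phi eta)) -
       (Re (fourier Phi (- xi)) - Re (fourier Phi (- eta)))); last by ring.
    exact: half_leB.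
Qed.

Lemma schwartz_kernel_pw xi :
  [/\ pw (re Phi) xi <= 2 * B ^+ 2, pw (im Phi) xi <= 2 * B ^+ 2 &
      ~ E xi -> pw (re Phi) xi = 0 /\ pw (im Phi) xi = 0].
Proof.
have [e1 e2 e3 e4] := transforms_of_fourier xi lr li.
have sqr_le (a : R) : `|a| <= B -> a ^+ 2 <= B ^+ 2.
  by move=> ab; rewrite -real_normK ?num_real// ler_sqr ?nnegrE// (le_trans _ ab).
have b1 : (2^-1 * (Re (fourier Phi xi) + Re (fourier Phi (- xi)))) ^+ 2 <= B ^+ 2.
  by apply: sqr_le; exact: half_le.
have b2 : (2^-1 * (Re (fourier Phi xi) - Re (fourier Phi (- xi)))) ^+ 2 <= B ^+ 2.
  by apply: sqr_le; exact: half_leB.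
have b3 : (2^-1 * (Im (fourier Phi xi) + Im (fourier Phi (- xi)))) ^+ 2 <= B ^+ 2.
  by apply: sqr_le; exact: half_le.
have b4 : (2^-1 * (Im (fourier Phi (- xi)) - Im (fourier Phi xi))) ^+ 2 <= B ^+ 2.
  by apply: sqr_le; exact: half_leB.
rewrite /pw e1 e2 e3 e4; split; [lra|lra|].
by move=> /nE[-> ->] /=; rewrite !addr0 !subrr !mulr0 !expr0n/= addr0.
Qed.

End one_kernel.

Lemma in_Lp_parts p f : 0 < p -> in_Lp p f ->
  L1 (fun x => `|Re (f x)| `^ p) /\ L1 (fun x => `|Im (f x)| `^ p).
Proof.
move=> p0 fp; have lf := in_Lp_L1 p0 fp; have [mr mi _] := fp.
have h (a : R -> R) : measurable_fun setT a -> (forall x, `|a x| <= cabs (f x)) ->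
    L1 (fun x => `|a x| `^ p).
  move=> ma af; apply: L1_le lf.
    by apply: measurable_powR_comp; exact: measurableT_comp.
  move=> x; rewrite ger0_norm ?powR_ge0//.
  by apply: ge0_ler_powR; rewrite ?nnegrE ?cabs_ge0//; exact: ltW.
split; apply: h => // x; [exact: normr_Re_le|exact: normr_Im_le].
Qed.

Lemma convolution_schwartz p f Phi x : 1 <= p -> in_Lp p f -> schwartz Phi ->
  convolution f Phi x = (conv (re f) (re Phi) x - conv (im f) (im Phi) x) +i*
                        (conv (re f) (im Phi) x + conv (im f) (re Phi) x).
Proof.
move=> p1 fp sP; have p0 : 0 < p by exact: lt_le_trans p1.
have [lfr lfi] := in_Lp_parts p0 fp; have [mr mi _] := fp.
have [lr li] := schwartz_L1 sP; have [M hM] := schwartz_le sP.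
have br y : `|Re (Phi y)| <= M by exact: le_trans (normr_Re_le _) (hM y).
have bi y : `|Im (Phi y)| <= M by exact: le_trans (normr_Im_le _) (hM y).
apply: convolutionE.
- exact: L1_mul_reflect_powR p1 mr lfr lr br.
- exact: L1_mul_reflect_powR p1 mi lfi li bi.
- exact: L1_mul_reflect_powR p1 mr lfr li bi.
- exact: L1_mul_reflect_powR p1 mi lfi lr br.
Qed.

Lemma measurable_convolution p f Phi : 1 <= p -> in_Lp p f -> schwartz Phi ->
  measurable_fun setT (fun x => cabs (convolution f Phi x)).
Proof.
move=> p1 fp sP; have p0 : 0 < p by exact: lt_le_trans p1.
have [lfr lfi] := in_Lp_parts p0 fp; have [mr mi _] := fp.
have [lr li] := schwartz_L1 sP; have [M hM] := schwartz_le sP.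
have [cr ci] := schwartz_continuous sP.
have br y : `|Re (Phi y)| <= M by exact: le_trans (normr_Re_le _) (hM y).
have bi y : `|Im (Phi y)| <= M by exact: le_trans (normr_Im_le _) (hM y).
apply: measurable_cabs; under eq_fun do rewrite (convolution_schwartz _ p1 fp sP) /=.
  apply: measurable_funB; [exact: measurable_conv p1 mr lfr lr cr br|exact: measurable_conv p1 mi lfi li ci bi].
apply: measurable_funD; [exact: measurable_conv p1 mr lfr li ci bi|exact: measurable_conv p1 mi lfi lr cr br].
Qed.

End family.

(** * Families of Schwartz kernels with disjoint frequency supports *)

Section family_bound.
Context {R : realType}.
Local Notation mu := (@lebesgue_measure R).
Implicit Types (f g : R -> R[i]) (z : R[i]) (x y xi p B : R).

Local Notation Re := complex.Re.
Local Notation Im := complex.Im.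
Local Notation re f := (fun x => Re (f x)).
Local Notation im f := (fun x => Im (f x)).

Lemma ge0_integral_sum4 (a b c d : R -> R) :
  measurable_fun setT a -> measurable_fun setT b -> measurable_fun setT c -> measurable_fun setT d ->
  (forall x, 0 <= a x) -> (forall x, 0 <= b x) -> (forall x, 0 <= c x) -> (forall x, 0 <= d x) ->
  (\int[mu]_x (a x + b x + c x + d x)%:E = \int[mu]_x (a x)%:E + \int[mu]_x (b x)%:E +
    \int[mu]_x (c x)%:E + \int[mu]_x (d x)%:E)%E.
Proof.
have D (g h : R -> R) : measurable_fun setT g -> measurable_fun setT h ->
    (forall x, 0 <= g x) -> (forall x, 0 <= h x) ->
    (\int[mu]_x (g x + h x)%:E = \int[mu]_x (g x)%:E + \int[mu]_x (h x)%:E)%E.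
  move=> mg mh g0 h0; rewrite -ge0_integralD//.
  - by move=> x _; rewrite lee_fin.
  - exact/measurable_EFinP.
  - by move=> x _; rewrite lee_fin.
  - exact/measurable_EFinP.
move=> ma mb mc md a0 b0 c0 d0.
have mab : measurable_fun setT (fun x => a x + b x) by exact: measurable_funD.
have mabc : measurable_fun setT (fun x => a x + b x + c x) by exact: measurable_funD.
have ab0 x : 0 <= a x + b x by rewrite addr_ge0.
have abc0 x : 0 <= a x + b x + c x by rewrite addr_ge0.
by rewrite (D _ _ mabc md abc0 d0) (D _ _ mab mc ab0 c0) (D _ _ ma mb a0 b0).
Qed.

(** The interpolated bound is applied to each of the four real convolutions. At a fixed frequency at
    most one kernel of the list has a nonzero transform, so the squared multipliers sum to at most
    [2 * B ^ 2], and the constant depends only on [p] and [B]. *)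
Lemma schwartz_family_bound p B : 2 < p -> exists2 C, 0 <= C &
  forall (Phi : int -> R -> R[i]) (E : int -> set R) (w : int -> R) (s : seq int) f,
  (forall j, schwartz (Phi j)) -> (forall j, measurable (E j)) ->
  (forall j xi, E j xi -> E j (- xi)) ->
  (forall j, 0 < w j) -> (forall j, (mu (E j) <= (w j)%:E)%E) ->
  (forall j, supported_in (fourier (Phi j)) (E j)) ->
  (forall j xi, cabs (fourier (Phi j) xi) <= B) ->
  (forall j xi eta, cabs (fourier (Phi j) xi - fourier (Phi j) eta) <=
    B / w j * `|xi - eta|) ->
  uniq s -> (forall j k xi, j \in s -> k \in s -> E j xi -> E k xi -> j = k) ->
  in_Lp p f ->
  (\sum_(j <- s) \int[mu]_x (cabs (convolution f (Phi j) x) `^ p)%:E <=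
    C%:E * \int[mu]_x (cabs (f x) `^ p)%:E)%E.
Proof.
move=> p2; have p0 : 0 < p by lra.
have p1 : 1 <= p by lra.
have b1 : 0 < 6 * B ^+ 2 + pi :> R by rewrite ltr_wpDl ?pi_gt0// mulr_ge0 ?sqr_ge0.
have b2 : 0 <= 2 * B ^+ 2 by rewrite mulr_ge0 ?sqr_ge0.
have [C C0 bound] := conv_Lp_lp_bound p2 b1 b2.
exists (4 `^ p * (4 * C)); first by rewrite !mulr_ge0 ?powR_ge0.
move=> Phi E w s f sP mE symE w0 Ew suppE hatB hatL us dis fp.
have [lfr lfi] := in_Lp_parts p0 fp; have [mr mi _] := fp.
have lf := in_Lp_L1 p0 fp.
have [M hM] := choice (fun j => schwartz_le (sP j)).
have lr j := (schwartz_L1 (sP j)).1; have li j := (schwartz_L1 (sP j)).2.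
have cr j := (schwartz_continuous (sP j)).1; have ci j := (schwartz_continuous (sP j)).2.
have br j y : `|Re (Phi j y)| <= M j by exact: le_trans (normr_Re_le _) (hM j y).
have bi j y : `|Im (Phi j y)| <= M j by exact: le_trans (normr_Im_le _) (hM j y).
have l1 j := schwartz_kernel_L1_le (sP j) (mE j) (@symE j) (w0 j) (Ew j) (@suppE j) (@hatB j) (@hatL j).
have pwb j xi := schwartz_kernel_pw (sP j) (@symE j) (@suppE j) (@hatB j) xi.
have sr xi : \sum_(j <- s) pw (re (Phi j)) xi <= 2 * B ^+ 2.
  apply: sum_disjoint_le => // [j|j k js ks hj hk]; first by have [] := pwb j xi.
  apply: (dis j k xi js ks); apply: contrapT => nE.
    by have [_ _ /(_ nE)[h _]] := pwb j xi; rewrite h eqxx in hj.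
  by have [_ _ /(_ nE)[h _]] := pwb k xi; rewrite h eqxx in hk.
have si xi : \sum_(j <- s) pw (im (Phi j)) xi <= 2 * B ^+ 2.
  apply: sum_disjoint_le => // [j|j k js ks hj hk]; first by have [] := pwb j xi.
  apply: (dis j k xi js ks); apply: contrapT => nE.
    by have [_ _ /(_ nE)[_ h]] := pwb j xi; rewrite h eqxx in hj.
  by have [_ _ /(_ nE)[_ h]] := pwb k xi; rewrite h eqxx in hk.
have F1 := bound _ s _ M _ lr cr br (fun j => (l1 j).1) sr mr lfr.
have F2 := bound _ s _ M _ li ci bi (fun j => (l1 j).2) si mi lfi.
have F3 := bound _ s _ M _ li ci bi (fun j => (l1 j).2) si mr lfr.
have F4 := bound _ s _ M _ lr cr br (fun j => (l1 j).1) sr mi lfi.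
pose I := (\int[mu]_x (cabs (f x) `^ p)%:E)%E.
have part (a : R -> R) : measurable_fun setT a -> (forall x, `|a x| <= cabs (f x)) ->
    (C%:E * \int[mu]_x (`|a x| `^ p)%:E <= C%:E * I)%E.
  move=> ma af; apply: lee_wpmul2l; first by rewrite lee_fin.
  apply: ge0_le_integral => //.
  - by apply/measurable_EFinP; apply: measurable_powR_comp; exact: measurableT_comp.
  - by apply/measurable_EFinP; exact: L1_measurable.
  - move=> x _; rewrite lee_fin; apply: ge0_ler_powR; rewrite ?nnegrE ?cabs_ge0//; exact: ltW.
have Pr := part _ mr (fun x => normr_Re_le _).
have Pi := part _ mi (fun x => normr_Im_le _).
have F1' := le_trans F1 Pr; have F2' := le_trans F2 Pi.
have F3' := le_trans F3 Pr; have F4' := le_trans F4 Pi.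
have mc (a K : R -> R) (m : R) : measurable_fun setT a -> L1 (fun x => `|a x| `^ p) -> L1 K -> continuous K ->
    (forall x, `|K x| <= m) -> measurable_fun setT (fun x => `|conv a K x| `^ p).
  move=> ma la lK cK mK; apply: measurable_powR_comp.
  apply: measurableT_comp => //; exact: (measurable_conv p1 ma la lK cK mK).
pose T j := (\int[mu]_x (`|conv (re f) (re (Phi j)) x| `^ p)%:E + \int[mu]_x (`|conv (im f) (im (Phi j)) x| `^ p)%:E +
  \int[mu]_x (`|conv (re f) (im (Phi j)) x| `^ p)%:E + \int[mu]_x (`|conv (im f) (re (Phi j)) x| `^ p)%:E)%E.
have T0 j : (0 <= T j)%E.
  by apply: adde_ge0; [apply: adde_ge0; [apply: adde_ge0|]|];
    apply: integral_ge0 => x _; rewrite lee_fin powR_ge0.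
have step j : (\int[mu]_x (cabs (convolution f (Phi j) x) `^ p)%:E <= (4 `^ p)%:E * T j)%E.
  have m1 := mc _ _ _ mr lfr (lr j) (cr j) (br j).
  have m2 := mc _ _ _ mi lfi (li j) (ci j) (bi j).
  have m3 := mc _ _ _ mr lfr (li j) (ci j) (bi j).
  have m4 := mc _ _ _ mi lfi (lr j) (cr j) (br j).
  have mS := measurable_funD (measurable_funD (measurable_funD m1 m2) m3) m4.
  rewrite /T -(ge0_integral_sum4 m1 m2 m3 m4); try by move=> x; exact: powR_ge0.
  rewrite -ge0_integralZl_EFin; [|by []| | |exact: powR_ge0]; last 2 first.
  - by move=> x _; rewrite lee_fin !addr_ge0 ?powR_ge0.
  - by apply/measurable_EFinP; exact: mS.
  apply: ge0_le_integral; first by [].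
  - by move=> x _; rewrite lee_fin powR_ge0.
  - apply/measurable_EFinP; apply: measurable_powR_comp; exact: measurable_convolution p1 fp (sP j).
  - by apply: measurable_funeM; apply/measurable_EFinP; exact: mS.
  - move=> x _; rewrite -EFinM lee_fin.
    apply: le_trans (powR_sum4_le (ltW p0) (normr_ge0 _) (normr_ge0 _) (normr_ge0 _) (normr_ge0 _)).
    apply: ge0_ler_powR; rewrite ?nnegrE ?cabs_ge0 ?addr_ge0 ?(ltW p0)//.
    rewrite (convolution_schwartz _ p1 fp (sP j)); apply: le_trans (cabs_le _) _ => /=.
    rewrite -addrA; apply: lerD; [exact: ler_normB|exact: ler_normD].
apply: (@le_trans _ _ (\sum_(j <- s) (4 `^ p)%:E * T j)%E).
  by apply: lee_sum => j _; exact: step.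
rewrite -ge0_sume_distrr; last by move=> j _; exact: T0.
rewrite EFinM -muleA; apply: lee_wpmul2l; first by rewrite lee_fin powR_ge0.
rewrite /T 3!big_split.
apply: le_trans (leeD (leeD (leeD F1' F2') F3') F4') _.
rewrite /I -(EFin_Rintegral lf) -!EFinM -!EFinD lee_fin.
by rewrite le_eqVlt; apply/orP; left; apply/eqP; ring.
Qed.

End family_bound.

(** * Frequency pieces *)

Section dyadic_frequencies.
Context {R : realType}.
Local Notation mu := (@lebesgue_measure R).
Implicit Types (f g : R -> R[i]) (z : R[i]) (x y xi p B a b : R) (j k M gamma : int) (L : nat).

Local Notation Re := complex.Re.
Local Notation Im := complex.Im.
Local Notation re f := (fun x => Re (f x)).
Local Notation im f := (fun x => Im (f x)).

Lemma measurable_annulus a b : measurable (annulus a b).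
Proof.
rewrite (_ : annulus a b = (fun x : R => `|x|) @^-1` `[a, b]); last first.
  by apply/seteqP; split => x /=; rewrite in_itv.
rewrite -[X in measurable X]setTI.
have mn : measurable_fun setT (fun x : R => `|x|).
  by apply: continuous_measurable_fun => x; exact: norm_continuous.
exact: mn.
Qed.

Lemma annulus_sym a b xi : annulus a b xi -> annulus a b (- xi).
Proof. by rewrite /annulus/= normrN. Qed.

Lemma lebesgue_measure_annulus a b : 0 < a -> a <= b ->
  mu (annulus a b) = (2 * (b - a))%:E.
Proof.
move=> a0 ab; have b0 : 0 < b by exact: lt_le_trans ab.
rewrite (_ : annulus a b = `[a, b]%classic `|` `[- b, - a]%classic); last first.
  apply/seteqP; split => x /=; rewrite !in_itv/= /annulus/=.
    have [x0|x0] := leP 0 x; first by rewrite (ger0_norm x0); left.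
    by rewrite (ltr0_norm x0) => /andP[? ?]; right; apply/andP; split; lra.
  case=> /andP[h1 h2].
    by rewrite ger0_norm ?h1//; lra.
  by rewrite ltr0_norm; [apply/andP; split; lra|lra].
pose I1 : set R := `[a, b]%classic; pose I2 : set R := `[- b, - a]%classic.
have -> : mu (`[a, b]%classic `|` `[- b, - a]%classic) = (mu I1 + mu I2)%E.
  apply: measureU => //.
  by apply/seteqP; split => x //= [] /=; rewrite !in_itv/= => /andP[? ?] /andP[? ?]; lra.
rewrite /I1 /I2 !lebesgue_measure_itv/= !lte_fin ltrN2.
move: ab; rewrite le_eqVlt => /orP[/eqP ->|ab]; first by rewrite ltxx adde0 subrr mulr0.
by rewrite ab -!EFinD; congr EFin; ring.
Qed.

Lemma Adyad_gt0 L M j : 0 < Adyad R L M j.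
Proof. exact: exprz_gt0. Qed.

(** Five steps give [2 ^ 5 = 32], which exceeds the ratio of the radii of the annuli to be
    separated: 4 for [omega12] and 19 for the annular [omega3]. Four steps would give only 16. *)
Lemma Adyad_growth L M j k : (0 < L)%N -> j + 5 <= k -> 32 * Adyad R L M j <= Adyad R L M k.
Proof.
move=> L0 jk; have -> : Adyad R L M k = 2 ^ (L%:Z * (k - j)) * Adyad R L M j.
  by rewrite /Adyad -expfzDr//; congr (_ ^ _); ring.
rewrite ler_wpM2r//; first by rewrite ltW// Adyad_gt0.
have -> : 32 = 2 ^ (5%:Z) :> R by rewrite -exprnP !exprS expr0; ring.
rewrite ler_eXz2l ?ltr1n//.
have L1' : (1 : int) <= L%:Z by [].
have h5 : 5 <= k - j by rewrite lerBrDr addrC.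
have := ler_pM ler01 (ler0n _ 5) L1' h5; by rewrite mul1r.
Qed.

Lemma Zclass_separated gamma j k : Zclass gamma j -> Zclass gamma k -> j < k -> j + 5 <= k.
Proof.
rewrite /Zclass /= => jg kg jk.
have N8 : (8 : int) <= 2%:Z ^+ 100.
  rewrite -(subnK (isT : (3 <= 100)%N)) exprD.
  have h : (1 : int) <= 2%:Z ^+ (100 - 3) by rewrite exprn_ege1.
  have -> : 2%:Z ^+ 3 = 8 by [].
  by rewrite ler_peMl.
(* Of the modulus only [8 <= N] is retained, which leaves room for the gap 5 and keeps the power
   abstract. *)
move: (2%:Z ^+ 100) N8 jg kg => N N8 jg kg.
have : (N %| k - j)%Z by rewrite -eqz_mod_dvd; apply/eqP; rewrite kg jg.
move=> /dvdzP[q qE].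
have q1 : 1 <= q.
  have : 0 < q * N by rewrite -qE subr_gt0.
  have N0 : 0 < N by exact: lt_le_trans N8.
  by rewrite (pmulr_lgt0 _ N0) gtz0_ge1.
have : 1 * N <= q * N by rewrite ler_wpM2r// (le_trans _ N8).
rewrite mul1r -qE lerBrDr => h; apply: le_trans h.
by rewrite addrC lerD2r (le_trans _ N8).
Qed.

Lemma Zclass_growth L M gamma j k : (0 < L)%N -> Zclass gamma j -> Zclass gamma k -> j != k ->
  32 * Adyad R L M j <= Adyad R L M k \/ 32 * Adyad R L M k <= Adyad R L M j.
Proof.
move=> L0 jg kg; rewrite neq_lt => /orP[jk|kj].
  by left; apply: Adyad_growth => //; exact: (Zclass_separated jg kg jk).
by right; apply: Adyad_growth => //; exact: (Zclass_separated kg jg kj).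
Qed.

(* The annuli of a residue class are disjoint as soon as their ratio is less than 32. *)
Lemma annulus_disjoint L M gamma (alpha beta : R) j k xi : (0 < L)%N -> 0 < alpha ->
  beta < 32 * alpha -> Zclass gamma j -> Zclass gamma k ->
  annulus (alpha * Adyad R L M j) (beta * Adyad R L M j) xi ->
  annulus (alpha * Adyad R L M k) (beta * Adyad R L M k) xi -> j = k.
Proof.
move=> L0 a0 ab jg kg /andP[j1 j2] /andP[k1 k2].
apply/eqP; apply: contraT => jk; exfalso.
have Aj := Adyad_gt0 L M j; have Ak := Adyad_gt0 L M k.
by have [h|h] := Zclass_growth M L0 jg kg jk; nra.
Qed.

Lemma derivable_lipschitz (h : R -> R) (c : R) : (forall x, derivable h x 1) ->
  (forall x, `|derive1 h x| <= c) -> forall x y, `|h x - h y| <= c * `|x - y|.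
Proof.
move=> dh hc x y; wlog xy : x y / x <= y.
  by move=> H; have [/H//|/ltW/H] := leP x y; rewrite distrC (distrC y).
have dh' (z : R) : z \in `]x, y[ -> is_derive z 1 h (derive1 h z).
  by move=> _; apply: DeriveDef; [exact: dh|rewrite derive1E].
have ch : {within `[x, y], continuous h}.
  apply: continuous_subspaceT => z; apply: differentiable_continuous.
  exact/derivable1_diffP.
have [z _ e] := MVT_segment xy dh' ch.
by rewrite distrC e (distrC x) normrM ler_wpM2r.
Qed.
End dyadic_frequencies.

(** * Families of dilated and of adapted kernels *)

Section frequency_pieces.
Context {R : realType}.
Local Notation mu := (@lebesgue_measure R).
Implicit Types (f g : R -> R[i]) (z : R[i]) (x y xi eta p B a b : R) (j k M gamma : int) (L : nat).

Local Notation Re := complex.Re.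
Local Notation Im := complex.Im.
Local Notation re f := (fun x => Re (f x)).
Local Notation im f := (fun x => Im (f x)).

Lemma cos_lipschitz x y : `|cos x - cos y| <= `|x - y|.
Proof.
rewrite -[leRHS]mul1r; apply: derivable_lipschitz => z; first exact: derivable_cos.
by rewrite derive1E derive_val normrN normr_sin_le1.
Qed.

Lemma sin_lipschitz x y : `|sin x - sin y| <= `|x - y|.
Proof.
rewrite -[leRHS]mul1r; apply: derivable_lipschitz => z; first exact: derivable_sin.
by rewrite derive1E derive_val normr_cos_le1.
Qed.

Let phase_dist x xi eta : `|2 * pi * x * xi - 2 * pi * x * eta| = 2 * pi * `|xi - eta| * `|x|.
Proof.
rewrite -mulrBr !normrM (ger0_norm (pi_ge0 R)) ger0_norm//; ring.
Qed.

Lemma cosT_lipschitz (a : R -> R) xi eta : L1 a -> L1 (fun x => `|x| ^+ 1 * `|a x|) ->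
  `|cosT a xi - cosT a eta| <= 2 * pi * (\int[mu]_x (`|x| ^+ 1 * `|a x|)) * `|xi - eta|.
Proof.
move=> la lxa; rewrite /cosT -(RintegralBE (L1_cos xi la) (L1_cos eta la)).
rewrite mulrAC -(RintegralZE _ lxa); apply: Rintegral_normr_le.
- exact: L1B (L1_cos xi la) (L1_cos eta la).
- exact: L1Z.
- move=> x; rewrite -mulrBr normrM expr1 mulrA mulrC ler_wpM2r//.
  by rewrite -phase_dist; exact: cos_lipschitz.
Qed.

Lemma sinT_lipschitz (a : R -> R) xi eta : L1 a -> L1 (fun x => `|x| ^+ 1 * `|a x|) ->
  `|sinT a xi - sinT a eta| <= 2 * pi * (\int[mu]_x (`|x| ^+ 1 * `|a x|)) * `|xi - eta|.
Proof.
move=> la lxa; rewrite /sinT -(RintegralBE (L1_sin xi la) (L1_sin eta la)).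
rewrite mulrAC -(RintegralZE _ lxa); apply: Rintegral_normr_le.
- exact: L1B (L1_sin xi la) (L1_sin eta la).
- exact: L1Z.
- move=> x; rewrite -mulrBr normrM expr1 mulrA mulrC ler_wpM2r//.
  by rewrite -phase_dist; exact: sin_lipschitz.
Qed.

Lemma schwartz_fourier_lipschitz f : schwartz f -> exists B K,
  [/\ 0 <= B, 0 <= K, forall xi, cabs (fourier f xi) <= B &
      forall xi eta, cabs (fourier f xi - fourier f eta) <= K * `|xi - eta|].
Proof.
move=> sf; have [cr ci] := schwartz_continuous sf; have [lr li] := schwartz_L1 sf.
have lxr := L1_decaying 1 sf cr (fun x => normr_Re_le (f x)).
have lxi := L1_decaying 1 sf ci (fun x => normr_Im_le (f x)).
pose N1 := \int[mu]_x `|Re (f x)|; pose N2 := \int[mu]_x `|Im (f x)|.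
pose X1 := \int[mu]_x (`|x| ^+ 1 * `|Re (f x)|); pose X2 := \int[mu]_x (`|x| ^+ 1 * `|Im (f x)|).
have N10 : 0 <= N1 by apply: Rintegral_ge0.
have N20 : 0 <= N2 by apply: Rintegral_ge0.
have X10 : 0 <= X1 by apply: Rintegral_ge0 => x _; rewrite mulr_ge0.
have X20 : 0 <= X2 by apply: Rintegral_ge0 => x _; rewrite mulr_ge0.
exists (2 * (N1 + N2)), (2 * (2 * pi * X1 + 2 * pi * X2)); split.
- by rewrite mulr_ge0 ?addr_ge0.
- by rewrite mulr_ge0 ?addr_ge0 ?mulr_ge0 ?pi_ge0.
- move=> xi; apply: le_trans (cabs_le _) _; rewrite fourierE//=.
  have := cosT_le xi lr; have := cosT_le xi li; have := sinT_le xi lr; have := sinT_le xi li.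
  have := ler_normD (cosT (re f) xi) (sinT (im f) xi).
  have := ler_normB (cosT (im f) xi) (sinT (re f) xi).
  rewrite -/N1 -/N2; lra.
- move=> xi eta; apply: le_trans (cabs_le _) _; rewrite !fourierE//=.
  have := cosT_lipschitz xi eta lr lxr; have := cosT_lipschitz xi eta li lxi.
  have := sinT_lipschitz xi eta lr lxr; have := sinT_lipschitz xi eta li lxi.
  rewrite -/X1 -/X2.
  have -> : cosT (re f) xi + sinT (im f) xi - (cosT (re f) eta + sinT (im f) eta) =
    (cosT (re f) xi - cosT (re f) eta) + (sinT (im f) xi - sinT (im f) eta) by ring.
  have -> : cosT (im f) xi - sinT (re f) xi - (cosT (im f) eta - sinT (re f) eta) =
    (cosT (im f) xi - cosT (im f) eta) - (sinT (re f) xi - sinT (re f) eta) by ring.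
  have := ler_normD (cosT (re f) xi - cosT (re f) eta) (sinT (im f) xi - sinT (im f) eta).
  have := ler_normB (cosT (im f) xi - cosT (im f) eta) (sinT (re f) xi - sinT (re f) eta).
  lra.
Qed.

Lemma dilated_family_bound p L M (Phi : R -> R[i]) (Phis : int -> R -> R[i]) gamma :
  2 < p -> (0 < L)%N -> schwartz Phi -> supported_in (fourier Phi) `[1 / 2, 2] ->
  (forall j, schwartz (Phis j)) ->
  (forall j xi, fourier (Phis j) xi = fourier Phi (xi / Adyad R L M j)) ->
  exists2 C, 0 <= C & forall s f, uniq s -> (forall j, j \in s -> Zclass gamma j) ->
  in_Lp p f ->
  (\sum_(j <- s) \int[mu]_x (cabs (convolution f (Phis j) x) `^ p)%:E <=
    C%:E * \int[mu]_x (cabs (f x) `^ p)%:E)%E.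
Proof.
move=> p2 L0 sPhi suppPhi sPhis hat.
have [B [K [B0 K0 hB hK]]] := schwartz_fourier_lipschitz sPhi.
(* The scale is [w = 3 * A], the measure of [omega12], while the dilated transform has Lipschitz
   constant [K / A = 3 * K / w]; the summand [B] accounts for its size. *)
have [C C0 bound] := schwartz_family_bound (B + 3 * K) p2.
exists C => // s f us sZ fp.
have A0 j : 0 < Adyad R L M j by exact: Adyad_gt0.
have le12 j : Adyad R L M j / 2 <= 2 * Adyad R L M j by have := A0 j; lra.
apply: (bound Phis (omega12 L M) (fun j => 3 * Adyad R L M j) s f) => //.
- by move=> j; exact: measurable_annulus.
- by move=> j xi; exact: annulus_sym.
- by move=> j; rewrite mulr_gt0.
- move=> j; rewrite /omega12 lebesgue_measure_annulus ?divr_gt0// lee_fin; lra.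
- move=> j xi nE; rewrite hat; apply: suppPhi => /=; rewrite in_itv/= => /andP[h1 h2].
  apply: nE; have Aj := A0 j; rewrite /omega12 /annulus /=.
  (* The support of [fourier Phi] lies in the positive half-line, so only the positive half of the
     symmetric annulus is met. *)
  have x0 : 0 < xi / Adyad R L M j by lra.
  rewrite ger0_norm; last first.
    by rewrite -(pmulr_lge0 _ (x := (Adyad R L M j)^-1)) ?invr_gt0// ltW.
  move: h1 h2; rewrite ler_pdivlMr// ler_pdivrMr// => h1 h2; apply/andP; split; lra.
- by move=> j xi; rewrite hat (le_trans (hB _))// lerDl mulr_ge0.
- move=> j xi eta; rewrite !hat (le_trans (hK _ _))//.
  rewrite -mulrBl normrM (gtr0_norm (x := _^-1)) ?invr_gt0//.
  rewrite mulrA mulrAC ler_wpM2r// invfM mulrA ler_wpM2r ?invr_ge0 ?(ltW (A0 j))//.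
  rewrite ler_pdivlMr//; lra.
- move=> j k xi js ks; rewrite /omega12 ![_ / 2]mulrC.
  by apply: (@annulus_disjoint R L M gamma) => //; [lra|exact: sZ|exact: sZ].
Qed.

Lemma measurable_omega3 (L1 L2 : nat) (M1 M2 : int) j : measurable (@omega3 R L1 L2 M1 M2 j).
Proof.
rewrite /omega3; case: ifP => _; first exact: measurable_annulus.
case: ifP => _; first exact: measurable_annulus.
set b := 18 * _; rewrite (_ : [set xi : R | `|xi| <= b] = annulus 0 b); first exact: measurable_annulus.
by apply/seteqP; split => x /=; rewrite /annulus/= normr_ge0.
Qed.

Lemma omega3_sym (L1 L2 : nat) (M1 M2 : int) j xi :
  @omega3 R L1 L2 M1 M2 j xi -> @omega3 R L1 L2 M1 M2 j (- xi).
Proof.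
rewrite /omega3; case: ifP => _; first exact: annulus_sym.
case: ifP => _; first exact: annulus_sym.
by rewrite /= normrN.
Qed.

Lemma adapted_family_bound p (Phis : int -> R -> R[i]) (omega : int -> set R) (c : R) (k : int -> int) :
  2 < p -> 0 < c -> (forall j, schwartz (Phis j)) ->
  adapted_bumps (fun j => fourier (Phis j)) omega ->
  comparable_sizes c omega k ->
  (forall j, measurable (omega j)) -> (forall j xi, omega j xi -> omega j (- xi)) ->
  exists2 C, 0 <= C & forall s f, uniq s ->
  (forall j1 j2 xi, j1 \in s -> j2 \in s -> omega j1 xi -> omega j2 xi -> j1 = j2) ->
  in_Lp p f ->
  (\sum_(j <- s) \int[mu]_x (cabs (convolution f (Phis j) x) `^ p)%:E <=
    C%:E * \int[mu]_x (cabs (f x) `^ p)%:E)%E.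
Proof.
move=> p2 c0 sPhis [sm supp bd] cmp mom sym.
have [C0 h0] := bd 0%N; have [C1 h1] := bd 1%N.
(* [C0] bounds the transforms and [C1] their first derivatives, rescaled by the measure of
   [omega j]; the 2 comes from adding the Lipschitz bounds of real and imaginary parts. *)
have [C Cge bound] := schwartz_family_bound (`|C0| + 2 * `|C1|) p2.
exists C => // s f us dis fp.
pose w j := fine (mu (omega j)).
have wfin j : mu (omega j) = (w j)%:E.
  rewrite fineK// ge0_fin_numE//; apply: le_lt_trans (cmp j).2 _; exact: ltry.
have w0 j : 0 < w j.
  rewrite -lte_fin -wfin; apply: lt_le_trans (cmp j).1.
  by rewrite lte_fin mulr_gt0 ?invr_gt0// exprz_gt0.
apply: (bound Phis omega w s f) => //.
- by move=> j; rewrite wfin.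
- move=> j xi; have := h0 j xi; rewrite expr0 invr1 mulr1.
  have -> : cabs (cderiv 0 (fourier (Phis j)) xi) = cabs (fourier (Phis j) xi).
    by rewrite /cderiv /=; case: (fourier (Phis j) xi).
  have := ler_norm C0; have := normr_ge0 C1; lra.
- move=> j xi eta.
  have Lip (h : R -> R) : (forall x, derivable h x 1) ->
      (forall x, `|derive1 h x| <= cabs (cderiv 1 (fourier (Phis j)) x)) ->
      `|h xi - h eta| <= `|C1| / w j * `|xi - eta|.
    move=> dh hle; apply: derivable_lipschitz => // x.
    apply: le_trans (hle x) _; apply: le_trans (h1 j x) _.
    by rewrite expr1 -/(w j) ler_wpM2r ?ler_norm// invr_ge0 ltW.
  apply: le_trans (cabs_le _) _; rewrite !raddfB.
  have hr := Lip (fun x => Re (fourier (Phis j) x)) (fun x => (sm j 0%N x).1)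
    (fun x => normr_Re_le (cderiv 1 (fourier (Phis j)) x)).
  have hi := Lip (fun x => Im (fourier (Phis j) x)) (fun x => (sm j 0%N x).2)
    (fun x => normr_Im_le (cderiv 1 (fourier (Phis j)) x)).
  apply: le_trans (lerD hr hi) _; rewrite -mulrDl ler_wpM2r// -mulrDl ler_wpM2r ?invr_ge0 ?(ltW (w0 j))//.
  have := normr_ge0 C0; lra.
Qed.

End frequency_pieces.

(** * Time localization *)

Section localization.
Context {R : realType}.
Local Notation mu := (@lebesgue_measure R).
Implicit Types (f g : R -> R[i]) (z : R[i]) (x y : R) (j k n : int).

Local Notation Re := complex.Re.
Local Notation Im := complex.Im.

Lemma Rintegral_eq0 (h : R -> R) : (forall x, h x = 0) -> \int[mu]_x h x = 0.
Proof.
move=> h0; rewrite Rintegral_fine (_ : (fun x => (h x)%:E) = cst 0%E) ?integral0//.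
by apply/funext => x; rewrite h0.
Qed.

Lemma EFin_fine_le (x : \bar R) : (0 <= x)%E -> ((fine x)%:E <= x)%E.
Proof. by case: x => [r| |] //= _; rewrite leey. Qed.

(** [fine] replaces an infinite part by 0, which is still at most the true sum; divergent families
    are therefore covered. *)
Lemma normr_rsum_le (I : choiceType) (D : set I) (a : I -> R) :
  (`|rsum D a|%:E <= \esum_(i in D) `|a i|%:E)%E.
Proof.
rewrite /rsum; set P := \esum_(i in D) _; set N := \esum_(i in D) _.
have P0 : (0 <= P)%E by apply: esum_ge0 => i _; rewrite lee_fin le_max lexx orbT.
have N0 : (0 <= N)%E by apply: esum_ge0 => i _; rewrite lee_fin le_max lexx orbT.
have -> : \esum_(i in D) `|a i|%:E = (P + N)%E.
  rewrite -esumD; [|by move=> i _; rewrite lee_fin le_max lexx orbT..].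
  apply: eq_esum => i _; rewrite -EFinD; congr EFin.
  have [ai|ai] := leP 0 (a i).
    rewrite ger0_norm// (max_idPr _); last by rewrite oppr_le0.
    by rewrite addr0.
  rewrite ltr0_norm// (max_idPl _); last by rewrite oppr_ge0 ltW.
  by rewrite add0r.
apply: (@le_trans _ _ ((fine P)%:E + (fine N)%:E)%E).
  rewrite -EFinD lee_fin (le_trans (ler_normB _ _))//.
  by rewrite !ger0_norm// fine_ge0.
by apply: leeD; exact: EFin_fine_le.
Qed.

Lemma cabs_csum_le (I : choiceType) (D : set I) (a : I -> R[i]) :
  ((cabs (csum D a))%:E <= 2%:E * \esum_(i in D) (cabs (a i))%:E)%E.
Proof.
set S := \esum_(i in D) _.
have hr : (`|rsum D (fun i => Re (a i))|%:E <= S)%E.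
  apply: le_trans (normr_rsum_le _ _) _; apply: le_esum => i _.
  by rewrite lee_fin normr_Re_le.
have hi : (`|rsum D (fun i => Im (a i))|%:E <= S)%E.
  apply: le_trans (normr_rsum_le _ _) _; apply: le_esum => i _.
  by rewrite lee_fin normr_Im_le.
apply: (@le_trans _ _ (S + S)%E); last by rewrite mule_natl mule2n.
apply: le_trans (leeD hr hi); rewrite -EFinD lee_fin; exact: cabs_le.
Qed.

(* No measurability is needed: the integral of a nonnegative function is a supremum. *)
Lemma ge0_integral_mono (g h : R -> \bar R) : (forall x, 0 <= g x)%E ->
  (forall x, g x <= h x)%E -> (\int[mu]_x g x <= \int[mu]_x h x)%E.
Proof.
move=> g0 gh; have h0 x : (0 <= h x)%E by exact: le_trans (gh x).
rewrite (ge0_integralTE mu g0) (ge0_integralTE mu h0).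
apply: ereal_sup_le => _ [s sg <-]; exists s => // x.
exact: le_trans (gh x).
Qed.

(** The integrals of the positive and negative parts both lie between 0 and that of [G], hence so
    does the absolute value of their difference. *)
Lemma normr_Rintegral_le_dominated (h : R -> R) (G : R -> \bar R) :
  (forall x, `|h x|%:E <= G x)%E ->
  (`|\int[mu]_x h x|%:E <= \int[mu]_x G x)%E.
Proof.
move=> hG; rewrite Rintegral_fine integralE.
set g := fun x => (h x)%:E.
set P := (\int[mu]_x g^\+ x)%E; set N := (\int[mu]_x g^\- x)%E; set I := (\int[mu]_x G x)%E.
have P0 : (0 <= P)%E by apply: integral_ge0 => x _; exact: funepos_ge0.
have N0 : (0 <= N)%E by apply: integral_ge0 => x _; exact: funeneg_ge0.
have PI : (P <= I)%E.
  apply: ge0_integral_mono => x; first exact: funepos_ge0.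
  apply: le_trans (hG x); rewrite /g funeposE -fine_max//= ?lee_fin.
  by rewrite ge_max ler_norm normr_ge0.
have NI : (N <= I)%E.
  apply: ge0_integral_mono => x; first exact: funeneg_ge0.
  apply: le_trans (hG x); rewrite /g funenegE -fine_max//= ?lee_fin.
  by rewrite ge_max -normrN ler_norm normr_ge0.
have [Ify|Ify] := eqVneq I +oo%E; first by rewrite Ify leey.
have If : (I < +oo)%E by rewrite ltey.
have Pf : P \is a fin_num by rewrite ge0_fin_numE// (le_lt_trans PI).
have Nf : N \is a fin_num by rewrite ge0_fin_numE// (le_lt_trans NI).
have If' : I \is a fin_num by rewrite ge0_fin_numE// (le_trans P0).
move: PI NI P0 N0; rewrite -(fineK Pf) -(fineK Nf) -(fineK If') !lee_fin -EFinB /=.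
move: (fine P) (fine N) (fine I) => a b c ac bc a0 b0.
by rewrite ler_norml; apply/andP; split; lra.
Qed.

Lemma cabs_cint_le (F : R -> R[i]) (G : R -> \bar R) :
  (forall x, (cabs (F x))%:E <= G x)%E ->
  ((cabs (cint F))%:E <= 2%:E * \int[mu]_x G x)%E.
Proof.
move=> FG.
have hr : (`|\int[mu]_x Re (F x)|%:E <= \int[mu]_x G x)%E.
  apply: normr_Rintegral_le_dominated => x.
  by apply: le_trans (FG x); rewrite lee_fin normr_Re_le.
have hi : (`|\int[mu]_x Im (F x)|%:E <= \int[mu]_x G x)%E.
  apply: normr_Rintegral_le_dominated => x.
  by apply: le_trans (FG x); rewrite lee_fin normr_Im_le.
rewrite mule_natl mule2n; apply: le_trans (leeD hr hi).
by rewrite -EFinD lee_fin; exact: cabs_le.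
Qed.

(** The intervals are closed, so a common endpoint lies in two of them: [n] is the floor of
    [2 ^ k * y] or, at an endpoint, one less. The bound 2 thus holds at every point. *)
Lemma sum_indicator_dyadic_le (k : int) (s : seq int) y : uniq s ->
  \sum_(n <- s) (\1_(dyadic k n) y : R) <= 2.
Proof.
move=> us; pose m := Num.floor (2 ^ k * y).
have one (a : int) : \sum_(n <- s) ((n == a)%:R : R) <= 1.
  apply: sum_disjoint_le => //; first by move=> j; case: (_ == _).
  move=> j l _ _; rewrite !pnatr_eq0 !eqb0 !negbK => /eqP -> /eqP ->//.
have p2 : (0 : R) < 2 ^ k by exact: exprz_gt0.
apply: (@le_trans _ _ (\sum_(n <- s) (((n == m)%:R : R) + (n == m - 1)%:R))); last first.
  by rewrite big_split /= -[leRHS]/(1 + 1); exact: lerD.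
apply: ler_sum => n _; rewrite indicE.
case: (boolP (y \in _)) => [|_]; last by rewrite addr_ge0.
rewrite inE /dyadic/= in_itv/= => /andP[h1 h2].
have t1 : n%:~R <= 2 ^ k * y.
  by move: h1; rewrite -invr_expz mulrC ler_pdivrMr// mulrC.
have t2 : 2 ^ k * y <= (n + 1)%:~R.
  by move: h2; rewrite -invr_expz [X in _ <= X]mulrC ler_pdivlMr// mulrC.
have nm : n <= m by rewrite /m floor_ge_int.
have [->|nm'] := eqVneq n m; first by rewrite lerDl.
have n1m : n + 1 <= m by rewrite -ltzD1 ltrD2r lt_neqAle nm' nm.
have m1 : m <= n + 1.
  rewrite -(ler_int R); apply: le_trans t2; exact: floor_le.
have -> : n = m - 1 by apply/eqP; rewrite eq_sym subr_eq eq_le m1 n1m.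
by rewrite eqxx lerDr.
Qed.

Section bump_function.
Variable psi : R -> R.
Hypotheses (spsi : schwartz (fun x => (psi x)%:C)) (psi_ge0 : forall x, 0 <= psi x)
  (psi1 : fourier (fun x => (psi x)%:C) 0 = 1).

Let lpsi : L1 psi. Proof. exact: (schwartz_L1 spsi).1. Qed.

Let int_psi : \int[mu]_x psi x = 1.
Proof.
have [lr li] := schwartz_L1 spsi.
have := psi1; rewrite (fourierE _ lr li) => /(congr1 (@complex.Re R)) /=.
have -> : sinT (fun x => Im (psi x)%:C) 0 = 0.
  by apply: Rintegral_eq0 => x; rewrite mul0r.
rewrite addr0 => <-; apply: eq_Rintegral => x _.
by rewrite mulr0 cos0 mulr1.
Qed.

Let dilate_ge0 k x : 0 <= dilate psi k x.
Proof. by rewrite /dilate mulr_ge0 ?psi_ge0// exprz_ge0. Qed.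

Let L1_dilate k : L1 (dilate psi k).
Proof.
have a0 : (2 ^ k : R) != 0 by rewrite gt_eqF// exprz_gt0.
have := L1Z (2 ^ k) (L1_affine 0 a0 lpsi).
by rewrite (_ : (fun _ => _) = dilate psi k)//; apply/funext => x; rewrite addr0.
Qed.

Let int_dilate k : \int[mu]_x dilate psi k x = 1.
Proof.
have p0 : (0 : R) < 2 ^ k by exact: exprz_gt0.
have a0 : (2 ^ k : R) != 0 by rewrite gt_eqF.
transitivity (\int[mu]_x (2 ^ k * psi (2 ^ k * x + 0))).
  by apply: eq_Rintegral => x _; rewrite addr0.
rewrite (RintegralZE _ (L1_affine 0 a0 lpsi)) (Rintegral_affine 0 a0 lpsi) int_psi.
by rewrite gtr0_norm// mulr1 divff.
Qed.

Let measurable_dyadic k n : measurable (dyadic k n : set R).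
Proof. exact: measurable_itv. Qed.

Let L1_ind k n x : L1 (fun y => dilate psi k (x - y) * (\1_(dyadic k n) y : R)).
Proof.
apply: (L1_bounded_mul (L1_reflect x (L1_dilate k)) (M := 1)).
  exact: measurable_indic.
by move=> y; rewrite indicE; case: (_ \in _); rewrite ?normr1 ?normr0.
Qed.

Let one_starE k n x : one_star psi k n x =
  (\int[mu]_y (dilate psi k (x - y) * (\1_(dyadic k n) y : R)))%:C.
Proof.
rewrite /one_star /convolution /cint; congr (_ +i* _).
  by apply: eq_Rintegral => y _ /=; rewrite mul0r subr0 mulrC.
by apply: Rintegral_eq0 => y /=; rewrite mul0r mulr0 addr0.
Qed.

Let one_star_ge0 k n x :
  0 <= \int[mu]_y (dilate psi k (x - y) * (\1_(dyadic k n) y : R)).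
Proof. by apply: Rintegral_ge0 => y _; rewrite mulr_ge0. Qed.

(** By linearity the sum is one convolution of [dilate psi k], nonnegative of mass 1, with a sum of
    indicators bounded by 2. *)
Lemma sum_one_star_le k (s : seq int) x : uniq s ->
  \sum_(n <- s) cabs (one_star psi k n x) <= 2.
Proof.
move=> us.
pose I y := \sum_(n <- s) (\1_(dyadic k n) y : R).
have [lI ->] : L1 (fun y => dilate psi k (x - y) * I y) /\
    \sum_(n <- s) cabs (one_star psi k n x) = \int[mu]_y (dilate psi k (x - y) * I y).
  rewrite /I; elim: s {us I} => [|n s [lIs IH]].
    have l0 : L1 (fun y => dilate psi k (x - y) * \sum_(n <- [::]) (\1_(dyadic k n) y : R)).
      have := L1Z 0 lpsi; rewrite (_ : (fun _ => _) = fun=> 0); last by apply/funext => y; rewrite mul0r.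
      by rewrite (_ : (fun y => _ * _) = fun=> 0)//; apply/funext => y; rewrite big_nil mulr0.
    split=> //; rewrite big_nil.
    by rewrite Rintegral_eq0// => y; rewrite big_nil mulr0.
  have E : (fun y => dilate psi k (x - y) * \sum_(m <- n :: s) (\1_(dyadic k m) y : R)) =
      (fun y => dilate psi k (x - y) * (\1_(dyadic k n) y : R) +
        dilate psi k (x - y) * \sum_(m <- s) (\1_(dyadic k m) y : R)).
    by apply/funext => y; rewrite big_cons mulrDr.
  split; first by rewrite E; exact: L1D.
  rewrite big_cons IH one_starE cabs_real ger0_norm// -(RintegralDE (L1_ind k n x) lIs).
  by apply: eq_Rintegral => y _; rewrite big_cons mulrDr.
have ld := L1_reflect x (L1_dilate k).
apply: (@le_trans _ _ (\int[mu]_y (2 * dilate psi k (x - y)))).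
  apply: Rintegral_le => //; first exact: L1Z.
  by move=> y; rewrite mulrC ler_wpM2r// sum_indicator_dyadic_le.
by rewrite (RintegralZE 2 ld) (Rintegral_reflect x (L1_dilate k)) int_dilate mulr1.
Qed.

(** The convolution does not depend on [n] and leaves the sum, whose weights add up to at most 2;
    the other factor 2 comes from the separate real and imaginary sums in [csum]. *)
Lemma cabs_localized_le (k : int -> int) (S : set (int * int)) (Phi : int -> R -> R[i]) f j x :
  cabs (localized psi k S Phi f j x) <= 4 * cabs (convolution f (Phi j) x).
Proof.
rewrite -lee_fin; apply: le_trans (cabs_csum_le _ _) _.
rewrite (_ : 4 * _ = 2 * (2 * cabs (convolution f (Phi j) x))); last by ring.
rewrite EFinM; apply: lee_wpmul2l; first by rewrite lee_fin.
apply: ge_ereal_sup => _ [A [finA _] <-].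
rewrite (fsbig_finite _ _ finA) sumEFin lee_fin.
under eq_bigr do rewrite cabsM.
rewrite -mulr_suml ler_wpM2r ?cabs_ge0//; apply: sum_one_star_le.
exact: finmap.fset_uniq.
Qed.
End bump_function.
End localization.

(** * The trilinear estimate *)

Section trilinear.
Context {R : realType}.
Local Notation mu := (@lebesgue_measure R).
Implicit Types (a b c p : R).

(** With [t] the right-hand side, each factor is at most [t] to the power [1 / p_i], and these
    exponents add up to 1. *)
Lemma young3 a b c p1 p2 p3 : 0 <= a -> 0 <= b -> 0 <= c ->
  0 < p1 -> 0 < p2 -> 0 < p3 -> p1^-1 + p2^-1 + p3^-1 = 1 ->
  a * b * c <= a `^ p1 + b `^ p2 + c `^ p3.
Proof.
move=> a0 b0 c0 p10 p20 p30 p123; set t := _ + _ + _.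
have t0 : 0 <= t by rewrite !addr_ge0 ?powR_ge0.
have le (u q : R) : 0 <= u -> 0 < q -> u `^ q <= t -> u <= t `^ q^-1.
  move=> u0 q0 ut; have -> : u = (u `^ q) `^ q^-1 by rewrite -powRrM mulfV ?gt_eqF// powRr1.
  by apply: ge0_ler_powR; [rewrite invr_ge0 ltW|rewrite nnegrE powR_ge0|rewrite nnegrE|].
have := powR_ge0 a p1; have := powR_ge0 b p2; have := powR_ge0 c p3 => h3 h2 h1.
have ha : a <= t `^ p1^-1 by apply: le => //; rewrite /t; lra.
have hb : b <= t `^ p2^-1 by apply: le => //; rewrite /t; lra.
have hc : c <= t `^ p3^-1 by apply: le => //; rewrite /t; lra.
have -> : t = t `^ p1^-1 * t `^ p2^-1 * t `^ p3^-1.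
  rewrite -powRD; last by rewrite gt_eqF//= addr_gt0 ?invr_gt0.
  rewrite -powRD; last by rewrite p123 oner_eq0.
  by rewrite p123 powRr1.
by apply: ler_pM => //; [exact: mulr_ge0|exact: ler_pM].
Qed.

(** Monotone convergence along the enumeration [int_of_nat], whose initial segments are lists of
    distinct integers. *)
Lemma integral_esum_int_le (h : int -> R -> R) (M : \bar R) :
  (forall j, measurable_fun setT (h j)) -> (forall j x, 0 <= h j x) ->
  (forall s, uniq s -> (\sum_(j <- s) \int[mu]_x (h j x)%:E <= M)%E) ->
  (\int[mu]_x (\esum_(j in [set: int]) (h j x)%:E) <= M)%E.
Proof.
move=> mh h0 hM; have [_ einj _] := int_of_nat_bij.
have E x : \esum_(j in [set: int]) (h j x)%:E = (\sum_(n <oo) (h (int_of_nat n) x)%:E)%E.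
  rewrite nneseries_esumT; last by move=> n; rewrite lee_fin.
  exact: (reindex_esum _ _ _ (fun j => (h j x)%:E) int_of_nat_bij).
under eq_integral do rewrite E.
rewrite integral_nneseries; [|by []|by move=> n; apply/measurable_EFinP; exact: mh|by move=> n x _; rewrite lee_fin].
apply: lime_le; first by apply: is_cvg_nneseries => n _ _; apply: integral_ge0 => x _; rewrite lee_fin.
apply: nearW => n; have := hM (map int_of_nat (index_iota 0 n)); rewrite big_map; apply.
by rewrite map_inj_uniq ?iota_uniq// => m l; apply: einj; exact: in_setT.
Qed.

(** Hoelder's inequality by normalization: after division by the [N_i] the three power sums are at
    most [C_i], Young's inequality is applied pointwise, and multiplying back restores the product
    of the [N_i]. Each translation is removed inside its own integral, before the sum over [j]. *)
Lemma trilinear_le (p1 p2 p3 N1 N2 N3 C1 C2 C3 : R) (T1 T2 T3 : int -> R -> R)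
    (t1 t2 : int -> R) (s : seq int) :
  0 < p1 -> 0 < p2 -> 0 < p3 -> p1^-1 + p2^-1 + p3^-1 = 1 ->
  0 < N1 -> 0 < N2 -> 0 < N3 ->
  (forall j, measurable_fun setT (T1 j)) -> (forall j, measurable_fun setT (T2 j)) ->
  (forall j, measurable_fun setT (T3 j)) ->
  (forall j x, 0 <= T1 j x) -> (forall j x, 0 <= T2 j x) -> (forall j x, 0 <= T3 j x) ->
  (\sum_(j <- s) \int[mu]_x (T1 j x `^ p1)%:E <= (C1 * N1 `^ p1)%:E)%E ->
  (\sum_(j <- s) \int[mu]_x (T2 j x `^ p2)%:E <= (C2 * N2 `^ p2)%:E)%E ->
  (\sum_(j <- s) \int[mu]_x (T3 j x `^ p3)%:E <= (C3 * N3 `^ p3)%:E)%E ->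
  (\sum_(j <- s) \int[mu]_x (T1 j (x + t1 j) * T2 j (x + t2 j) * T3 j x)%:E <=
    (N1 * N2 * N3 * (C1 + C2 + C3))%:E)%E.
Proof.
move=> p10 p20 p30 p123 N10 N20 N30 m1 m2 m3 T10 T20 T30 h1 h2 h3.
pose N := N1 * N2 * N3; have N0 : 0 < N by rewrite !mulr_gt0.
have part (p n C : R) (T : int -> R -> R) (t : int -> R) : 0 < n -> (forall j, measurable_fun setT (T j)) ->
    (forall j x, 0 <= T j x) ->
    (\sum_(j <- s) \int[mu]_x (T j x `^ p)%:E <= (C * n `^ p)%:E)%E ->
    (\sum_(j <- s) \int[mu]_x ((n^-1 * T j (x + t j)) `^ p)%:E <= C%:E)%E.
  move=> n0 mT T0 h.
  have E j : (\int[mu]_x ((n^-1 * T j (x + t j)) `^ p)%:E = (n^-1 `^ p)%:E * \int[mu]_x (T j x `^ p)%:E)%E.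
    have mTp : measurable_fun setT (fun x => (T j x `^ p)%:E).
      by apply/measurable_EFinP; exact: measurable_powR_comp.
    rewrite -(ge0_integral_shift (t j) mTp); last by move=> x; rewrite lee_fin powR_ge0.
    rewrite -ge0_integralZl_EFin; [|by []|by move=> x _; rewrite lee_fin powR_ge0| |exact: powR_ge0].
      by apply: eq_integral => x _; rewrite powRM// invr_ge0 ltW.
    by apply: (measurableT_comp mTp); exact: measurable_funD.
  under eq_bigr do rewrite E.
  rewrite -ge0_sume_distrr; last by move=> j _; apply: integral_ge0 => x _; rewrite lee_fin powR_ge0.
  apply: (le_trans (lee_wpmul2l _ h)); first by rewrite lee_fin powR_ge0.
  rewrite -EFinM lee_fin mulrCA -powRM ?invr_ge0 ?(ltW n0)// mulVf ?gt_eqF// powR1 mulr1//.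
have h1' := part _ _ _ _ t1 N10 m1 T10 h1.
have h2' := part _ _ _ _ t2 N20 m2 T20 h2.
have h3' := part _ _ _ _ (fun=> 0) N30 m3 T30 h3.
have ms (p n t : R) (T : R -> R) : measurable_fun setT T ->
    measurable_fun setT (fun x : R => (n^-1 * T (x + t)) `^ p).
  move=> mT; apply: measurable_powR_comp; apply: measurable_funM => //.
  by apply: (measurableT_comp mT); exact: measurable_funD.
have step j : (\int[mu]_x (T1 j (x + t1 j) * T2 j (x + t2 j) * T3 j x)%:E <=
  N%:E * (\int[mu]_x ((N1^-1 * T1 j (x + t1 j)) `^ p1)%:E +
    (\int[mu]_x ((N2^-1 * T2 j (x + t2 j)) `^ p2)%:E +
     \int[mu]_x ((N3^-1 * T3 j (x + 0)) `^ p3)%:E)))%E.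
  have a1 := ms p1 N1 (t1 j) _ (m1 j).
  have a2 := ms p2 N2 (t2 j) _ (m2 j).
  have a3 := ms p3 N3 0 _ (m3 j).
  have a4 : measurable_fun setT (fun x : R => 0 : R) by [].
  have S := ge0_integral_sum4 a1 a2 a3 a4 (fun x => powR_ge0 _ _) (fun x => powR_ge0 _ _)
     (fun x => powR_ge0 _ _) (fun x => lexx 0).
  move: S; rewrite integral0 adde0 -addeA => <-.
  have mS := measurable_funD (measurable_funD (measurable_funD a1 a2) a3) a4.
  rewrite -ge0_integralZl_EFin; [|by []| | |exact: ltW]; last 2 first.
  - by move=> x _; rewrite lee_fin addr0 !addr_ge0 ?powR_ge0.
  - by apply/measurable_EFinP; exact: mS.
  apply: ge0_integral_mono => x; first by rewrite lee_fin !mulr_ge0.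
  rewrite -EFinM lee_fin !addr0.
  have -> : T1 j (x + t1 j) * T2 j (x + t2 j) * T3 j x =
     N * ((N1^-1 * T1 j (x + t1 j)) * (N2^-1 * T2 j (x + t2 j)) * (N3^-1 * T3 j x)).
    by rewrite /N; field; rewrite !gt_eqF.
  apply: ler_wpM2l; first exact: ltW.
  by apply: young3 => //; rewrite mulr_ge0// invr_ge0 ltW.
apply: (@le_trans _ _ (\sum_(j <- s) N%:E * (\int[mu]_x ((N1^-1 * T1 j (x + t1 j)) `^ p1)%:E +
    (\int[mu]_x ((N2^-1 * T2 j (x + t2 j)) `^ p2)%:E +
     \int[mu]_x ((N3^-1 * T3 j (x + 0)) `^ p3)%:E)))%E).
  by apply: lee_sum => j _; exact: step.
rewrite -ge0_sume_distrr; last first.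
  by move=> j _; apply: adde_ge0; [|apply: adde_ge0]; apply: integral_ge0 => x _; rewrite lee_fin powR_ge0.
rewrite -/N (EFinM N); apply: lee_wpmul2l; first by rewrite lee_fin ltW.
have E (a b c : int -> \bar R) : (\sum_(j <- s) (a j + (b j + c j)) =
    \sum_(j <- s) a j + (\sum_(j <- s) b j + \sum_(j <- s) c j))%E by rewrite !big_split.
rewrite E -addrA (EFinD C1) (EFinD C2).
exact: leeD h1' (leeD h2' h3').
Qed.

Lemma le_eps3 (x C a b c : R) :
  (forall e, 0 < e -> x <= (a + e) * (b + e) * (c + e) * C) -> x <= a * b * c * C.
Proof.
move=> h.
have ec : (n.+1%:R^-1 : R) @[n --> \oo] --> (0 : R) by exact: cvg_harmonic.
have lim (t : R) : (t + n.+1%:R^-1) @[n --> \oo] --> t.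
  by rewrite -[X in _ --> X]addr0; apply: cvgD => //; exact: cvg_cst.
have L : ((a + n.+1%:R^-1) * (b + n.+1%:R^-1) * (c + n.+1%:R^-1) * C) @[n --> \oo] -->
    a * b * c * C by apply: cvgMl; apply: cvgM => //; exact: cvgM.
rewrite -(cvg_lim _ L)//; apply: limr_ge; first by apply/cvg_ex; eexists; exact: L.
by apply: nearW => n; apply: h; rewrite invr_gt0.
Qed.
End trilinear.

(** * The form on separated scales *)

Section lacunary_form.
Context {R : realType}.
Local Notation mu := (@lebesgue_measure R).
Implicit Types (f : R -> R[i]) (p : R) (j n M gamma : int) (L : nat) (S : set (int * int)).

Lemma form_le (p1 p2 p3 N1 N2 N3 C1 C2 C3 K : R) (D : set int) (F : int -> R -> R[i])
    (T1 T2 T3 : int -> R -> R) (t1 t2 : int -> R) :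
  0 < p1 -> 0 < p2 -> 0 < p3 -> p1^-1 + p2^-1 + p3^-1 = 1 ->
  0 < N1 -> 0 < N2 -> 0 < N3 -> 0 <= K ->
  (forall j, measurable_fun setT (T1 j)) -> (forall j, measurable_fun setT (T2 j)) ->
  (forall j, measurable_fun setT (T3 j)) ->
  (forall j x, 0 <= T1 j x) -> (forall j x, 0 <= T2 j x) -> (forall j x, 0 <= T3 j x) ->
  (forall s, uniq s -> (forall j, j \in s -> D j) ->
    [/\ (\sum_(j <- s) \int[mu]_x (T1 j x `^ p1)%:E <= (C1 * N1 `^ p1)%:E)%E,
        (\sum_(j <- s) \int[mu]_x (T2 j x `^ p2)%:E <= (C2 * N2 `^ p2)%:E)%E &
        (\sum_(j <- s) \int[mu]_x (T3 j x `^ p3)%:E <= (C3 * N3 `^ p3)%:E)%E]) ->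
  (forall j x, D j -> cabs (F j x) <= K * (T1 j (x + t1 j) * T2 j (x + t2 j) * T3 j x)) ->
  (forall j x, ~ D j -> F j x = 0) ->
  cabs (cint (fun x => csum [set: int] (fun j => F j x))) <=
    N1 * N2 * N3 * (4 * K * (C1 + C2 + C3)).
Proof.
move=> p10 p20 p30 p123 N10 N20 N30 K0 m1 m2 m3 T10 T20 T30 hT FD F0.
pose g j (x : R) := T1 j (x + t1 j) * T2 j (x + t2 j) * T3 j x.
have g0 j x : 0 <= g j x by rewrite !mulr_ge0.
have mg j : measurable_fun setT (g j).
  apply: measurable_funM => //; apply: measurable_funM.
    by apply: (measurableT_comp (m1 j)); exact: measurable_funD.
  by apply: (measurableT_comp (m2 j)); exact: measurable_funD.
(* Extended by 0 off [D], so that the sum may run over all integers while only scales of [D] reach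
   the hypothesis [hT]. *)
pose h j (x : R) := if j \in D then 2 * K * g j x else 0.
have h0 j x : 0 <= h j x by rewrite /h; case: ifP => // _; rewrite !mulr_ge0.
have mh j : measurable_fun setT (h j).
  by rewrite /h; case: (j \in D) => //; exact: measurable_funM.
rewrite -lee_fin.
(* One factor 2 is spent on moving the modulus inside [cint], the other on moving it inside
   [csum]. *)
have -> : N1 * N2 * N3 * (4 * K * (C1 + C2 + C3)) =
    2 * (2 * K * (N1 * N2 * N3 * (C1 + C2 + C3))) by ring.
rewrite EFinM.
apply: (le_trans (@cabs_cint_le _ _ (fun x => \esum_(j in [set: int]) (h j x)%:E) _)).
  move=> x; apply: le_trans (cabs_csum_le _ _) _.
  rewrite mule_natl mule2n -esumD; [|by move=> j _; rewrite lee_fin cabs_ge0..].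
  apply: le_esum => j _; rewrite -EFinD lee_fin /h; case: ifPn => [|nj].
    by rewrite inE => /(FD _ x); rewrite -/(g j x); lra.
  have -> : F j x = 0 by apply: F0 => Dj; move: nj; rewrite mem_set.
  by rewrite (cabs_real 0) normr0 addr0.
apply: lee_wpmul2l; first by rewrite lee_fin.
apply: integral_esum_int_le => // s us.
pose t := [seq j <- s | j \in D].
have -> : (\sum_(j <- s) \int[mu]_x (h j x)%:E =
    \sum_(j <- t) (2 * K)%:E * \int[mu]_x (g j x)%:E)%E.
  rewrite /t big_filter [RHS]big_mkcond; apply: eq_bigr => j _; rewrite /h.
  case: ifP => _; last by rewrite integral0_eq.
  rewrite -ge0_integralZl_EFin; [|by []|by move=> x _; rewrite lee_fin| |by rewrite mulr_ge0].
    by apply: eq_integral => x _; rewrite -EFinM.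
  by apply/measurable_EFinP; exact: mg.
rewrite -ge0_sume_distrr; last by move=> j _; apply: integral_ge0 => x _; rewrite lee_fin.
rewrite (EFinM (2 * K)); apply: lee_wpmul2l; first by rewrite lee_fin mulr_ge0.
have [] := hT t (filter_uniq _ us).
  by move=> j; rewrite mem_filter => /andP[/set_mem].
exact: trilinear_le.
Qed.

Lemma localized_slice0 (psi : R -> R) (k : int -> int) S (Phi : int -> R -> R[i]) f j x :
  slice S j = set0 -> localized psi k S Phi f j x = 0.
Proof. by move=> S0; rewrite /localized /csum /rsum S0 !esum_set0 subrr. Qed.

Lemma lebesgue_measure_omega12 L M j : mu (omega12 L M j) = (3 * Adyad R L M j)%:E.
Proof.
have A0 := Adyad_gt0 (R := R) L M j.
by rewrite /omega12 lebesgue_measure_annulus ?divr_gt0//; [congr EFin; field|lra].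
Qed.

(** The scales at which [omega3] is an annulus rather than an interval around the origin. *)
Definition separated_scales (L1 L2 : nat) (M1 M2 : int) j :=
  Adyad R L2 M2 j < Adyad R L1 M1 j / 8 \/ Adyad R L1 M1 j < Adyad R L2 M2 j / 8.

(** The measures of the two annuli are in the same ratio as [A_1] and [A_2], and 1/10 is below the
    threshold 1/8 of [omega3]. *)
Lemma lacunary_part_separated (L1 L2 : nat) (M1 M2 : int) S j n :
  lacunary_part R L1 L2 M1 M2 S (j, n) -> separated_scales L1 L2 M1 M2 j.
Proof.
rewrite /lacunary_part /= !lebesgue_measure_omega12 -!EFinM !lee_fin.
have a0 := Adyad_gt0 (R := R) L1 M1 j; have b0 := Adyad_gt0 (R := R) L2 M2 j.
by case=> _ [h|h]; [left|right]; lra.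
Qed.

(** The equality of the two tests makes both annuli multiples of the same sequence, [A_1] or [A_2];
    an annulus of size [A_1] at one scale could well meet one of size [A_2] at another. *)
Lemma omega3_disjoint (L1 L2 : nat) (M1 M2 : int) gamma j k (xi : R) :
  (0 < L1)%N -> (0 < L2)%N -> Zclass gamma j -> Zclass gamma k ->
  separated_scales L1 L2 M1 M2 j -> separated_scales L1 L2 M1 M2 k ->
  (Adyad R L2 M2 j < Adyad R L1 M1 j / 8) = (Adyad R L2 M2 k < Adyad R L1 M1 k / 8) ->
  omega3 L1 L2 M1 M2 j xi -> omega3 L1 L2 M1 M2 k xi -> j = k.
Proof.
move=> L10 L20 jg kg sj sk E; rewrite /omega3 -E.
have dis L M : (0 < L)%N -> annulus (Adyad R L M j / 8) (19 * Adyad R L M j / 8) xi ->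
    annulus (Adyad R L M k / 8) (19 * Adyad R L M k / 8) xi -> j = k.
  move=> L0; rewrite ![_ / 8]mulrC ![8^-1 * (19 * _)]mulrA.
  by apply: (annulus_disjoint L0 _ _ jg kg); lra.
have [_|le] := ltP (Adyad R L2 M2 j) _; first exact: dis.
have -> : Adyad R L1 M1 j < Adyad R L2 M2 j / 8 by case: sj => // h; lra.
have -> : Adyad R L1 M1 k < Adyad R L2 M2 k / 8.
  by case: sk => //; rewrite -E ltNge le.
exact: dis.
Qed.

Lemma third_family_bound p (L1 L2 : nat) (M1 M2 : int) (Phis : int -> R -> R[i])
    (c : R) (k : int -> int) gamma :
  2 < p -> 0 < c -> (0 < L1)%N -> (0 < L2)%N -> (forall j, schwartz (Phis j)) ->
  adapted_bumps (fun j => fourier (Phis j)) (omega3 L1 L2 M1 M2) ->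
  comparable_sizes c (omega3 L1 L2 M1 M2) k ->
  exists2 C, 0 <= C & forall s f, uniq s ->
  (forall j, j \in s -> Zclass gamma j /\ separated_scales L1 L2 M1 M2 j) ->
  in_Lp p f ->
  (\sum_(j <- s) \int[mu]_x (cabs (convolution f (Phis j) x) `^ p)%:E <=
    C%:E * \int[mu]_x (cabs (f x) `^ p)%:E)%E.
Proof.
move=> p2 c0 L10 L20 sPhis bumps cmp.
have [C C0 bound] := adapted_family_bound p2 c0 sPhis bumps cmp
  (@measurable_omega3 R _ _ _ _) (@omega3_sym R _ _ _ _).
exists (C + C); first exact: addr_ge0.
move=> s f us hs fp.
pose a j := Adyad R L2 M2 j < Adyad R L1 M1 j / 8.
have dis b j1 j2 (xi : R) : j1 \in [seq j <- s | a j == b] -> j2 \in [seq j <- s | a j == b] ->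
    omega3 L1 L2 M1 M2 j1 xi -> omega3 L1 L2 M1 M2 j2 xi -> j1 = j2.
  rewrite !mem_filter => /andP[/eqP e1 /hs[z1 s1]] /andP[/eqP e2 /hs[z2 s2]].
  by apply: (omega3_disjoint L10 L20 z1 z2 s1 s2); rewrite -/(a j1) -/(a j2) e1 e2.
have part b := bound _ f (filter_uniq (fun j => a j == b) us) (dis b) fp.
have E (F : int -> \bar R) : (\sum_(j <- s) F j =
    \sum_(j <- [seq j <- s | a j == true]) F j + \sum_(j <- [seq j <- s | a j == false]) F j)%E.
  rewrite !big_filter [LHS](bigID (fun j => a j == true)); congr (_ + _)%E.
  by apply: eq_bigl => j; case: (a j).
rewrite E EFinD ge0_muleDl ?lee_fin//; exact: leeD (part true) (part false).
Qed.

End lacunary_form.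

Theorem proposition5p1 (R : realType)
  (L1 L2 : nat) (M1 M2 : int) (hL1 : (0 < L1)%N) (hL2 : (0 < L2)%N)
  (Phi : R -> R[i]) (hPhi : schwartz Phi)
  (hPhi_supp : supported_in (fourier Phi) `[1 / 2, 2])
  (Phi1 Phi2 Phi3 : int -> R -> R[i])
  (hPhi1 : forall j, schwartz (Phi1 j))
  (hPhi1_hat : forall j xi, fourier (Phi1 j) xi = fourier Phi (xi / Adyad R L1 M1 j))
  (hPhi2 : forall j, schwartz (Phi2 j))
  (hPhi2_hat : forall j xi, fourier (Phi2 j) xi = fourier Phi (xi / Adyad R L2 M2 j))
  (hPhi3 : forall j, schwartz (Phi3 j))
  (hPhi3_bump : adapted_bumps (fun j => fourier (Phi3 j))
     (omega3 L1 L2 M1 M2))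
  (hPhi3_one : forall j xi, plateau3 L1 L2 M1 M2 j xi ->
     fourier (Phi3 j) xi = 1)
  (psi : R -> R) (hpsi : schwartz (fun x => (psi x)%:C))
  (hpsi_ge0 : forall x, 0 <= psi x)
  (hpsi_supp : supported_in (fourier (fun x => (psi x)%:C))
     `[- (1 / 100), 1 / 100])
  (hpsi_one : fourier (fun x => (psi x)%:C) 0 = 1)
  (c : R) (k1 k2 k3 : int -> int)
  (hc : 0 < c)
  (hk1 : comparable_sizes c (omega12 L1 M1) k1)
  (hk2 : comparable_sizes c (omega12 L2 M2) k2)
  (hk3 : comparable_sizes c (omega3 L1 L2 M1 M2) k3)
  (gamma : int) (hgamma : 0 <= gamma < 2%:Z ^+ 100)
  (S : set (int * int)) (hS : S `<=` Zclass gamma `*` [set: int])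
  (p1 p2 r r' : R) (hp1 : 2 < p1) (hp2 : 2 < p2) (hr : 1 < r < 2)
  (hp : 1 / p1 + 1 / p2 = 1 / r) (hr' : 1 / r + 1 / r' = 1) :
  exists C : R, forall (m : nat) (f1 f2 f3 : R -> R[i]),
    in_Lp p1 f1 -> in_Lp p2 f2 -> in_Lp r' f3 ->
    ((cabs (Lambda L1 L2 M1 M2 psi (kmin k1 k2 k3) Phi1 Phi2 Phi3
              (lacunary_part R L1 L2 M1 M2 S) m f1 f2 f3))%:E
     <= C%:E * Lpnorm p1 f1 * Lpnorm p2 f2 * Lpnorm r' f3)%E.
Proof.
(* Some tactics below would otherwise try to evaluate [2 ^+ 100]. *)
clear hgamma.
have rp : 0 < r by case/andP: hr => h _; exact: lt_trans h.
have p1p : 0 < p1 by lra.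
have p2p : 0 < p2 by lra.
(* [1 / r' = 1 - 1 / r] lies strictly between 0 and 1/2 because [1 < r < 2]. *)
have r'2 : 2 < r'.
  have i2 : 2^-1 < r^-1 by case/andP: hr => _ h; rewrite ltf_pV2 ?posrE.
  have i1 : r^-1 < 1 by case/andP: hr => h _; rewrite invf_lt1.
  have e : r'^-1 = 1 - r^-1 by move: hr'; rewrite !div1r; lra.
  have r'p : 0 < r' by rewrite -invr_gt0 e; lra.
  by rewrite -ltf_pV2 ?posrE// e; lra.
have r'p : 0 < r' by lra.
have p123 : p1^-1 + p2^-1 + r'^-1 = 1 by move: hp hr'; rewrite !div1r => ->.
have [C1 C10 bound1] := dilated_family_bound gamma hp1 hL1 hPhi hPhi_supp hPhi1 hPhi1_hat.
have [C2 C20 bound2] := dilated_family_bound gamma hp2 hL2 hPhi hPhi_supp hPhi2 hPhi2_hat.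
have [C3 C30 bound3] := third_family_bound gamma r'2 hc hL1 hL2 hPhi3 hPhi3_bump hk3.
(* 64 is the cube of the factor 4 lost in each time localization; the other 4 is that of [form_le].
   The constant is fixed before [m] is introduced. *)
exists (4 * 64 * (C1 + C2 + C3)) => m f1 f2 f3 f1p f2p f3p.
have fin (p : R) (f : R -> R[i]) : in_Lp p f -> Lpnorm p f = (fine (Lpnorm p f))%:E.
  by case=> _ _ h; rewrite fineK// ge0_fin_numE// Lnorm_ge0.
have bnd (p : R) (f : R -> R[i]) (Phis : int -> R -> R[i]) (C : R) s (e : R) : 0 < p -> 0 <= C -> 0 < e -> in_Lp p f ->
    (\sum_(j <- s) \int[lebesgue_measure]_x (cabs (convolution f (Phis j) x) `^ p)%:E <=
      C%:E * \int[lebesgue_measure]_x (cabs (f x) `^ p)%:E)%E ->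
    (\sum_(j <- s) \int[lebesgue_measure]_x (cabs (convolution f (Phis j) x) `^ p)%:E <=
      (C * (fine (Lpnorm p f) + e) `^ p)%:E)%E.
  move=> p0 C0 e0 fp h; apply: le_trans h _; rewrite EFinM.
  apply: lee_wpmul2l; first by rewrite lee_fin.
  have n0 : 0 <= fine (Lpnorm p f) by rewrite fine_ge0// Lnorm_ge0.
  rewrite (Lpnorm_powR _ p0) {1}(fin _ _ fp) poweR_EFin lee_fin.
  apply: ge0_ler_powR; [exact: ltW|by rewrite nnegrE|by rewrite nnegrE addr_ge0// ltW|].
  by rewrite lerDl ltW.
rewrite (fin _ _ f1p) (fin _ _ f2p) (fin _ _ f3p) -!EFinM lee_fin.
set a := fine _; set b := fine _; set c' := fine _.
rewrite (_ : _ * _ * _ * _ = a * b * c' * (4 * 64 * (C1 + C2 + C3))); last by ring.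
(* The norms, which may vanish, are enlarged because [trilinear_le] divides by them. *)
apply: le_eps3 => e e0.
have n1 : 0 <= a by rewrite fine_ge0// Lnorm_ge0.
have n2 : 0 <= b by rewrite fine_ge0// Lnorm_ge0.
have n3 : 0 <= c' by rewrite fine_ge0// Lnorm_ge0.
pose T f (Phis : int -> R -> R[i]) (j : int) (x : R) := cabs (convolution f (Phis j) x).
have ae : 0 < a + e by rewrite ltr_wpDl.
have be : 0 < b + e by rewrite ltr_wpDl.
have ce : 0 < c' + e by rewrite ltr_wpDl.
apply: (@form_le R p1 p2 r' (a + e) (b + e) (c' + e) C1 C2 C3 64
  [set j | Zclass gamma j /\ separated_scales (R := R) L1 L2 M1 M2 j] _
  (T f1 Phi1) (T f2 Phi2) (T f3 Phi3)
  (fun j => 2 ^ (m%:Z - j * L1%:Z - M1)) (fun j => 2 ^ (m%:Z - j * L2%:Z - M2))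
  p1p p2p r'p p123 ae be ce (ler0n _ _)).
- by move=> j; apply: (measurable_convolution _ f1p) => //; lra.
- by move=> j; apply: (measurable_convolution _ f2p) => //; lra.
- by move=> j; apply: (measurable_convolution _ f3p) => //; lra.
- by move=> j x; exact: cabs_ge0.
- by move=> j x; exact: cabs_ge0.
- by move=> j x; exact: cabs_ge0.
- move=> s us hs; split; apply: bnd => //.
  + by apply: bound1 => // j /hs[].
  + by apply: bound2 => // j /hs[].
  + exact: bound3.
- move=> j x _; rewrite !cabsM.
  rewrite (_ : 64 * _ = 4 * T f1 Phi1 j (Tr L1 M1 m j x) * (4 * T f2 Phi2 j (Tr L2 M2 m j x)) *
    (4 * T f3 Phi3 j x)); last by rewrite /Tr; ring.
  have loc := cabs_localized_le hpsi hpsi_ge0 hpsi_one.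
  by apply: ler_pM; rewrite ?mulr_ge0 ?cabs_ge0//; apply: ler_pM; rewrite ?cabs_ge0.
(* At any other scale the slice of the lacunary part is empty, so that already the third factor is
   an empty sum. *)
- move=> j x nj; rewrite [X in _ * X]localized_slice0 ?mulr0//.
  apply/seteqP; split => // n /= Sn; apply: nj; split; last exact: lacunary_part_separated Sn.
  by have [] := hS _ Sn.1.
Qed.
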